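(* Fix $\alpha>0$ and $\kappa>0$, and let $\Lambda_W=(0,0,0,\kappa)\in\mathbb{R}^4$. For all parameters $\Lambda=(H_1,H_2,H_3,K_2)$ sufficiently close to $\Lambda_W$, there exists a solution $\hat{\mathbf m}=\hat{\mathbf m}(\xi;\Lambda)\in S^2$, with velocity $V=V(\Lambda)\in\mathbb{R}$, of the travelling-wave equation $$V\hat{\mathbf m}'+\alpha V\,\hat{\mathbf m}\times\hat{\mathbf m}'+\hat{\mathbf m}\times\mathbf H(\hat{\mathbf m})=0,\qquad \lim_{\xi\to\pm\infty}\hat{\mathbf m}(\xi)=\hat{\mathbf m}^\Lambda_\pm ,$$ where $\mathbf H(\hat{\mathbf m})=\hat{\mathbf m}''+(\hat{\mathbf m}\cdot\hat{\mathbf x})\hat{\mathbf x}-K_2(\hat{\mathbf m}\cdot\hat{\mathbf y})\hat{\mathbf y}+H_1\hat{\mathbf x}+H_2\hat{\mathbf y}+H_3\hat{\mathbf z}$. Both $\hat{\mathbf m}$ and $V$ are continuously differentiable in $\Lambda$, and for $\Lambda=\Lambda_W$, $\hat{\mathbf m}$ coincides with the static profile $\hat{\mathbf m}_W(\xi)=(\tanh\xi,0,\operatorname{sech}\xi)$.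
   Context: $\hat{\mathbf x},\hat{\mathbf y},\hat{\mathbf z}$ is the standard basis of $\mathbb{R}^3$, $S^2\subset\mathbb{R}^3$ is the unit sphere, and primes denote $d/d\xi$, $\xi\in\mathbb{R}$. For $\Lambda=(H_1,H_2,H_3,K_2)$ and $\mathbf H_a=H_1\hat{\mathbf x}+H_2\hat{\mathbf y}+H_3\hat{\mathbf z}$, the potential is $$U^\Lambda(\hat{\mathbf m})=\tfrac12\left(1-(\hat{\mathbf m}\cdot\hat{\mathbf x})^2+K_2(\hat{\mathbf m}\cdot\hat{\mathbf y})^2-2\mathbf H_a\cdot\hat{\mathbf m}\right),\qquad \hat{\mathbf m}\in S^2.$$ The boundary values $\hat{\mathbf m}^\Lambda_\pm\in S^2$ are distinct local minima of $U^\Lambda$ on $S^2$ with $\hat{\mathbf x}\cdot\hat{\mathbf m}^\Lambda_+>0$ and $\hat{\mathbf x}\cdot\hat{\mathbf m}^\Lambda_-<0$. The travelling-wave equation is obtained by substituting $\hat{\mathbf M}(x,t)=\hat{\mathbf m}(\xi)$, $\xi=x-Vt$, in the Landau--Lifshitz--Gilbert equation $\hat{\mathbf M}_t+\alpha\hat{\mathbf M}\times\hat{\mathbf M}_t=\hat{\mathbf M}\times\mathbf H(\hat{\mathbf M})$, in which $\alpha$ is the Gilbert damping constant. *)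

(* Defs.v *)
From Stdlib Require Import Reals.
From Coquelicot Require Import Coquelicot.
Open Scope R_scope.

(** Vectors of R^3 and parameters (H1, H2, H3, K2) in R^4 are left-nested pairs,
    which carry Coquelicot's product [NormedModule] structure; its norm is
    equivalent to the Euclidean one. *)
Definition vec3 : Type := (R * R * R)%type.
Definition param : Type := (R * R * R * R)%type.

Definition xhat : vec3 := (1, 0, 0).
Definition yhat : vec3 := (0, 1, 0).
Definition zhat : vec3 := (0, 0, 1).

Definition dot (u v : vec3) : R :=
  let '(u1, u2, u3) := u in let '(v1, v2, v3) := v in
  u1 * v1 + u2 * v2 + u3 * v3.

Definition cross (u v : vec3) : vec3 :=
  let '(u1, u2, u3) := u in let '(v1, v2, v3) := v in
  (u2 * v3 - u3 * v2, u3 * v1 - u1 * v3, u1 * v2 - u2 * v1).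

Definition vadd (u v : vec3) : vec3 := plus u v.
Definition vscal (a : R) (u : vec3) : vec3 := scal a u.
Definition vzero : vec3 := zero.

Declare Scope vec3_scope.
Delimit Scope vec3_scope with vec3.
Infix "+" := vadd : vec3_scope.
Infix "*" := vscal : vec3_scope.

Definition sphere (m : vec3) : Prop := dot m m = 1.

Definition applied_field (L : param) : vec3 :=
  let '(H1, H2, H3, _) := L in (H1 * xhat + H2 * yhat + H3 * zhat)%vec3.

Definition anisotropy (L : param) : R := let '(_, _, _, K2) := L in K2.

Definition potential (L : param) (m : vec3) : R :=
  / 2 * (1 - dot m xhat ^ 2 + anisotropy L * dot m yhat ^ 2
         - 2 * dot (applied_field L) m).

Definition local_min_on_sphere (U : vec3 -> R) (m : vec3) : Prop :=
  sphere m /\ within sphere (locally m) (fun n => U m <= U n).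

Definition boundary_values (L : param) (mp mm : vec3) : Prop :=
  mp <> mm
  /\ local_min_on_sphere (potential L) mp
  /\ local_min_on_sphere (potential L) mm
  /\ dot xhat mp > 0
  /\ dot xhat mm < 0.

(** The field H(m) at a point where m has the value [m] and its second
    derivative in xi has the value [m'']. *)
Definition effective_field (L : param) (m m'' : vec3) : vec3 :=
  (m'' + dot m xhat * xhat + (- anisotropy L * dot m yhat)%R * yhat
   + applied_field L)%vec3.

Definition travelling_wave (alpha : R) (L : param) (V : R) (m : R -> vec3) : Prop :=
  (forall xi, sphere (m xi)) /\
  exists m' m'' : R -> vec3, forall xi : R,
    is_derive m xi (m' xi) /\ is_derive m' xi (m'' xi) /\
    (V * m' xi + (alpha * V)%R * cross (m xi) (m' xi)
     + cross (m xi) (effective_field L (m xi) (m'' xi)))%vec3 = vzero.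

Definition Walker_param (kappa : R) : param := (0, 0, 0, kappa).

Definition Walker_profile (xi : R) : vec3 := (tanh xi, 0, / cosh xi).

(** In finite dimension, continuity of the Frechet derivative in operator norm is
    the same as continuity of its value at each fixed direction [h]. *)
Definition C1_on (D : param -> Prop) (f : param -> R) : Prop :=
  exists df : param -> param -> R, forall L : param, D L ->
    filterdiff f (locally L) (df L) /\
    forall h : param, continuous (fun L' => df L' h) L.

(** For a function of (xi, L), "continuously differentiable in L": the derivative
    in L exists everywhere and is continuous as a function of (xi, L). *)
Definition C1_in_param_on (D : param -> Prop) (f : R -> param -> vec3) : Prop :=
  exists df : R -> param -> param -> vec3, forall (xi : R) (L : param), D L ->
    filterdiff (f xi) (locally L) (df xi L) /\
    forall h : param, continuous (fun p : R * param => df (fst p) (snd p) h) (xi, L).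

(* Main.v *)
Require Import Defs.
From Stdlib Require Import Reals Lra Psatz ProofIrrelevance FunctionalExtensionality IndefiniteDescription.
From Coquelicot Require Import Coquelicot.
Open Scope R_scope.

(** Static and moving walls are found by a Lyapunov-Schmidt reduction, carried out as
    one contraction.

    Write the unit vector in Mercator coordinates around the y axis,
    [m = (sin theta, sinh psi, cos theta) / cosh psi].  These are conformal, and the
    travelling-wave equation becomes a pair of second order equations
    [theta'' = ...], [psi'' = ...] whose right-hand sides are smooth for all values of
    the unknowns.  The Walker wall is [psi = 0] with [sin theta = tanh] and
    [cos theta = sech].  Put [theta = (Walker angle) + u].  The linearisation
    decouples into
    [u'' - (1 - 2 sech^2) u] and [psi'' - (1 + kappa - 2 sech^2) psi].
    The second operator is invertible because [kappa > 0].  The first one has the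
    translation mode [sech] as kernel and cokernel; as the velocity enters that
    equation through [- alpha V sech], with [alpha > 0], the velocity takes care of
    the solvability condition.  Both inverses are explicit combinations of the
    bounded solutions of [g' = a g - f] ([theta_flux_derive], [psi_inverse_derive]).

    The unknown of the contraction is the pair [n] of nonlinear remainders, in the
    Banach algebra [Cbar] of continuous functions on the extended line.  The state
    and the velocity depend linearly on [n], so the problem reads
    [n = remainder (n, L)], where [remainder] and its derivative in [n] vanish at the
    Walker wall ([remainder_zero], [remainder_der_zero]).  The fixed point theorem
    [smooth_fixed_point] gives a solution that is continuously differentiable in the
    parameters, in sup norm and hence at each [xi].

    Functions in [Cbar] have limits at both ends.  These limits are equilibria
    ([end_state]), that is, critical points of the potential near the two poles of
    the x axis.  Since the potential is quadratic, its expansion at a critical point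
    is exact, which shows that such a point is a local minimum and is the only one
    in its hemisphere ([critical_is_local_min], [local_min_unique]).  Hence the
    limits are the boundary values. *)

(** * Maps with Lipschitz derivative *)

(** A quantitative form of continuous differentiability on [S], with one constant
    for all estimates.  Unlike differentiability at each point it needs no mean
    value theorem: sums, products, compositions and fixed points of such maps are
    estimated by the triangle inequality alone. *)
Record C11_bounds {X Y : NormedModule R_AbsRing} (C : R) (S : X -> Prop)
    (F : X -> Y) (DF : X -> X -> Y) : Prop := {
  c11_plus : forall x h k, S x -> DF x (plus h k) = plus (DF x h) (DF x k);
  c11_scal : forall x a h, S x -> DF x (scal a h) = scal a (DF x h);
  c11_val : forall x, S x -> norm (F x) <= C;
  c11_der : forall x h, S x -> norm (DF x h) <= C * norm h;
  c11_lip : forall x y, S x -> S y -> norm (minus (F y) (F x)) <= C * norm (minus y x);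
  c11_dlip : forall x y h, S x -> S y ->
    norm (minus (DF y h) (DF x h)) <= C * norm (minus y x) * norm h;
  c11_rem : forall x y, S x -> S y ->
    norm (minus (minus (F y) (F x)) (DF x (minus y x))) <= C * norm (minus y x) ^ 2
}.

Definition C11_on {X Y : NormedModule R_AbsRing} (S : X -> Prop)
    (F : X -> Y) (DF : X -> X -> Y) : Prop :=
  exists C, 0 <= C /\ C11_bounds C S F DF.

Lemma plus_minus_cancel {G : AbelianGroup} (x y : G) : plus x (minus y x) = y.
Proof.
  unfold minus. rewrite plus_comm, <- plus_assoc.
  etransitivity; [apply f_equal, plus_opp_l | apply plus_zero_r].
Qed.

Lemma minus_self {X : NormedModule R_AbsRing} (x : X) : minus x x = zero.
Proof. exact (@minus_eq_zero (NormedModule.AbelianGroup _ X) x). Qed.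

Lemma norm_minus_self {X : NormedModule R_AbsRing} (x : X) : norm (minus x x) = 0.
Proof.
  transitivity (norm (zero : X)); [apply f_equal, minus_self | apply norm_zero].
Qed.

Lemma norm_minus_sym {X : NormedModule R_AbsRing} (x y : X) :
  norm (minus x y) = norm (minus y x).
Proof. rewrite <- norm_opp, opp_minus. reflexivity. Qed.

Lemma norm_minus_trans {X : NormedModule R_AbsRing} (b a c : X) :
  norm (minus a c) <= norm (minus a b) + norm (minus b c).
Proof. rewrite (minus_trans b a c). apply norm_triangle. Qed.

Lemma norm_le_minus {X : NormedModule R_AbsRing} (a b : X) :
  norm a <= norm (minus a b) + norm b.
Proof.
  replace a with (plus (minus a b) b) at 1; [apply norm_triangle |].
  rewrite plus_comm. apply plus_minus_cancel.
Qed.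

Lemma norm_minus_le {X : NormedModule R_AbsRing} (a b : X) :
  norm (minus a b) <= norm a + norm b.
Proof. unfold minus. rewrite <- (norm_opp b). apply norm_triangle. Qed.

Lemma c11_minus {X Y : NormedModule R_AbsRing} {C} {S : X -> Prop} {F : X -> Y} {DF} :
  C11_bounds C S F DF ->
  forall x h k, S x -> DF x (minus h k) = minus (DF x h) (DF x k).
Proof.
  intros H x h k Hx. unfold minus.
  rewrite (c11_plus _ _ _ _ H) by exact Hx. f_equal.
  transitivity (DF x (scal (opp one) k)).
  { f_equal. symmetry. exact (@scal_opp_one _ (NormedModule.ModuleSpace _ X) k). }
  rewrite (c11_scal _ _ _ _ H) by exact Hx.
  exact (@scal_opp_one _ (NormedModule.ModuleSpace _ Y) (DF x k)).
Qed.

Lemma C11_weaken {X Y : NormedModule R_AbsRing} C C' S S' (F : X -> Y) DF :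
  C <= C' -> (forall x, S' x -> S x) ->
  C11_bounds C S F DF -> C11_bounds C' S' F DF.
Proof.
  intros HC HS [H1 H2 H3 H4 H5 H6 H7].
  split; intros; auto.
  - eapply Rle_trans; [apply H3; auto | lra].
  - eapply Rle_trans; [apply H4; auto |].
    apply Rmult_le_compat_r; [apply norm_ge_0 | lra].
  - eapply Rle_trans; [apply H5; auto |].
    apply Rmult_le_compat_r; [apply norm_ge_0 | lra].
  - eapply Rle_trans; [apply H6; auto |].
    apply Rmult_le_compat_r; [apply norm_ge_0 |].
    apply Rmult_le_compat_r; [apply norm_ge_0 | lra].
  - eapply Rle_trans; [apply H7; auto |].
    apply Rmult_le_compat_r; [apply pow2_ge_0 | lra].
Qed.

(** Chain rule.  Both the derivative and the remainder split at an intermediate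
    term: [DG (F y) (DF x h)] for the former, [DG (F x) (F y - F x)] for the latter. *)
Lemma C11_comp {X Y Z : NormedModule R_AbsRing} (S : X -> Prop) (T : Y -> Prop)
    (F : X -> Y) DF (G : Y -> Z) DG :
  (forall x, S x -> T (F x)) -> C11_on S F DF -> C11_on T G DG ->
  C11_on S (fun x => G (F x)) (fun x h => DG (F x) (DF x h)).
Proof.
  intros HT [C [C0 HF]] [K [K0 HG]].
  exists (K + K * C + K * C * C). 
  assert (KC : 0 <= K * C) by (apply Rmult_le_pos; assumption).
  assert (KCC : 0 <= K * C * C) by (apply Rmult_le_pos; assumption).
  split; [lra |].
  split; intros.
  - rewrite (c11_plus _ _ _ _ HF), (c11_plus _ _ _ _ HG); auto.
  - rewrite (c11_scal _ _ _ _ HF), (c11_scal _ _ _ _ HG); auto.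
  - eapply Rle_trans; [apply (c11_val _ _ _ _ HG); auto | lra].
  - eapply Rle_trans; [apply (c11_der _ _ _ _ HG); auto |].
    generalize (c11_der _ _ _ _ HF x h H) (norm_ge_0 h). nra.
  - eapply Rle_trans; [apply (c11_lip _ _ _ _ HG); auto |].
    generalize (c11_lip _ _ _ _ HF x y H H0) (norm_ge_0 (minus y x)). nra.
  - eapply Rle_trans; [apply (norm_minus_trans (DG (F y) (DF x h))) |].
    rewrite <- (c11_minus HG) by auto.
    generalize (c11_der _ _ _ _ HG (F y) (minus (DF y h) (DF x h)) (HT _ H0)).
    generalize (c11_dlip _ _ _ _ HG (F x) (F y) (DF x h) (HT _ H) (HT _ H0)).
    generalize (c11_dlip _ _ _ _ HF x y h H H0) (c11_lip _ _ _ _ HF x y H H0)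
      (c11_der _ _ _ _ HF x h H).
    generalize (norm_ge_0 h) (norm_ge_0 (minus y x)) (norm_ge_0 (minus (F y) (F x)))
      (norm_ge_0 (DF x h)).
    set (a := norm h). set (b := norm (minus y x)). set (c := norm (minus (F y) (F x))).
    set (d := norm (DF x h)). intros.
    assert (c * d <= C * b * (C * a)) by (apply Rmult_le_compat; auto).
    assert (0 <= b * a) by (apply Rmult_le_pos; auto).
    assert (K * (c * d) <= K * (C * b * (C * a))) by (apply Rmult_le_compat_l; auto).
    assert (K * norm (minus (DF y h) (DF x h)) <= K * (C * b * a)) by (apply Rmult_le_compat_l; auto).
    nra.
  - eapply Rle_trans; [apply (norm_minus_trans (DG (F x) (minus (F y) (F x)))) |].
    rewrite <- (c11_minus HG) by auto.
    generalize (c11_rem _ _ _ _ HG (F x) (F y) (HT _ H) (HT _ H0)).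
    generalize (c11_der _ _ _ _ HG (F x) (minus (minus (F y) (F x)) (DF x (minus y x))) (HT _ H)).
    generalize (c11_rem _ _ _ _ HF x y H H0) (c11_lip _ _ _ _ HF x y H H0).
    generalize (norm_ge_0 (minus y x)) (norm_ge_0 (minus (F y) (F x))).
    set (b := norm (minus y x)). set (c := norm (minus (F y) (F x))).
    intros.
    assert (c ^ 2 <= (C * b) ^ 2) by (apply pow_incr; lra).
    assert (K * c ^ 2 <= K * (C * b) ^ 2) by (apply Rmult_le_compat_l; auto).
    assert (K * norm (minus (minus (F y) (F x)) (DF x (minus y x))) <= K * (C * b ^ 2))
      by (apply Rmult_le_compat_l; auto).
    assert (0 <= b ^ 2) by apply pow2_ge_0. nra.
Qed.

Lemma norm_pair_le {X Y : NormedModule R_AbsRing} (x : X) (y : Y) :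
  norm (x, y) <= norm x + norm y.
Proof.
  change (sqrt (norm x ^ 2 + norm y ^ 2) <= norm x + norm y).
  generalize (norm_ge_0 x) (norm_ge_0 y). intros.
  rewrite <- (sqrt_pow2 (norm x + norm y)) by lra.
  apply sqrt_le_1_alt. nra.
Qed.

Lemma C11_pair {X Y Z : NormedModule R_AbsRing} (S : X -> Prop)
    (F : X -> Y) DF (G : X -> Z) DG :
  C11_on S F DF -> C11_on S G DG ->
  C11_on S (fun x => (F x, G x) : prod_NormedModule _ Y Z) (fun x h => (DF x h, DG x h)).
Proof.
  intros [C [C0 HF]] [K [K0 HG]]. exists (C + K). split; [lra |].
  split.
  - intros x h k H. rewrite (c11_plus _ _ _ _ HF), (c11_plus _ _ _ _ HG); auto.
  - intros x a h H. rewrite (c11_scal _ _ _ _ HF), (c11_scal _ _ _ _ HG); auto.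
  - intros x H. refine (Rle_trans _ _ _ (norm_pair_le _ _) _).
    generalize (c11_val _ _ _ _ HF x H) (c11_val _ _ _ _ HG x H). lra.
  - intros x h H. refine (Rle_trans _ _ _ (norm_pair_le _ _) _).
    generalize (c11_der _ _ _ _ HF x h H) (c11_der _ _ _ _ HG x h H). lra.
  - intros x y H H0.
    refine (Rle_trans _ _ _ (norm_pair_le (minus (F y) (F x)) (minus (G y) (G x))) _).
    generalize (c11_lip _ _ _ _ HF x y H H0) (c11_lip _ _ _ _ HG x y H H0). lra.
  - intros x y h H H0.
    refine (Rle_trans _ _ _ (norm_pair_le (minus (DF y h) (DF x h)) (minus (DG y h) (DG x h))) _).
    generalize (c11_dlip _ _ _ _ HF x y h H H0) (c11_dlip _ _ _ _ HG x y h H H0). lra.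
  - intros x y H H0.
    refine (Rle_trans _ _ _ (norm_pair_le (minus (minus (F y) (F x)) (DF x (minus y x)))
      (minus (minus (G y) (G x)) (DG x (minus y x)))) _).
    generalize (c11_rem _ _ _ _ HF x y H H0) (c11_rem _ _ _ _ HG x y H H0). lra.
Qed.

Lemma C11_linear {X Y : NormedModule R_AbsRing} B (l : X -> Y) :
  is_linear l -> C11_on (fun x => norm x <= B) l (fun _ h => l h).
Proof.
  intros Hl. destruct (linear_norm _ Hl) as [M [M0 HM]].
  exists (M * (1 + Rabs B)). 
  assert (HB := Rle_abs B). assert (HB0 := Rabs_pos B).
  assert (HM1 : M <= M * (1 + Rabs B)).
  { rewrite <- (Rmult_1_r M) at 1. apply Rmult_le_compat_l; lra. }
  split; [apply Rmult_le_pos; lra |].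
  split; intros.
  - apply linear_plus; auto.
  - apply linear_scal; auto.
  - eapply Rle_trans; [apply HM |]. apply Rmult_le_compat_l; lra.
  - eapply Rle_trans; [apply HM |]. apply Rmult_le_compat_r; [apply norm_ge_0 | lra].
  - rewrite <- linear_minus by auto.
    eapply Rle_trans; [apply HM |]. apply Rmult_le_compat_r; [apply norm_ge_0 | lra].
  - rewrite norm_minus_self.
    apply Rmult_le_pos; [apply Rmult_le_pos; [lra | apply norm_ge_0] | apply norm_ge_0].
  - rewrite <- linear_minus by auto. rewrite norm_minus_self.
    apply Rmult_le_pos; [lra | apply pow2_ge_0].
Qed.

Lemma C11_const {X Y : NormedModule R_AbsRing} S (c : Y) :
  C11_on S (fun _ : X => c) (fun _ _ => zero).
Proof.
  assert (Hz : norm (zero : Y) = 0) by apply norm_zero.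
  exists (norm c). split; [apply norm_ge_0 |].
  generalize (norm_ge_0 c); intros Hc.
  split.
  - intros. symmetry. apply plus_zero_r.
  - intros. symmetry. apply (@scal_zero_r _ (NormedModule.ModuleSpace _ Y)).
  - intros. apply Rle_refl.
  - intros x h _. rewrite Hz. apply Rmult_le_pos; [auto | apply norm_ge_0].
  - intros x y _ _. rewrite norm_minus_self. apply Rmult_le_pos; [auto | apply norm_ge_0].
  - intros x y h _ _. rewrite norm_minus_self.
    repeat apply Rmult_le_pos; auto using norm_ge_0.
  - intros x y _ _. rewrite (minus_self c), norm_minus_self. apply Rmult_le_pos; [auto | apply pow2_ge_0].
Qed.

(** Maps given together with their derivative, so that the derivative of a
    composite expression is again an expression that can be computed. *)
Record smooth (X Y : NormedModule R_AbsRing) := Smooth {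
  sm_fun :> X -> Y;
  sm_der : X -> X -> Y;
  sm_C11 : forall B, C11_on (fun x => norm x <= B) sm_fun sm_der
}.
Arguments Smooth {X Y}.
Arguments sm_fun {X Y}.
Arguments sm_der {X Y}.
Arguments sm_C11 {X Y}.

Lemma C11_on_bounded {X Y : NormedModule R_AbsRing} S (F : X -> Y) DF :
  C11_on S F DF -> exists B, forall x, S x -> norm (F x) <= B.
Proof. intros [C [_ H]]. exists C. intros x Hx. apply (c11_val _ _ _ _ H x Hx). Qed.

Lemma C11_smooth_comp {X Y Z : NormedModule R_AbsRing} S (F : X -> Y) DF (G : smooth Y Z) :
  C11_on S F DF -> C11_on S (fun x => G (F x)) (fun x h => sm_der G (F x) (DF x h)).
Proof.
  intros HF. destruct (C11_on_bounded _ _ _ HF) as [B HB].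
  apply C11_comp with (T := fun y => norm y <= B); auto. apply sm_C11.
Qed.

Definition smooth_linear {X Y : NormedModule R_AbsRing} (l : X -> Y) (Hl : is_linear l) : smooth X Y :=
  Smooth l (fun _ => l) (fun B => C11_linear B l Hl).
Definition smooth_const {X Y : NormedModule R_AbsRing} (c : Y) : smooth X Y :=
  Smooth _ _ (fun B => C11_const _ c).
Definition smooth_comp {X Y Z : NormedModule R_AbsRing} (G : smooth Y Z) (F : smooth X Y) : smooth X Z :=
  Smooth _ _ (fun B => C11_smooth_comp _ _ _ G (sm_C11 F B)).
Definition smooth_pair {X Y Z : NormedModule R_AbsRing} (F : smooth X Y) (G : smooth X Z) :
    smooth X (prod_NormedModule _ Y Z) :=
  Smooth _ _ (fun B => C11_pair _ _ _ _ _ (sm_C11 F B) (sm_C11 G B)).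
Definition smooth_plus {X Y : NormedModule R_AbsRing} (F G : smooth X Y) : smooth X Y :=
  smooth_comp (smooth_linear (fun z : prod_NormedModule _ Y Y => plus (fst z) (snd z)) is_linear_plus)
    (smooth_pair F G).

Definition near {X : NormedModule R_AbsRing} (x0 : X) (d : R) (x : X) : Prop :=
  norm (minus x x0) < d.

Lemma locally_near {X : NormedModule R_AbsRing} (x0 : X) d x :
  near x0 d x -> locally x (near x0 d).
Proof.
  intros Hx. apply locally_le_locally_norm.
  assert (H : 0 < d - norm (minus x x0)) by (unfold near in Hx; lra).
  exists (mkposreal _ H). intros y Hy. unfold ball_norm in Hy; simpl in Hy.
  unfold near. generalize (norm_minus_trans x y x0). lra.
Qed.

Lemma near_center {X : NormedModule R_AbsRing} (x0 : X) d : 0 < d -> near x0 d x0.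
Proof. intros H. unfold near. rewrite norm_minus_self. exact H. Qed.

(** The link to Frechet differentiability: the remainder is quadratic, hence
    negligible against the increment. *)
Lemma C11_filterdiff {X Y : NormedModule R_AbsRing} x0 d (F : X -> Y) DF x :
  C11_on (near x0 d) F DF -> near x0 d x -> filterdiff F (locally x) (DF x).
Proof.
  intros [C [C0 H]] Hx. split.
  - split; intros.
    + apply (c11_plus _ _ _ _ H); auto.
    + apply (c11_scal _ _ _ _ H); auto.
    + exists (C + 1). split; [lra |]. intros h.
      generalize (c11_der _ _ _ _ H x h Hx) (norm_ge_0 h). nra.
  - intros x' Hx'. rewrite <- (is_filter_lim_locally_unique _ _ Hx').
    intros [e He]; simpl.
    assert (He' : 0 < e / (C + 1)) by (apply Rdiv_lt_0_compat; lra).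
    generalize (filter_and _ _ (locally_near x0 d x Hx)
      (locally_near x _ x (near_center x _ He'))).
    apply filter_imp. intros y [Hy1 Hy2]. unfold near in Hy2.
    eapply Rle_trans; [apply (c11_rem _ _ _ _ H x y Hx Hy1) |].
    generalize (norm_ge_0 (minus y x)); intros Hn.
    assert (E : e / (C + 1) * (C + 1) = e) by (field; lra).
    simpl. rewrite Rmult_1_r, <- Rmult_assoc.
    apply Rmult_le_compat_r; nra.
Qed.

(** * Fixed points depending on a parameter *)

(** The part of completeness that the Picard iteration uses; it passes to
    products without any discussion of Cauchy filters. *)
Definition geometrically_complete (E : NormedModule R_AbsRing) : Prop :=
  forall (x : nat -> E) C,
    (forall n, norm (minus (x (S n)) (x n)) <= C * (/ 2) ^ n) ->
    exists l C', forall n, norm (minus l (x n)) <= C' * (/ 2) ^ n.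

Lemma le_of_geometric a b C : (forall n, a <= b + C * (/ 2) ^ n) -> a <= b.
Proof.
  intros H. apply Rnot_lt_le. intros Hab.
  assert (HC : 0 < 1 + Rabs C) by (generalize (Rabs_pos C); lra).
  assert (He : 0 < (a - b) / (1 + Rabs C)) by (apply Rdiv_lt_0_compat; lra).
  destruct (pow_lt_1_zero (/ 2)) with (y := (a - b) / (1 + Rabs C)) as [N HN]; auto.
  { rewrite Rabs_pos_eq; lra. }
  specialize (HN N (Nat.le_refl N)). specialize (H N).
  assert (Hp : 0 < (/ 2) ^ N) by (apply pow_lt; lra).
  rewrite Rabs_pos_eq in HN by lra.
  apply (Rmult_lt_compat_r (1 + Rabs C)) in HN; auto.
  unfold Rdiv in HN. rewrite Rmult_assoc, Rinv_l, Rmult_1_r in HN by lra.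
  generalize (Rle_abs C). nra.
Qed.

Lemma eq_of_norm_minus {X : NormedModule R_AbsRing} (x y : X) :
  norm (minus x y) <= 0 -> x = y.
Proof.
  intros H. rewrite <- (plus_minus_cancel y x : plus y (minus x y) = x).
  rewrite (norm_eq_zero (minus x y)) by (apply Rle_antisym; [auto | apply norm_ge_0]).
  apply plus_zero_r.
Qed.

Lemma contraction_fixed_point (E : NormedModule R_AbsRing) (T : E -> E) e0 r :
  geometrically_complete E -> 0 <= r ->
  (forall x, norm (minus x e0) <= r -> norm (minus (T x) e0) <= r) ->
  (forall x y, norm (minus x e0) <= r -> norm (minus y e0) <= r ->
     norm (minus (T x) (T y)) <= / 2 * norm (minus x y)) ->
  exists x, norm (minus x e0) <= r /\ T x = x.
Proof.
  intros HE Hr Hball Hlip.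
  set (x := fun n => Nat.iter n T e0).
  assert (Hx : forall n, norm (minus (x n) e0) <= r).
  { induction n; simpl; auto. unfold x; simpl. rewrite norm_minus_self. exact Hr. }
  assert (Hd : forall n, norm (minus (x (S n)) (x n)) <= r * (/ 2) ^ n).
  { induction n.
    - rewrite pow_O, Rmult_1_r. apply (Hx 1%nat).
    - change (norm (minus (T (x (S n))) (T (x n))) <= r * (/ 2) ^ S n).
      eapply Rle_trans; [apply Hlip; apply Hx |]. rewrite <- tech_pow_Rmult. lra. }
  destruct (HE x r Hd) as [l [C Hl]].
  assert (Hlr : norm (minus l e0) <= r).
  { apply le_of_geometric with C. intros n.
    generalize (norm_minus_trans (x n) l e0) (Hl n) (Hx n). lra. }
  exists l. split; auto.
  apply eq_of_norm_minus. apply le_of_geometric with C. intros n.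
  generalize (norm_minus_trans (x (S n)) (T l) l) (Hl (S n)) (Hlip l (x n) Hlr (Hx n)) (Hl n).
  rewrite (norm_minus_sym (x (S n)) l).
  change (T (x n)) with (x (S n)). rewrite <- tech_pow_Rmult. lra.
Qed.

Section Implicit.
Context {E P : NormedModule R_AbsRing}.
Local Notation X := (prod_NormedModule R_AbsRing E P).
Local Notation "[ e ; p ]" :=
  (@pair (NormedModule.sort R_AbsRing E) (NormedModule.sort R_AbsRing P) e p).
Variable (F : smooth X E) (e0 : E) (p0 : P).
Hypothesis (HE : geometrically_complete E).
Hypothesis (F0 : F [e0; p0] = e0).
Hypothesis (DF0 : forall h, sm_der F [e0; p0] [h; zero] = zero).

Lemma norm_minus_pair (e e' : E) (p p' : P) :
  @norm _ X (@minus X [e; p] [e'; p']) <= norm (minus e e') + norm (minus p p').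
Proof. exact (norm_pair_le (minus e e') (minus p p')). Qed.

Lemma norm_inl (e : E) : @norm _ X [e; zero] <= norm e.
Proof.
  eapply Rle_trans; [apply norm_pair_le |].
  rewrite (norm_zero : norm (zero : P) = 0). lra.
Qed.

Lemma minus_same_snd (e e' : E) (p : P) :
  @minus X [e; p] [e'; p] = [minus e e'; zero].
Proof. exact (f_equal (fun z => [minus e e'; z] : X) (minus_self p)). Qed.

(** Near the base point the partial derivative in the unknown is at most 1/8,
    because it vanishes at the base point and is Lipschitz; the quadratic
    remainder then makes [F (., p)] a contraction on a ball, with factor 1/4. *)
Lemma small_box : exists K r d, 1 <= K /\ 0 < r <= 1 /\ 0 < d /\ K * d <= r / 2 /\
  C11_bounds K (fun x : E * P => norm (minus (fst x) e0) <= r /\ near p0 d (snd x)) F (sm_der F) /\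
  (forall (x : E * P) (h : E), norm (minus (fst x) e0) <= r -> near p0 d (snd x) ->
     norm (sm_der F x [h; zero]) <= / 8 * norm h) /\
  (forall (e e' : E) (p : P), norm (minus e e0) <= r -> norm (minus e' e0) <= r -> near p0 d p ->
     norm (minus (F [e; p]) (F [e'; p])) <= / 4 * norm (minus e e')).
Proof.
  destruct (sm_C11 F (@norm _ X [e0; p0] + 2)) as [C [C0 HC]].
  (* [K * r = 1/16] makes the derivative in the unknown at most [K * (r + d) <= 1/8]. *)
  set (K := C + 1). set (r := / (16 * K)).
  assert (HK : 1 <= K) by (unfold K; lra).
  assert (Hr0 : 0 < r) by (apply Rinv_0_lt_compat; lra).
  assert (HKr : K * r = / 16) by (unfold r; field; lra).
  assert (Hr1 : r <= / 16) by (rewrite <- HKr; nra).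
  set (d := r / (2 * K)).
  assert (HKd : K * d = r / 2) by (unfold d; field; lra).
  assert (Hd0 : 0 < d) by (apply Rdiv_lt_0_compat; lra).
  assert (Hd1 : d <= r) by nra.
  assert (Hbox : forall x : E * P, norm (minus (fst x) e0) <= r /\ near p0 d (snd x) ->
                 norm x <= @norm _ X [e0; p0] + 2).
  { intros [e p] [He Hp]. unfold near in Hp. simpl in *.
    generalize (@norm_le_minus X [e; p] [e0; p0]) (norm_minus_pair e e0 p p0). lra. }
  assert (HF : C11_bounds K (fun x : E * P => norm (minus (fst x) e0) <= r /\ near p0 d (snd x))
            F (sm_der F)).
  { apply C11_weaken with (3 := HC); [unfold K; lra | exact Hbox]. }
  assert (H8 : forall (x : E * P) (h : E), norm (minus (fst x) e0) <= r -> near p0 d (snd x) ->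
     norm (sm_der F x [h; zero]) <= / 8 * norm h).
  { intros [e p] h He Hp.
    assert (H0 : norm (minus (@fst E P [e0; p0]) e0) <= r /\ near p0 d (@snd E P [e0; p0])).
    { simpl. rewrite norm_minus_self. split; [lra | apply near_center; auto]. }
    generalize (c11_dlip _ _ _ _ HF [e0; p0] [e; p] [h; zero] H0 (conj He Hp)).
    generalize (norm_le_minus (sm_der F [e; p] [h; zero]) (sm_der F [e0; p0] [h; zero])).
    replace (norm (sm_der F [e0; p0] [h; zero])) with 0 by (rewrite DF0; symmetry; apply norm_zero).
    unfold near in Hp. simpl in He, Hp.
    generalize (norm_minus_pair e e0 p p0) (norm_inl h) (norm_ge_0 h)
      (@norm_ge_0 _ X [h; zero]) (@norm_ge_0 _ X (@minus X [e; p] [e0; p0])).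
    set (a := norm (minus _ _)). set (b := @norm _ X [h; zero]). intros.
    assert (K * a <= / 8) by nra. nra. }
  exists K, r, d. repeat split; auto; try lra; try apply HF.
  intros e e' p He He' Hp.
  generalize (c11_rem _ _ _ _ HF [e'; p] [e; p] (conj He' Hp) (conj He Hp)).
  rewrite minus_same_snd.
  generalize (H8 [e'; p] (minus e e') He' Hp).
  generalize (norm_le_minus (minus (F [e; p]) (F [e'; p]))
    (sm_der F [e'; p] [minus e e'; zero])).
  generalize (norm_inl (minus e e')) (@norm_ge_0 _ X [minus e e'; zero])
   (norm_minus_trans e0 e e'). rewrite (norm_minus_sym e0 e').
  set (a := @norm _ X [minus e e'; zero]). set (b := norm (minus e e')). intros.
  assert (b <= 2 * r) by lra.
  assert (a ^ 2 <= 2 * r * b) by (simpl; rewrite Rmult_1_r; apply Rmult_le_compat; lra).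
  assert (K * a ^ 2 <= K * (2 * r * b)) by (apply Rmult_le_compat_l; lra).
  replace (K * (2 * r * b)) with (/ 8 * b) in * by (replace (K * (2 * r * b)) with (2 * (K * r) * b) by ring; rewrite HKr; field).
  lra.
Qed.

(** Implicit function theorem in fixed-point form.  The derivative [dw p h] of the
    fixed point is itself the fixed point of the affine contraction
    [z |-> DF (w p, p) (z, h)].  Every estimate for [w] and [dw] is obtained by
    writing the quantity to be bounded as [DF (w p, p) (itself, 0)] plus an
    explicit error, and absorbing the first term. *)
Theorem smooth_fixed_point : exists d w dw, 0 < d /\ w p0 = e0 /\
  (forall p, near p0 d p -> F [w p; p] = w p) /\ C11_on (near p0 d) w dw.
Proof.
  destruct small_box as (K & r & d & HK & Hr & Hd & HKd & HF & H8 & H4).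
  (* A zero vector entering through its norm alone, to bound [DF x (o, h)] by [norm h]. *)
  destruct (ex_intro (fun o : E => norm o = 0) zero norm_zero) as [o Ho].
  assert (Hw : forall p : P, exists e : E, near p0 d p -> norm (minus e e0) <= r /\ F [e; p] = e).
  { intros p. destruct (Rlt_dec (norm (minus p p0)) d) as [Hp | Hp]; [| exists e0; contradiction].
    destruct (contraction_fixed_point E (fun e => F [e; p]) e0 r HE) as [e He]; [lra | | |].
    - intros e He.
      assert (H0 : norm (minus e0 e0) <= r) by (rewrite norm_minus_self; lra).
      generalize (H4 e e0 p He H0 Hp).
      generalize (c11_lip _ _ _ _ HF [e0; p0] [e0; p] (conj H0 (near_center _ _ Hd)) (conj H0 Hp)).
      rewrite F0. generalize (norm_minus_pair e0 e0 p p0). rewrite norm_minus_self.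
      generalize (norm_minus_trans (F [e0; p]) (F [e; p]) e0).
      generalize (norm_ge_0 (minus p p0)). intros.
      assert (K * @norm _ X (@minus X [e0; p] [e0; p0]) <= K * d) by (apply Rmult_le_compat_l; lra).
      lra.
    - intros x y Hx Hy. generalize (H4 x y p Hx Hy Hp) (norm_ge_0 (minus x y)). lra.
    - exists e. auto. }
  destruct (functional_choice _ Hw) as [w Hw']. clear Hw.
  assert (Hz : forall ph : P * P, exists z : E, near p0 d (fst ph) ->
     sm_der F [w (fst ph); fst ph] [z; snd ph] = z).
  { intros [p h]; simpl. destruct (Rlt_dec (norm (minus p p0)) d) as [Hp | Hp];
      [| exists e0; contradiction].
    destruct (Hw' p Hp) as [Hwp _].
    assert (Hl : forall y z : E, norm (minus (sm_der F [w p; p] [y; h]) (sm_der F [w p; p] [z; h]))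
       <= / 8 * norm (minus y z)).
    { intros y z. rewrite <- (c11_minus HF) by (split; auto). rewrite minus_same_snd. auto. }
    assert (HKh : 0 <= K * norm h) by (apply Rmult_le_pos; [lra | apply norm_ge_0]).
    generalize (c11_der _ _ _ _ HF [w p; p] [o; h] (conj Hwp Hp)) (norm_pair_le o h). intros.
    assert (K * norm [o; h] <= K * norm h) by (apply Rmult_le_compat_l; lra).
    destruct (contraction_fixed_point E (fun z => sm_der F [w p; p] [z; h])
       (sm_der F [w p; p] [o; h]) (K * norm h) HE) as [z Hz]; [lra | | |].
    - intros z Hz. generalize (Hl z o) (norm_minus_le z o)
        (norm_le_minus z (sm_der F [w p; p] [o; h])). lra.
    - intros y z _ _. generalize (Hl y z) (norm_ge_0 (minus y z)). lra.
    - exists z. intros _. apply Hz. }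
  destruct (functional_choice _ Hz) as [dw0 Hdw0]. clear Hz.
  set (dw := fun p h : P => dw0 (p, h)).
  assert (Hdw : forall p h : P, near p0 d p -> sm_der F [w p; p] [dw p h; h] = dw p h)
    by (intros p h Hp; exact (Hdw0 (p, h) Hp)).
  clearbody dw. clear dw0 Hdw0.
  assert (HS : forall p, near p0 d p ->
     norm (minus (@fst E P [w p; p]) e0) <= r /\ near p0 d (@snd E P [w p; p]))
    by (intros p Hp; split; [apply (Hw' p Hp) | exact Hp]).
  assert (H8' : forall (p : P) (z : E), near p0 d p -> norm (sm_der F [w p; p] [z; zero]) <= / 8 * norm z)
    by (intros p z Hp; apply H8; apply (HS p Hp)).
  assert (Huniq : forall (p : P) (z : E) (h : P), near p0 d p -> sm_der F [w p; p] [z; h] = z -> dw p h = z).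
  { intros p z h Hp Hz. apply eq_of_norm_minus.
    generalize (H8' p (minus (dw p h) z) Hp).
    rewrite <- (minus_same_snd (dw p h) z h), (c11_minus HF) by auto.
    rewrite (Hdw p h Hp), Hz. generalize (norm_ge_0 (minus (dw p h) z)). lra. }
  assert (Hdwb : forall p h : P, near p0 d p -> norm (dw p h) <= 2 * K * norm h).
  { intros p h Hp.
    generalize (c11_der _ _ _ _ HF [w p; p] [o; h] (HS p Hp)) (norm_pair_le o h)
      (H8' p (minus (dw p h) o) Hp) (norm_minus_le (dw p h) o)
      (norm_le_minus (dw p h) (sm_der F [w p; p] [o; h])).
    rewrite <- (minus_same_snd (dw p h) o h), (c11_minus HF) by auto.
    rewrite (Hdw p h Hp). intros.
    assert (K * norm [o; h] <= K * norm h) by (apply Rmult_le_compat_l; lra).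
    generalize (norm_ge_0 (dw p h)). lra. }
  assert (Hlip : forall p q : P, near p0 d p -> near p0 d q ->
     norm (minus (w q) (w p)) <= 2 * K * norm (minus q p)).
  { intros p q Hp Hq. destruct (Hw' p Hp) as [Hp1 Hp2], (Hw' q Hq) as [Hq1 Hq2].
    generalize (H4 (w q) (w p) q Hq1 Hp1 Hq)
      (c11_lip _ _ _ _ HF [w p; p] [w p; q] (conj Hp1 Hp) (conj Hp1 Hq))
      (norm_minus_trans (F [w p; q]) (F [w q; q]) (F [w p; p]))
      (norm_minus_pair (w p) (w p) q p).
    rewrite norm_minus_self, Hp2, Hq2. intros.
    assert (K * @norm _ X (@minus X [w p; q] [w p; p]) <= K * norm (minus q p))
      by (apply Rmult_le_compat_l; lra).
    generalize (norm_ge_0 (minus (w q) (w p))). lra. }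
  assert (HlipX : forall p q : P, near p0 d p -> near p0 d q ->
     @norm _ X (@minus X [w q; q] [w p; p]) <= (2 * K + 1) * norm (minus q p)).
  { intros p q Hp Hq. generalize (norm_minus_pair (w q) (w p) q p) (Hlip p q Hp Hq). lra. }
  exists d, w, dw. repeat split; auto.
  - destruct (Hw' p0 (near_center _ _ Hd)) as [H1 H2].
    apply eq_of_norm_minus.
    assert (H0 : norm (minus e0 e0) <= r) by (rewrite norm_minus_self; lra).
    generalize (H4 (w p0) e0 p0 H1 H0 (near_center _ _ Hd)).
    rewrite H2, F0. generalize (norm_ge_0 (minus (w p0) e0)). lra.
  - intros p Hp. apply (Hw' p Hp).
  - set (L := 2 * K * (2 * K + 1) ^ 2 + norm e0 + 1).
    generalize (norm_ge_0 e0); intros He0.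
    assert (HL1 : 2 * K <= L) by (unfold L; nra).
    exists L. split; [lra |]. split.
    + intros p h k Hp. apply Huniq; auto.
      rewrite <- (Hdw p h Hp), <- (Hdw p k Hp) at 2.
      rewrite <- (c11_plus _ _ _ _ HF) by auto. reflexivity.
    + intros p a h Hp. apply Huniq; auto.
      rewrite <- (Hdw p h Hp) at 2.
      rewrite <- (c11_scal _ _ _ _ HF) by auto. reflexivity.
    + intros p Hp. generalize (norm_le_minus (w p) e0) (proj1 (HS p Hp)). simpl.
      assert (0 <= 2 * K * (2 * K + 1) ^ 2) by (apply Rmult_le_pos; [lra | apply pow2_ge_0]).
      unfold L. lra.
    + intros p h Hp. eapply Rle_trans; [apply Hdwb; auto |].
      apply Rmult_le_compat_r; [apply norm_ge_0 | auto].
    + intros p q Hp Hq. eapply Rle_trans; [apply Hlip; auto |].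
      apply Rmult_le_compat_r; [apply norm_ge_0 | auto].
    + intros p q h Hp Hq.
      generalize (norm_minus_trans (sm_der F [w p; p] [dw q h; h]) (dw q h) (dw p h)).
      rewrite <- (Hdw q h Hq) at 2. rewrite <- (Hdw p h Hp) at 2.
      rewrite <- (c11_minus HF) by auto. rewrite minus_same_snd.
      generalize (H8' p (minus (dw q h) (dw p h)) Hp).
      generalize (c11_dlip _ _ _ _ HF [w p; p] [w q; q] [dw q h; h] (HS p Hp) (HS q Hq)).
      generalize (HlipX p q Hp Hq) (norm_pair_le (dw q h) h : norm [dw q h; h] <= _) (Hdwb q h Hq).
      generalize (@norm_ge_0 _ X (@minus X [w q; q] [w p; p])) (norm_ge_0 (minus q p))
        (norm_ge_0 h) (norm_ge_0 (minus (dw q h) (dw p h))) (@norm_ge_0 _ X [dw q h; h]).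
      set (a := @norm _ X (@minus X [w q; q] [w p; p])). set (b := @norm _ X [dw q h; h]).
      set (c := norm (minus q p)). set (c' := norm h).
      set (z := norm (minus (dw q h) (dw p h))). intros.
      assert (a * b <= ((2 * K + 1) * c) * ((2 * K + 1) * c')) by (apply Rmult_le_compat; lra).
      assert (K * (a * b) <= K * (((2 * K + 1) * c) * ((2 * K + 1) * c')))
        by (apply Rmult_le_compat_l; lra).
      assert (0 <= c * c') by (apply Rmult_le_pos; auto).
      assert (0 <= (norm e0 + 1) * (c * c')) by (apply Rmult_le_pos; lra).
      unfold L. lra.
    + intros p q Hp Hq.
      set (rho := minus (minus (w q) (w p)) (dw p (minus q p))).
      assert (Hrho : rho = plus
        (minus (minus (F [w q; q]) (F [w p; p])) (sm_der F [w p; p] (@minus X [w q; q] [w p; p])))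
        (sm_der F [w p; p] [rho; zero])).
      { assert (Hrho1 : sm_der F [w p; p] [rho; zero]
          = minus (sm_der F [w p; p] (@minus X [w q; q] [w p; p])) (dw p (minus q p))).
        { unfold rho.
          rewrite <- (minus_same_snd (minus (w q) (w p)) (dw p (minus q p)) (minus q p)).
          rewrite (c11_minus HF) by auto. rewrite (Hdw p _ Hp). reflexivity. }
        rewrite Hrho1, (proj2 (Hw' p Hp)), (proj2 (Hw' q Hq)).
        exact (@minus_trans (NormedModule.AbelianGroup _ E)
          (sm_der F [w p; p] (@minus X [w q; q] [w p; p])) _ _). }
      assert (Hn : norm rho <=
        norm (minus (minus (F [w q; q]) (F [w p; p]))
                (sm_der F [w p; p] (@minus X [w q; q] [w p; p])))
        + norm (sm_der F [w p; p] [rho; zero])).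
      { eapply Rle_trans; [right; exact (f_equal norm Hrho) | apply norm_triangle]. }
      generalize (c11_rem _ _ _ _ HF [w p; p] [w q; q] (HS p Hp) (HS q Hq)).
      generalize (H8' p rho Hp) (HlipX p q Hp Hq) (norm_ge_0 rho).
      generalize (@norm_ge_0 _ X (@minus X [w q; q] [w p; p])) (norm_ge_0 (minus q p)).
      set (a := @norm _ X (@minus X [w q; q] [w p; p])). set (c := norm (minus q p)). intros.
      assert (a ^ 2 <= ((2 * K + 1) * c) ^ 2) by (apply pow_incr; lra).
      assert (K * a ^ 2 <= K * ((2 * K + 1) * c) ^ 2) by (apply Rmult_le_compat_l; lra).
      assert (0 <= (norm e0 + 1) * c ^ 2) by (apply Rmult_le_pos; [lra | apply pow2_ge_0]).
      unfold L. lra.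
Qed.
End Implicit.

(** * Continuous functions on the extended line *)

(** Bounded functions with a finite limit at every point of the extended real
    line.  At a finite point the filter [Rbar_locally z] contains neighbourhoods of
    [z] itself, so a limit there means continuity; treating all points alike gives
    one proof for each closure property. *)
Definition tame (f : R -> R) : Prop :=
  (exists M, forall x, Rabs (f x) <= M) /\
  forall z : Rbar, exists l : R, filterlim f (Rbar_locally z) (locally l).

Lemma tame_const c : tame (fun _ => c).
Proof.
  split; [exists (Rabs c); intros; lra |].
  intros z. exists c. apply filterlim_const.
Qed.

Lemma tame_plus f g : tame f -> tame g -> tame (fun x => f x + g x).
Proof.
  intros [[M HM] Hf] [[N HN] Hg]. split.
  - exists (M + N). intros x. eapply Rle_trans; [apply Rabs_triang |].
    specialize (HM x); specialize (HN x); lra.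
  - intros z. destruct (Hf z) as [l Hl], (Hg z) as [k Hk]. exists (l + k).
    apply (filterlim_comp_2 f g Rplus Hl Hk). exact (filterlim_plus l k).
Qed.

Lemma tame_mult f g : tame f -> tame g -> tame (fun x => f x * g x).
Proof.
  intros [[M HM] Hf] [[N HN] Hg]. split.
  - exists (M * N). intros x. rewrite Rabs_mult.
    apply Rmult_le_compat; auto using Rabs_pos.
  - intros z. destruct (Hf z) as [l Hl], (Hg z) as [k Hk]. exists (l * k).
    apply (filterlim_comp_2 f g Rmult Hl Hk). exact (filterlim_mult l k).
Qed.

Lemma continuous_bounded (g : R -> R) B : (forall x, continuous g x) ->
  exists K, 0 <= K /\ forall x, Rabs x <= B -> Rabs (g x) <= K.
Proof.
  intros Hg. destruct (bounded_continuity g (- B) B) as [K HK].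
  - intros x _. apply Hg.
  - exists (Rabs K). split; [apply Rabs_pos |]. intros x Hx.
    apply Rabs_le_between in Hx. generalize (HK x Hx) (Rle_abs K).
    unfold norm; simpl; unfold abs; simpl. lra.
Qed.

Lemma tame_comp (g f : R -> R) : (forall x, continuous g x) -> tame f -> tame (fun x => g (f x)).
Proof.
  intros Hg [[M HM] Hf]. split.
  - destruct (continuous_bounded g M Hg) as [K [_ HK]]. exists K. auto.
  - intros z. destruct (Hf z) as [l Hl]. exists (g l).
    eapply filterlim_comp; [exact Hl | apply Hg].
Qed.

Lemma tame_continuous f : tame f -> forall x, continuous f x.
Proof.
  intros [_ H] x. destruct (H x) as [l Hl]. simpl in Hl.
  unfold continuous. replace (f x) with l; [exact Hl |].
  apply eq_close. intros e.
  destruct (proj1 (filterlim_locally f l) Hl e) as [d Hd].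
  apply Hd. apply ball_center.
Qed.

(** The Banach algebra of continuous functions on the two-point compactification of
    the line, under the sup norm.  Limits at both ends are built into the space, so
    that a solution found in it automatically has end states. *)
Record Cbar := MakeCbar { ev :> R -> R; ev_tame : tame ev }.

Lemma Cbar_ext (f g : Cbar) : (forall x, f x = g x) -> f = g.
Proof.
  destruct f as [f Hf], g as [g Hg]; simpl. intros H.
  assert (f = g) by (apply functional_extensionality; auto). subst.
  f_equal. apply proof_irrelevance.
Qed.

Definition cst (c : R) : Cbar := MakeCbar _ (tame_const c).
Definition cb_plus (f g : Cbar) : Cbar := MakeCbar _ (tame_plus _ _ (ev_tame f) (ev_tame g)).
Definition cb_mult (f g : Cbar) : Cbar := MakeCbar _ (tame_mult _ _ (ev_tame f) (ev_tame g)).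
Definition cb_scal (a : R) (f : Cbar) : Cbar := cb_mult (cst a) f.
Definition cb_opp (f : Cbar) : Cbar := cb_scal (-1) f.

Definition cb_norm (f : Cbar) : R := real (Lub_Rbar (fun r => exists x, r = Rabs (f x))).

Lemma cb_norm_spec (f : Cbar) :
  (forall x, Rabs (f x) <= cb_norm f) /\
  (forall M, (forall x, Rabs (f x) <= M) -> cb_norm f <= M).
Proof.
  unfold cb_norm.
  destruct (Lub_Rbar_correct (fun r => exists x, r = Rabs (f x))) as [H1 H2].
  destruct (proj1 (ev_tame f)) as [M HM].
  destruct (Lub_Rbar (fun r => exists x, r = Rabs (f x))) as [l | |].
  - split.
    + intros x. apply (H1 (Rabs (f x))). eauto.
    + intros N HN. apply (H2 N). intros r [x ->]. apply HN.
  - exfalso. apply (H2 M). intros r [x ->]. apply HM.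
  - exfalso. apply (H1 (Rabs (f 0))). eauto.
Qed.

Lemma ev_le_norm (f : Cbar) x : Rabs (f x) <= cb_norm f.
Proof. apply cb_norm_spec. Qed.
Lemma cb_norm_le (f : Cbar) M : (forall x, Rabs (f x) <= M) -> cb_norm f <= M.
Proof. apply cb_norm_spec. Qed.
Definition Cbar_AbelianMonoid_mixin : AbelianMonoid.mixin_of Cbar.
Proof.
  apply (AbelianMonoid.Mixin Cbar cb_plus (cst 0)); intros;
    apply Cbar_ext; intros; simpl; ring.
Defined.
Canonical Cbar_AbelianMonoid := AbelianMonoid.Pack Cbar Cbar_AbelianMonoid_mixin Cbar.

Definition Cbar_AbelianGroup_mixin : AbelianGroup.mixin_of Cbar_AbelianMonoid.
Proof.
  apply (AbelianGroup.Mixin Cbar_AbelianMonoid cb_opp); intros;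
    apply Cbar_ext; intros; simpl; ring.
Defined.
Canonical Cbar_AbelianGroup := AbelianGroup.Pack Cbar
  (AbelianGroup.Class Cbar _ Cbar_AbelianGroup_mixin) Cbar.

Definition Cbar_ModuleSpace_mixin : ModuleSpace.mixin_of R_Ring Cbar_AbelianGroup.
Proof.
  apply (ModuleSpace.Mixin R_Ring Cbar_AbelianGroup cb_scal); intros;
    apply Cbar_ext; intros; simpl; unfold mult, one, plus; simpl; ring.
Defined.
Canonical Cbar_ModuleSpace := ModuleSpace.Pack R_Ring Cbar
  (ModuleSpace.Class R_Ring Cbar _ Cbar_ModuleSpace_mixin) Cbar.

Lemma cb_norm_triangle (f g : Cbar) : cb_norm (cb_plus f g) <= cb_norm f + cb_norm g.
Proof.
  apply cb_norm_le. intros x. simpl. eapply Rle_trans; [apply Rabs_triang |].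
  apply Rplus_le_compat; apply ev_le_norm.
Qed.

Lemma cb_norm_scal a (f : Cbar) : cb_norm (cb_scal a f) <= Rabs a * cb_norm f.
Proof.
  apply cb_norm_le. intros x. simpl. rewrite Rabs_mult.
  apply Rmult_le_compat_l; [apply Rabs_pos | apply ev_le_norm].
Qed.

Definition Cbar_UniformSpace_mixin : UniformSpace.mixin_of Cbar.
Proof.
  apply (UniformSpace.Mixin Cbar (cst 0) (fun f e g => cb_norm (minus g f) < e)).
  - intros f e. apply Rle_lt_trans with 0; [| apply cond_pos].
    apply cb_norm_le. intros x. simpl. rewrite <- Rabs_R0. right. f_equal. ring.
  - intros f g e H. eapply Rle_lt_trans; [| exact H].
    apply cb_norm_le. intros x.
    eapply Rle_trans; [| apply (ev_le_norm _ x)]. simpl.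
    rewrite <- Rabs_Ropp. right. f_equal. ring.
  - intros f g h e1 e2 H1 H2. eapply Rle_lt_trans; [| exact (Rplus_lt_compat _ _ _ _ H1 H2)].
    rewrite Rplus_comm. eapply Rle_trans; [| apply cb_norm_triangle].
    right. f_equal. apply Cbar_ext. intros x. simpl. ring.
Defined.
Canonical Cbar_UniformSpace := UniformSpace.Pack Cbar Cbar_UniformSpace_mixin Cbar.

Canonical Cbar_NormedModuleAux := NormedModuleAux.Pack R_AbsRing Cbar
  (NormedModuleAux.Class R_AbsRing Cbar
     (ModuleSpace.class _ Cbar_ModuleSpace) Cbar_UniformSpace_mixin) Cbar.

Definition Cbar_NormedModule_mixin : NormedModule.mixin_of R_AbsRing Cbar_NormedModuleAux.
Proof.
  apply (NormedModule.Mixin R_AbsRing Cbar_NormedModuleAux cb_norm 1).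
  - exact cb_norm_triangle.
  - exact cb_norm_scal.
  - intros f g e H. exact H.
  - intros f g e H. rewrite Rmult_1_l. exact H.
  - intros f H. apply Cbar_ext. intros x. simpl.
    generalize (ev_le_norm f x) (Rabs_pos (f x)). rewrite H. intros.
    apply Rabs_eq_0. lra.
Defined.
Canonical Cbar_NormedModule := NormedModule.Pack R_AbsRing Cbar
  (NormedModule.Class R_AbsRing Cbar _ Cbar_NormedModule_mixin) Cbar.

Lemma Cbar_minus (f g : Cbar) x : minus f g x = f x - g x.
Proof. simpl. ring. Qed.

(** Uniform limits satisfy the Cauchy criterion along each filter [Rbar_locally z],
    by the three-epsilon argument. *)
Lemma tame_uniform_limit (u : nat -> R -> R) f C :
  (forall n, tame (u n)) -> (forall n x, Rabs (f x - u n x) <= C * (/ 2) ^ n) -> tame f.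
Proof.
  intros Hu Hf. split.
  - destruct (Hu 0%nat) as [[M HM] _]. exists (C + M). intros x.
    generalize (Hf 0%nat x) (HM x) (Rabs_triang (f x - u 0%nat x) (u 0%nat x)).
    replace (f x - u 0%nat x + u 0%nat x) with (f x) by ring. simpl. lra.
  - intros z. apply (proj1 (filterlim_locally_cauchy (U := R_CompleteSpace) (F := Rbar_locally z) f)).
    intros e.
    assert (HC : 0 < 1 + Rabs C) by (generalize (Rabs_pos C); lra).
    assert (He : 0 < e / 3 / (1 + Rabs C))
      by (apply Rdiv_lt_0_compat; [generalize (cond_pos e); lra | lra]).
    destruct (pow_lt_1_zero (/ 2)) with (y := e / 3 / (1 + Rabs C)) as [N HN]; auto.
    { rewrite Rabs_pos_eq; lra. }
    specialize (HN N (Nat.le_refl N)).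
    assert (Hp : 0 < (/ 2) ^ N) by (apply pow_lt; lra).
    rewrite Rabs_pos_eq in HN by lra.
    assert (HCN : C * (/ 2) ^ N < e / 3).
    { apply (Rmult_lt_compat_r (1 + Rabs C)) in HN; auto.
      unfold Rdiv in HN at 1. rewrite Rmult_assoc, Rinv_l, Rmult_1_r in HN by lra.
      generalize (Rle_abs C). nra. }
    assert (He3 : 0 < e / 3) by (generalize (cond_pos e); lra).
    destruct (proj2 (filterlim_locally_cauchy (U := R_CompleteSpace) (F := Rbar_locally z) (u N))
      (proj2 (Hu N) z) (mkposreal _ He3)) as [Q [HQ1 HQ2]].
    exists Q. split; auto. intros a b Ha Hb.
    generalize (HQ2 a b Ha Hb) (Hf N a) (Hf N b).
    unfold ball; simpl; unfold AbsRing_ball, abs, minus, plus, opp; simpl. intros.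
    replace (f b + - f a) with ((f b - u N b) + (u N b + - u N a) + - (f a - u N a)) by ring.
    eapply Rle_lt_trans; [apply Rabs_triang |]. rewrite Rabs_Ropp.
    eapply Rle_lt_trans; [apply Rplus_le_compat_r, Rabs_triang |]. lra.
Qed.

Lemma R_geometrically_complete (x : nat -> R) C :
  (forall n, Rabs (x (S n) - x n) <= C * (/ 2) ^ n) ->
  exists l, forall n, Rabs (l - x n) <= 2 * C * (/ 2) ^ n.
Proof.
  intros H.
  assert (Hs : forall n m, Rabs (x (n + m)%nat - x n) <= 2 * C * (/ 2) ^ n - 2 * C * (/ 2) ^ (n + m)).
  { intros n m. induction m.
    - rewrite Nat.add_0_r. unfold Rminus. rewrite !Rplus_opp_r, Rabs_R0. lra.
    - rewrite Nat.add_succ_r.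
      replace (x (S (n + m)) - x n) with ((x (S (n + m)) - x (n + m)%nat) + (x (n + m)%nat - x n)) by ring.
      eapply Rle_trans; [apply Rabs_triang |]. generalize (H (n + m)%nat). simpl. lra. }
  assert (HC : 0 <= C) by (generalize (H 0%nat) (Rabs_pos (x 1%nat - x 0%nat)); simpl; lra).
  assert (Hpos : forall n, 0 <= C * (/ 2) ^ n).
  { intros n. apply Rmult_le_pos; auto. apply pow_le; lra. }
  assert (Hb : bound (fun y => exists n, y = x n - 2 * C * (/ 2) ^ n)).
  { exists (x 0%nat + 2 * C). intros y [n ->].
    generalize (Hs 0%nat n) (Rle_abs (x n - x 0%nat)) (Hpos n). simpl. lra. }
  destruct (completeness _ Hb) as [l [Hl1 Hl2]]; [exists (x 0%nat - 2 * C * (/ 2) ^ 0); eauto |].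
  exists l. intros n. apply Rabs_le. split.
  - generalize (Hl1 _ (ex_intro _ n eq_refl)). lra.
  - enough (l <= x n + 2 * C * (/ 2) ^ n) by lra.
    apply Hl2. intros y [m ->].
    destruct (Nat.le_ge_cases n m) as [Hnm | Hnm].
    + generalize (Hs n (m - n)%nat) (Rle_abs (x m - x n)) (Hpos m).
      replace (n + (m - n))%nat with m by lia. lra.
    + generalize (Hs m (n - m)%nat) (Rle_abs (- (x n - x m))) (Hpos n). rewrite Rabs_Ropp.
      replace (m + (n - m))%nat with n by lia. lra.
Qed.

Lemma Cbar_complete : geometrically_complete Cbar_NormedModule.
Proof.
  intros u C Hu.
  assert (Hx : forall x, exists l, forall n, Rabs (l - u n x) <= 2 * C * (/ 2) ^ n).
  { intros x. apply (R_geometrically_complete (fun n => u n x)). intros n.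
    eapply Rle_trans; [| apply (Hu n)]. rewrite <- Cbar_minus. apply ev_le_norm. }
  destruct (IndefiniteDescription.functional_choice _ Hx) as [f Hf].
  assert (Ht : tame f).
  { apply (tame_uniform_limit (fun n => u n) f (2 * C)); [intros; apply ev_tame | auto]. }
  exists (MakeCbar f Ht), (2 * C). intros n. apply cb_norm_le. intros x.
  rewrite (Cbar_minus (MakeCbar f Ht) (u n)). apply Hf.
Qed.

Lemma prod_complete (E F : NormedModule R_AbsRing) :
  geometrically_complete E -> geometrically_complete F ->
  geometrically_complete (prod_NormedModule R_AbsRing E F).
Proof.
  intros HE HF x C Hx.
  destruct (HE (fun n => fst (x n)) C) as [l [A HA]].
  { intros n. eapply Rle_trans; [| apply (Hx n)]. 
    apply (norm_le_prod_norm_1 (minus (x (S n)) (x n))). }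
  destruct (HF (fun n => snd (x n)) C) as [k [B HB]].
  { intros n. eapply Rle_trans; [| apply (Hx n)]. 
    apply (norm_le_prod_norm_2 (minus (x (S n)) (x n))). }
  exists (l, k), (A + B). intros n.
  refine (Rle_trans _ _ _ (norm_pair_le (minus l (fst (x n))) (minus k (snd (x n)))) _).
  generalize (HA n) (HB n). lra.
Qed.

(** * Products and superposition operators *)

Notation Cbar2 := (prod_NormedModule R_AbsRing Cbar_NormedModule Cbar_NormedModule).

Lemma ev_minus_le (f g : Cbar) x : Rabs (f x - g x) <= norm (minus f g).
Proof. rewrite <- Cbar_minus. apply ev_le_norm. Qed.

Lemma Rabs_mult_le a b A B : Rabs a <= A -> Rabs b <= B -> Rabs (a * b) <= A * B.
Proof. intros. rewrite Rabs_mult. apply Rmult_le_compat; auto using Rabs_pos. Qed.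

Lemma Rabs_plus_le a b A B : Rabs a <= A -> Rabs b <= B -> Rabs (a + b) <= A + B.
Proof. intros. eapply Rle_trans; [apply Rabs_triang | lra]. Qed.

Definition mult_der (x h : Cbar * Cbar) : Cbar :=
  cb_plus (cb_mult (fst h) (snd x)) (cb_mult (fst x) (snd h)).

Lemma C11_product B :
  @C11_on Cbar2 Cbar_NormedModule (fun x => norm x <= B)
    (fun x : Cbar * Cbar => cb_mult (fst x) (snd x)) mult_der.
Proof.
  set (b := Rabs B). assert (Hb : 0 <= b) by apply Rabs_pos.
  exists (b * b + 2 * b + 2). split; [nra |].
  assert (Hfst : forall (x : Cbar * Cbar) y, Rabs (fst x y) <= @norm _ Cbar2 x).
  { intros x y. eapply Rle_trans; [apply ev_le_norm | apply (@norm_le_prod_norm_1 _ Cbar_NormedModule Cbar_NormedModule x)]. }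
  assert (Hsnd : forall (x : Cbar * Cbar) y, Rabs (snd x y) <= @norm _ Cbar2 x).
  { intros x y. eapply Rle_trans; [apply ev_le_norm | apply (@norm_le_prod_norm_2 _ Cbar_NormedModule Cbar_NormedModule x)]. }
  assert (Hfst' : forall (x x' : Cbar * Cbar) y, Rabs (fst x y - fst x' y) <= @norm _ Cbar2 (@minus Cbar2 x x')).
  { intros x x' y. rewrite <- Cbar_minus. apply (Hfst (@minus Cbar2 x x')). }
  assert (Hsnd' : forall (x x' : Cbar * Cbar) y, Rabs (snd x y - snd x' y) <= @norm _ Cbar2 (@minus Cbar2 x x')).
  { intros x x' y. rewrite <- Cbar_minus. apply (Hsnd (@minus Cbar2 x x')). }
  assert (HB : forall x : Cbar2, norm x <= B -> norm x <= b)
    by (intros x Hx; generalize (Rle_abs B); unfold b; lra).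
  split.
  - intros x h k _. apply Cbar_ext. intros y. simpl. ring.
  - intros x a h _. apply Cbar_ext. intros y. simpl. ring.
  - intros x Hx. apply cb_norm_le. intros y. simpl. apply HB in Hx.
    eapply Rle_trans; [apply Rabs_mult_le; [apply Hfst | apply Hsnd] |].
    generalize (norm_ge_0 x). nra.
  - intros x h Hx. apply cb_norm_le. intros y. simpl. apply HB in Hx.
    eapply Rle_trans; [apply Rabs_plus_le; apply Rabs_mult_le; [apply Hfst | apply Hsnd | apply Hfst | apply Hsnd] |].
    generalize (norm_ge_0 x) (norm_ge_0 h). nra.
  - intros x x' Hx Hx'. change (Cbar * Cbar)%type in x, x'. apply cb_norm_le. intros y. rewrite Cbar_minus. simpl. apply HB in Hx, Hx'.
    replace (fst x' y * snd x' y - fst x y * snd x y) with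
      ((fst x' y - fst x y) * snd x' y + fst x y * (snd x' y - snd x y)) by ring.
    eapply Rle_trans; [apply Rabs_plus_le; apply Rabs_mult_le; [apply Hfst' | apply Hsnd | apply Hfst | apply Hsnd'] |].
    assert (arith : forall n n' N, 0 <= n -> 0 <= n' -> 0 <= N -> n <= b -> n' <= b ->
      N * n' + n * N <= (b * b + 2 * b + 2) * N).
    { intros. assert (N * n' <= N * b) by (apply Rmult_le_compat_l; auto).
      assert (n * N <= b * N) by (apply Rmult_le_compat_r; auto).
      assert (0 <= b * b * N) by (apply Rmult_le_pos; nra). lra. }
    apply arith; auto; apply (@norm_ge_0 _ Cbar2).
  - intros x x' h Hx Hx'. change (Cbar * Cbar)%type in x, x', h. apply cb_norm_le. intros y. rewrite Cbar_minus. simpl.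
    replace (fst h y * snd x' y + fst x' y * snd h y - (fst h y * snd x y + fst x y * snd h y)) with
      ((snd x' y - snd x y) * fst h y + (fst x' y - fst x y) * snd h y) by ring.
    eapply Rle_trans; [apply Rabs_plus_le; apply Rabs_mult_le; [apply Hsnd' | apply Hfst | apply Hfst' | apply Hsnd] |].
    assert (arith : forall N n, 0 <= N -> 0 <= n ->
      N * n + N * n <= (b * b + 2 * b + 2) * N * n).
    { intros. assert (0 <= N * n) by (apply Rmult_le_pos; auto).
      assert (0 <= (b * b + 2 * b) * (N * n)) by (apply Rmult_le_pos; nra). lra. }
    apply arith; apply (@norm_ge_0 _ Cbar2).
  - intros x x' Hx Hx'. change (Cbar * Cbar)%type in x, x'. apply cb_norm_le. intros y. rewrite !Cbar_minus. simpl.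
    replace (fst x' y * snd x' y - fst x y * snd x y - _) with
      ((fst x' y - fst x y) * (snd x' y - snd x y)) by ring.
    eapply Rle_trans; [apply Rabs_mult_le; [apply Hfst' | apply Hsnd'] |].
    assert (arith : forall N, N * N <= (b * b + 2 * b + 2) * N ^ 2).
    { intros. generalize (Rle_0_sqr N). unfold Rsqr. intros.
      assert (0 <= (b * b + 2 * b) * (N * N)) by (apply Rmult_le_pos; nra). simpl. lra. }
    apply arith.
Qed.

Definition smooth_product : smooth Cbar2 Cbar_NormedModule := Smooth _ _ C11_product.

Definition smooth_mult {X} (F G : smooth X Cbar_NormedModule) : smooth X Cbar_NormedModule :=
  smooth_comp smooth_product (smooth_pair F G).

Lemma is_derive_continuous (g g1 : R -> R) : (forall x, is_derive g x (g1 x)) -> forall x, continuous g x.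
Proof. intros H x. apply (ex_derive_continuous g). exists (g1 x). apply H. Qed.

(** The intermediate point [c] is exposed because the remainder of a superposition
    operator is [(g1 c - g1 x) * (y - x)], to be bounded by a second application. *)
Lemma mean_value_bound (g g1 : R -> R) K B x y :
  (forall x, is_derive g x (g1 x)) -> (forall x, Rabs x <= B -> Rabs (g1 x) <= K) ->
  Rabs x <= B -> Rabs y <= B ->
  exists c, Rabs c <= B /\ Rabs (c - x) <= Rabs (y - x) /\ g y - g x = g1 c * (y - x) /\
   Rabs (g y - g x) <= K * Rabs (y - x).
Proof.
  intros Hg HK Hx Hy.
  destruct (MVT_gen g x y g1) as [c [Hc E]].
  - intros z _. apply Hg.
  - intros z _. apply continuity_pt_filterlim, (is_derive_continuous g g1 Hg).
  - assert (Hc1 : Rabs c <= B).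
    { apply Rabs_le_between in Hx. apply Rabs_le_between in Hy. apply Rabs_le_between.
      unfold Rmin, Rmax in Hc. destruct (Rle_dec x y); lra. }
    exists c. repeat split; auto.
    + unfold Rmin, Rmax in Hc. destruct (Rle_dec x y).
      * rewrite !Rabs_pos_eq; lra.
      * rewrite !Rabs_left1; lra.
    + rewrite E, Rabs_mult. apply Rmult_le_compat_r; [apply Rabs_pos | auto].
Qed.

(** The superposition operator [f |-> g o f] acts smoothly in the sup norm as soon
    as [g] is twice continuously differentiable: the values of [f] stay in a
    compact interval, on which the second derivative of [g] is bounded. *)
Section Superposition.
Variables (g g1 g2 : R -> R).
Hypothesis (Hg : forall x, is_derive g x (g1 x)).
Hypothesis (Hg1 : forall x, is_derive g1 x (g2 x)).
Hypothesis (Hg2 : forall x, continuous g2 x).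

Definition cb_comp (f : Cbar) : Cbar :=
  MakeCbar _ (tame_comp g f (is_derive_continuous _ _ Hg) (ev_tame f)).
Definition cb_comp_der (f h : Cbar) : Cbar :=
  cb_mult (MakeCbar _ (tame_comp g1 f (is_derive_continuous _ _ Hg1) (ev_tame f))) h.

Lemma C11_superposition B :
  C11_on (fun f : Cbar_NormedModule => norm f <= B) (cb_comp : _ -> Cbar_NormedModule) cb_comp_der.
Proof.
  destruct (continuous_bounded g B (is_derive_continuous _ _ Hg)) as [K0 [HK0 H0]].
  destruct (continuous_bounded g1 B (is_derive_continuous _ _ Hg1)) as [K1 [HK1 H1]].
  destruct (continuous_bounded g2 B Hg2) as [K2 [HK2 H2]].
  exists (K0 + K1 + K2). split; [lra |].
  assert (HB : forall f : Cbar_NormedModule, norm f <= B -> forall x, Rabs (f x) <= B)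
    by (intros f Hf x; apply (Rle_trans _ _ _ (ev_le_norm f x) Hf)).
  assert (arith : forall K a N, 0 <= K <= K0 + K1 + K2 -> Rabs a <= N ->
     K * Rabs a <= (K0 + K1 + K2) * N).
  { intros K a N [HK HK'] Ha. apply Rmult_le_compat; auto using Rabs_pos. }
  split.
  - intros f h k _. apply Cbar_ext. intros x. simpl. ring.
  - intros f a h _. apply Cbar_ext. intros x. simpl. ring.
  - intros f Hf. apply cb_norm_le. intros x. simpl.
    generalize (H0 _ (HB f Hf x)). lra.
  - intros f h Hf. apply cb_norm_le. intros x. simpl.
    eapply Rle_trans; [apply Rabs_mult_le; [apply H1, HB, Hf | apply ev_le_norm] |].
    change (cb_norm h) with (norm h). generalize (norm_ge_0 h). nra.
  - intros f f' Hf Hf'. apply cb_norm_le. intros x. rewrite Cbar_minus. simpl.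
    destruct (mean_value_bound g g1 K1 B (f x) (f' x) Hg H1) as (c & _ & _ & _ & E); auto.
    eapply Rle_trans; [exact E |]. apply arith, ev_minus_le; lra.
  - intros f f' h Hf Hf'. apply cb_norm_le. intros x. rewrite Cbar_minus. simpl.
    destruct (mean_value_bound g1 g2 K2 B (f x) (f' x) Hg1 H2) as (c & _ & _ & _ & E); auto.
    rewrite <- Rmult_minus_distr_r.
    eapply Rle_trans; [apply Rabs_mult_le; [exact E | apply ev_le_norm] |].
    apply Rmult_le_compat_r; [apply norm_ge_0 |].
    apply arith, ev_minus_le; lra.
  - intros f f' Hf Hf'. apply cb_norm_le. intros x. rewrite !Cbar_minus. simpl.
    destruct (mean_value_bound g g1 K1 B (f x) (f' x) Hg H1) as (c & Hc & Hcx & E & _); auto.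
    destruct (mean_value_bound g1 g2 K2 B (f x) c Hg1 H2) as (_ & _ & _ & _ & E'); auto.
    replace (g (f' x) - g (f x) - _) with ((g1 c - g1 (f x)) * (f' x - f x))
      by (rewrite E; ring).
    eapply Rle_trans; [apply Rabs_mult_le with (A := K2 * norm (minus f' f)) |].
    + eapply Rle_trans; [exact E' |]. apply Rmult_le_compat_l; [lra |].
      eapply Rle_trans; [exact Hcx | apply ev_minus_le].
    + apply ev_minus_le.
    + assert (arith' : forall N, K2 * N * N <= (K0 + K1 + K2) * N ^ 2).
      { intros N. generalize (Rle_0_sqr N). unfold Rsqr. intros.
        assert (0 <= (K0 + K1) * (N * N)) by (apply Rmult_le_pos; lra). simpl. lra. }
      apply arith'.
Qed.

Definition smooth_superposition : smooth Cbar_NormedModule Cbar_NormedModule :=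
  Smooth _ _ C11_superposition.
End Superposition.

Lemma continuous_sin x : continuous sin x.
Proof. apply (ex_derive_continuous sin). auto_derive. auto. Qed.

Definition smooth_sin : smooth Cbar_NormedModule Cbar_NormedModule.
Proof.
  refine (smooth_superposition sin cos (fun x => - sin x) _ _ _).
  - intros x. auto_derive; auto; ring.
  - intros x. auto_derive; auto; ring.
  - intros x. apply (ex_derive_continuous (fun x => - sin x)). auto_derive. auto.
Defined.
Definition smooth_cos : smooth Cbar_NormedModule Cbar_NormedModule.
Proof.
  refine (smooth_superposition cos (fun x => - sin x) (fun x => - cos x) _ _ _).
  - intros x. auto_derive; auto; ring.
  - intros x. auto_derive; auto; ring.
  - intros x. apply (ex_derive_continuous (fun x => - cos x)). auto_derive. auto.
Defined.

Lemma exp_mult_opp x : exp x * exp (- x) = 1.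
Proof. rewrite <- exp_plus, Rplus_opp_r. apply exp_0. Qed.
Lemma cosh_pos x : 0 < cosh x.
Proof. unfold cosh. generalize (exp_pos x) (exp_pos (- x)). lra. Qed.
Lemma cosh2_sinh2 x : cosh x * cosh x - sinh x * sinh x = 1.
Proof. rewrite <- (exp_mult_opp x). unfold cosh, sinh. field. Qed.
Lemma is_derive_cosh x : is_derive cosh x (sinh x).
Proof. apply is_derive_Reals, derivable_pt_lim_cosh. Qed.
Lemma is_derive_sinh x : is_derive sinh x (cosh x).
Proof. apply is_derive_Reals, derivable_pt_lim_sinh. Qed.
Lemma is_derive_sech x : is_derive (fun x => / cosh x) x (- (tanh x * / cosh x)).
Proof.
  generalize (cosh_pos x); intros.
  evar_last; [apply is_derive_inv; [apply is_derive_cosh | lra] |]. unfold tanh. field. lra.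
Qed.
Lemma tanh2_sech2 x : tanh x * tanh x + / cosh x * / cosh x = 1.
Proof.
  generalize (cosh_pos x) (cosh2_sinh2 x); intros H E. unfold tanh.
  transitivity ((sinh x * sinh x + 1) / (cosh x * cosh x)); [field; lra |].
  replace (sinh x * sinh x + 1) with (cosh x * cosh x) by lra. field. lra.
Qed.
Lemma is_derive_tanh x : is_derive tanh x (/ cosh x * / cosh x).
Proof.
  generalize (cosh_pos x) (cosh2_sinh2 x); intros H E.
  apply (is_derive_ext (fun x => sinh x / cosh x)); [reflexivity |].
  evar_last; [apply is_derive_div; [apply is_derive_sinh | apply is_derive_cosh | lra] |].
  transitivity ((cosh x * cosh x - sinh x * sinh x) / (cosh x * cosh x)); [field; lra |].
  rewrite E. field. lra.
Qed.

Definition smooth_cosh : smooth Cbar_NormedModule Cbar_NormedModule :=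
  smooth_superposition cosh sinh cosh is_derive_cosh is_derive_sinh
    (is_derive_continuous _ _ is_derive_cosh).
Definition smooth_sinh : smooth Cbar_NormedModule Cbar_NormedModule :=
  smooth_superposition sinh cosh sinh is_derive_sinh is_derive_cosh
    (is_derive_continuous _ _ is_derive_sinh).

Lemma is_derive_sech_sqr x :
  is_derive (fun x => / cosh x * / cosh x) x (-2 * (/ cosh x * / cosh x) * tanh x).
Proof.
  generalize (is_derive_sech x); intros H. 
  evar_last; [apply (is_derive_mult (fun x => / cosh x) (fun x => / cosh x) x); [exact H | exact H | intros; apply Rmult_comm] |].
  unfold plus, mult; simpl. ring.
Qed.

Lemma continuous_sech_sqr_der x : continuous (fun x => -2 * (/ cosh x * / cosh x) * tanh x) x.
Proof.
  apply (continuous_mult (fun x => -2 * (/ cosh x * / cosh x)) tanh).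
  - apply (continuous_mult (fun _ => -2) (fun x => / cosh x * / cosh x)).
    + apply continuous_const.
    + apply (is_derive_continuous _ _ is_derive_sech_sqr).
  - apply (is_derive_continuous _ _ is_derive_tanh).
Qed.

Definition smooth_tanh : smooth Cbar_NormedModule Cbar_NormedModule :=
  smooth_superposition tanh _ _ is_derive_tanh is_derive_sech_sqr continuous_sech_sqr_der.

Lemma continuous_sech_der2 x :
  continuous (fun x => tanh x * tanh x * / cosh x - / cosh x * / cosh x * / cosh x) x.
Proof.
  generalize (is_derive_tanh x) (is_derive_sech x) (is_derive_cosh x) (cosh_pos x). intros Ht Hs Hc Hp.
  apply (ex_derive_continuous (fun x => tanh x * tanh x * / cosh x - / cosh x * / cosh x * / cosh x)).
  auto_derive. repeat split; try (eexists; eassumption); lra.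
Qed.

Lemma is_derive_sech_der x : is_derive (fun x => - (tanh x * / cosh x)) x
  (tanh x * tanh x * / cosh x - / cosh x * / cosh x * / cosh x).
Proof.
  evar_last.
  - apply (is_derive_opp (fun x => tanh x * / cosh x)), (is_derive_mult tanh (fun x => / cosh x) x);
      [apply is_derive_tanh | apply is_derive_sech | intros; apply Rmult_comm].
  - unfold plus, mult, opp; simpl. ring.
Qed.

Definition smooth_sech : smooth Cbar_NormedModule Cbar_NormedModule :=
  smooth_superposition _ _ _ is_derive_sech is_derive_sech_der continuous_sech_der2.

(** * The bounded solution of g' = a g - f *)

Ltac rewrite_derive H :=
  match type of H with is_derive ?f ?x ?d =>
    change (Derive (fun y : R => f y) x) with (Derive f x);
    rewrite (is_derive_unique f x d H)
  end.

(** Comparison principle: [exp (- a * z) * (D z - e)] is nondecreasing.  It serves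
    for the a priori bound, for uniqueness and for the limits at both ends. *)
Lemma linear_growth (D D' : R -> R) a e x y :
  0 < a -> x <= y ->
  (forall z, x <= z <= y -> is_derive D z (D' z) /\ a * D z - a * e <= D' z) ->
  D x - e <= exp (a * (x - y)) * (D y - e).
Proof.
  intros Ha Hxy HD.
  set (phi := fun z => exp (- a * z) * (D z - e)).
  set (phi' := fun z => exp (- a * z) * (D' z - a * (D z - e))).
  assert (Hphi : forall z, x <= z <= y -> is_derive phi z (phi' z)).
  { intros z Hz. destruct (HD z Hz) as [Hd _]. unfold phi, phi'.
    auto_derive; [eexists; exact Hd |].
    rewrite_derive Hd. ring. }
  destruct (MVT_gen phi x y phi') as [c [Hc E]].
  { intros z Hz. apply Hphi. rewrite Rmin_left, Rmax_right in Hz; lra. }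
  { intros z Hz. apply continuity_pt_filterlim, (ex_derive_continuous phi).
    rewrite Rmin_left, Rmax_right in Hz by lra. eexists. apply Hphi. exact Hz. }
  rewrite Rmin_left, Rmax_right in Hc by lra.
  assert (H0 : 0 <= phi' c * (y - x)).
  { apply Rmult_le_pos; [| lra]. apply Rmult_le_pos; [left; apply exp_pos |].
    destruct (HD c Hc). lra. }
  assert (Hle : phi x <= phi y) by lra. unfold phi in Hle.
  apply (Rmult_le_compat_l (exp (a * x))) in Hle; [| left; apply exp_pos].
  rewrite <- !Rmult_assoc, <- !exp_plus in Hle.
  replace (a * x + - a * x) with 0 in Hle by ring. rewrite exp_0 in Hle.
  replace (a * x + - a * y) with (a * (x - y)) in Hle by ring. lra.
Qed.

Lemma exp_tends_to_0 a e : 0 < a -> 0 < e -> exists X, forall x, x < X -> exp (a * x) < e.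
Proof.
  intros Ha He. exists (ln e / a). intros x Hx.
  rewrite <- (exp_ln e) by auto. apply exp_increasing.
  apply (Rmult_lt_compat_l a) in Hx; auto. replace (a * (ln e / a)) with (ln e) in Hx by (field; lra).
  exact Hx.
Qed.

Lemma decay_nonpos a x A K : 0 < a -> (forall y, x <= y -> A <= exp (a * (x - y)) * K) -> A <= 0.
Proof.
  intros Ha H. apply Rnot_lt_le. intros HA.
  assert (HK : 0 < 1 + Rabs K) by (generalize (Rabs_pos K); lra).
  destruct (exp_tends_to_0 a (A / (1 + Rabs K))) as [X HX]; auto.
  { apply Rdiv_lt_0_compat; auto. }
  specialize (HX (Rmin (X - 1) 0)). specialize (H (x - Rmin (X - 1) 0)).
  assert (Rmin (X - 1) 0 < X) by (eapply Rle_lt_trans; [apply Rmin_l | lra]).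
  assert (Rmin (X - 1) 0 <= 0) by apply Rmin_r.
  replace (x - (x - Rmin (X - 1) 0)) with (Rmin (X - 1) 0) in H by ring.
  specialize (H ltac:(lra)). specialize (HX ltac:(lra)).
  set (E := exp (a * Rmin (X - 1) 0)) in *.
  assert (0 < E) by apply exp_pos.
  apply (Rmult_lt_compat_r (1 + Rabs K)) in HX; auto.
  unfold Rdiv in HX. rewrite Rmult_assoc, Rinv_l, Rmult_1_r in HX by lra.
  generalize (Rle_abs K). nra.
Qed.

(** For [0 < a] a bounded solution is governed by the values of [f] to its right, so
    bounds on [f] over a half-line [x <= z] carry over to [g x].  The case [a < 0]
    is obtained later by reflection. *)
Section Resolvent.
Variables (a : R) (f g : R -> R).
Hypothesis (Ha : 0 < a) (Hg : forall x, is_derive g x (a * g x - f x)).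

Lemma growth_above l e x y : x <= y -> (forall z, x <= z <= y -> f z - l <= a * e) ->
  g x - l / a - e <= exp (a * (x - y)) * (g y - l / a - e).
Proof.
  intros Hxy Hf.
  apply (linear_growth (fun z => g z - l / a) (fun z => a * g z - f z) a e x y Ha Hxy).
  intros z Hz. split.
  - generalize (Hg z); intros Hz'. auto_derive; [eexists; exact Hz' |].
    rewrite_derive Hz'. ring.
  - specialize (Hf z Hz). replace (a * (g z - l / a)) with (a * g z - l) by (field; lra). lra.
Qed.

Lemma growth_below l e x y : x <= y -> (forall z, x <= z <= y -> l - f z <= a * e) ->
  l / a - g x - e <= exp (a * (x - y)) * (l / a - g y - e).
Proof.
  intros Hxy Hf.
  apply (linear_growth (fun z => l / a - g z) (fun z => f z - a * g z) a e x y Ha Hxy).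
  intros z Hz. split.
  - generalize (Hg z); intros Hz'. auto_derive; [eexists; exact Hz' |].
    rewrite_derive Hz'. ring.
  - specialize (Hf z Hz). replace (a * (l / a - g z)) with (l - a * g z) by (field; lra). lra.
Qed.

Hypothesis (Hb : exists K, forall x, Rabs (g x) <= K).

Lemma bounded_from_above_right l e x : (forall z, x <= z -> f z - l <= a * e) -> g x - l / a <= e.
Proof.
  intros Hf. destruct Hb as [K HK]. enough (g x - l / a - e <= 0) by lra.
  apply (decay_nonpos a x _ (K + Rabs (l / a) + Rabs e) Ha). intros y Hy.
  eapply Rle_trans; [apply growth_above; [exact Hy | intros; apply Hf; lra] |].
  apply Rmult_le_compat_l; [left; apply exp_pos |].
  generalize (HK y) (Rle_abs (g y)) (Rle_abs (- (l / a))) (Rle_abs (- e)). rewrite !Rabs_Ropp. lra.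
Qed.

Lemma bounded_from_below_right l e x : (forall z, x <= z -> l - f z <= a * e) -> l / a - g x <= e.
Proof.
  intros Hf. destruct Hb as [K HK]. enough (l / a - g x - e <= 0) by lra.
  apply (decay_nonpos a x _ (K + Rabs (l / a) + Rabs e) Ha). intros y Hy.
  eapply Rle_trans; [apply growth_below; [exact Hy | intros; apply Hf; lra] |].
  apply Rmult_le_compat_l; [left; apply exp_pos |].
  generalize (HK y) (Rle_abs (- g y)) (Rle_abs (l / a)) (Rle_abs (- e)). rewrite !Rabs_Ropp. lra.
Qed.

Lemma resolvent_limit_right l : filterlim f (Rbar_locally p_infty) (locally l) ->
  filterlim g (Rbar_locally p_infty) (locally (l / a)).
Proof.
  intros Hf. apply filterlim_locally. intros [e He]; simpl.
  assert (He' : 0 < a * (e / 2)) by (apply Rmult_lt_0_compat; lra).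
  destruct (proj1 (filterlim_locally f l) Hf (mkposreal _ He')) as [X HX]. simpl in HX.
  assert (HX' : forall z, X < z -> Rabs (f z - l) < a * (e / 2)) by exact HX.
  exists X. intros x Hx. change (Rabs (g x - l / a) < e).
  assert (g x - l / a <= e / 2).
  { apply bounded_from_above_right. intros z Hz.
    generalize (HX' z ltac:(lra)) (Rle_abs (f z - l)). lra. }
  assert (l / a - g x <= e / 2).
  { apply bounded_from_below_right. intros z Hz.
    generalize (HX' z ltac:(lra)) (Rle_abs (- (f z - l))). rewrite Rabs_Ropp. lra. }
  apply Rabs_def1; lra.
Qed.

(** Here only [f z] for [z] to the left is controlled.  The contribution of the
    point [X] is damped by the factor [exp (a * (x - X))]. *)
Lemma resolvent_limit_left l : filterlim f (Rbar_locally m_infty) (locally l) ->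
  filterlim g (Rbar_locally m_infty) (locally (l / a)).
Proof.
  intros Hf. apply filterlim_locally. intros [e He]; simpl.
  assert (He' : 0 < a * (e / 2)) by (apply Rmult_lt_0_compat; lra).
  destruct (proj1 (filterlim_locally f l) Hf (mkposreal _ He')) as [X0 HX]. simpl in HX.
  assert (HX' : forall z, z < X0 -> Rabs (f z - l) < a * (e / 2)) by exact HX. clear HX.
  set (X := X0 - 1). destruct Hb as [K HK].
  set (K' := Rabs K + Rabs (l / a) + e + 1).
  assert (HK' : 0 < K') by (unfold K'; generalize (Rabs_pos K) (Rabs_pos (l / a)); lra).
  destruct (exp_tends_to_0 a (e / 2 / K')) as [Y HY]; auto.
  { apply Rdiv_lt_0_compat; lra. }
  exists (Rmin X (X + Y)). intros x Hx. change (Rabs (g x - l / a) < e).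
  assert (x < X) by (eapply Rlt_le_trans; [exact Hx | apply Rmin_l]).
  assert (x < X + Y) by (eapply Rlt_le_trans; [exact Hx | apply Rmin_r]).
  assert (Hexp : exp (a * (x - X)) * K' < e / 2).
  { generalize (HY (x - X) ltac:(lra)); intros HE.
    apply (Rmult_lt_compat_r K') in HE; auto. unfold Rdiv in HE at 1.
    rewrite Rmult_assoc, Rinv_l, Rmult_1_r in HE by lra. exact HE. }
  generalize (Rle_abs (g X)) (Rle_abs (- g X)) (Rle_abs (l / a)) (Rle_abs (- (l / a))) (HK X) (Rle_abs K).
  rewrite !Rabs_Ropp. intros.
  assert (g x - l / a < e).
  { assert (Hgr : g x - l / a - e / 2 <= exp (a * (x - X)) * (g X - l / a - e / 2)).
    { apply growth_above; [lra |]. intros z Hz.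
      generalize (HX' z ltac:(unfold X in *; lra)) (Rle_abs (f z - l)). lra. }
    assert (exp (a * (x - X)) * (g X - l / a - e / 2) <= exp (a * (x - X)) * K').
    { apply Rmult_le_compat_l; [left; apply exp_pos | unfold K'; lra]. }
    lra. }
  assert (l / a - g x < e).
  { assert (Hgr : l / a - g x - e / 2 <= exp (a * (x - X)) * (l / a - g X - e / 2)).
    { apply growth_below; [lra |]. intros z Hz.
      generalize (HX' z ltac:(unfold X in *; lra)) (Rle_abs (- (f z - l))). rewrite Rabs_Ropp. lra. }
    assert (exp (a * (x - X)) * (l / a - g X - e / 2) <= exp (a * (x - X)) * K').
    { apply Rmult_le_compat_l; [left; apply exp_pos | unfold K'; lra]. }
    lra. }
  apply Rabs_def1; lra.
Qed.

Lemma resolvent_bound M : (forall x, Rabs (f x) <= M) -> forall x, Rabs (g x) <= / a * M.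
Proof.
  intros HM x.
  assert (HMa : a * (/ a * M) = M) by (field; lra).
  generalize (bounded_from_above_right 0 (/ a * M) x) (bounded_from_below_right 0 (/ a * M) x).
  rewrite HMa. unfold Rdiv. rewrite Rmult_0_l. intros H1 H2.
  apply Rabs_le. split.
  - enough (0 - g x <= / a * M) by lra. apply H2. intros z _.
    generalize (HM z) (Rle_abs (- f z)). rewrite Rabs_Ropp. lra.
  - enough (g x - 0 <= / a * M) by lra. apply H1. intros z _.
    generalize (HM z) (Rle_abs (f z)). lra.
Qed.
End Resolvent.

(** With [H] the primitive of [exp (- a y) f y] the solutions are
    [exp (a x) * (J - H x)], and a bounded one needs [J] to be the limit of [H] at
    infinity.  This limit is found as a supremum: with [b] the tail bound, [H - b]
    increases, [H + b] decreases, and the supremum of the former lies below the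
    latter, which also gives the bound. *)
Lemma bounded_solution_exists a (f : R -> R) M : 0 < a ->
  (forall x, continuous f x) -> (forall x, Rabs (f x) <= M) ->
  exists g, (forall x, is_derive g x (a * g x - f x)) /\ forall x, Rabs (g x) <= / a * M.
Proof.
  intros Ha Hf HM.
  set (k := fun y => exp (- a * y) * f y).
  assert (Hk : forall y, continuous k y).
  { intros y. apply (continuous_mult (fun y => exp (- a * y)) f); auto.
    apply (ex_derive_continuous (fun y => exp (- a * y))). auto_derive. auto. }
  set (H := fun x => RInt k 0 x).
  assert (HH : forall x, is_derive H x (k x)).
  { intros x. apply (is_derive_RInt k H 0 x); auto.
    apply filter_forall. intros y. apply (RInt_correct k).
    apply (ex_RInt_continuous k). intros; auto. }
  set (b := fun x => / a * M * exp (- a * x)).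
  assert (Hbd : forall x, is_derive b x (- (exp (- a * x) * M))).
  { intros x. unfold b. auto_derive; auto. field. lra. }
  assert (Hmono : forall s x y, (s = 1 \/ s = -1) -> x <= y ->
     s * H y + b y <= s * H x + b x).
  { intros s x y Hs Hxy.
    destruct (MVT_gen (fun z => s * H z + b z) x y (fun z => s * k z - exp (- a * z) * M)) as [c [_ E]].
    - intros z _. generalize (HH z) (Hbd z); intros E1 E2.
      auto_derive; [repeat split; eexists; eassumption |].
      rewrite_derive E1. rewrite_derive E2. ring.
    - intros z _. generalize (HH z) (Hbd z); intros E1 E2.
      apply continuity_pt_filterlim, (ex_derive_continuous (fun z => s * H z + b z)).
      auto_derive. repeat split; eexists; eassumption.
    - assert (s * k c - exp (- a * c) * M <= 0).
      { unfold k. generalize (exp_pos (- a * c)) (HM c) (Rle_abs (f c)) (Rle_abs (- f c)).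
        rewrite Rabs_Ropp. destruct Hs as [-> | ->]; nra. }
      nra. }
  assert (HM0 : 0 <= M) by (generalize (HM 0) (Rabs_pos (f 0)); lra).
  assert (Hbpos : forall x, 0 <= b x).
  { intros x. unfold b. apply Rmult_le_pos; [| left; apply exp_pos].
    apply Rmult_le_pos; [left; apply Rinv_0_lt_compat |]; auto. }
  assert (Hcross : forall x y, H y - b y <= H x + b x).
  { intros x y. destruct (Rle_dec x y) as [Hxy | Hxy].
    - generalize (Hmono 1 x y (or_introl eq_refl) Hxy) (Hbpos y). lra.
    - generalize (Hmono (-1) y x (or_intror eq_refl) ltac:(lra)) (Hbpos x). lra. }
  destruct (completeness (fun r => exists y, r = H y - b y)) as [J [HJ1 HJ2]].
  { exists (H 0 + b 0). intros r [y ->]. apply Hcross. }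
  { eexists; exists 0; reflexivity. }
  exists (fun x => exp (a * x) * (J - H x)). split.
  - intros x. generalize (HH x); intros E1.
    auto_derive; [repeat split; eexists; eassumption |].
    rewrite_derive E1. unfold k.
    assert (E2 : exp (a * x) * exp (- a * x) = 1).
    { rewrite <- exp_plus. replace (a * x + - a * x) with 0 by ring. apply exp_0. }
    transitivity (a * (exp (a * x) * (J - H x)) - (exp (a * x) * exp (- a * x)) * f x); [ring |].
    rewrite E2. ring.
  - intros x.
    assert (Rabs (J - H x) <= b x).
    { apply Rabs_le. split.
      - generalize (HJ1 _ (ex_intro _ x eq_refl)). lra.
      - enough (J <= H x + b x) by lra. apply HJ2. intros r [y ->]. apply Hcross. }
    rewrite Rabs_mult, (Rabs_pos_eq (exp (a * x))) by (left; apply exp_pos).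
    replace (/ a * M) with (exp (a * x) * b x).
    + apply Rmult_le_compat_l; [left; apply exp_pos | auto].
    + unfold b. transitivity (/ a * M * (exp (a * x) * exp (- a * x))); [ring |].
      rewrite <- exp_plus. replace (a * x + - a * x) with 0 by ring. rewrite exp_0. ring.
Qed.

Lemma tame_of_limits (g g1 : R -> R) K lp lm : (forall x, is_derive g x (g1 x)) ->
  (forall x, Rabs (g x) <= K) ->
  filterlim g (Rbar_locally p_infty) (locally lp) ->
  filterlim g (Rbar_locally m_infty) (locally lm) -> tame g.
Proof.
  intros Hd HK Hp Hm. split; [eauto |]. intros [x | |]; eauto.
  exists (g x). apply (is_derive_continuous g g1 Hd).
Qed.

Lemma tame_reflect f : tame f -> tame (fun x => f (- x)).
Proof.
  intros [[M HM] Hf]. split; [eauto |].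
  intros z. destruct (Hf (Rbar_opp z)) as [l Hl]. exists l.
  eapply filterlim_comp; [apply filterlim_Rbar_opp | exact Hl].
Qed.

Definition reflect (f : Cbar) : Cbar := MakeCbar _ (tame_reflect f (ev_tame f)).

Lemma resolvent_exists_pos a (f : Cbar) : 0 < a ->
  exists g : Cbar, forall x, is_derive g x (a * g x - f x).
Proof.
  intros Ha.
  destruct (bounded_solution_exists a f (norm f) Ha (tame_continuous _ (ev_tame f)) (ev_le_norm f))
    as [g [Hg Hb]].
  destruct (proj2 (ev_tame f) p_infty) as [lp Hp], (proj2 (ev_tame f) m_infty) as [lm Hm].
  assert (Ht : tame g).
  { eapply tame_of_limits; [exact Hg | exact Hb | |].
    - eapply resolvent_limit_right; eauto.
    - eapply resolvent_limit_left; eauto. }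
  exists (MakeCbar g Ht). exact Hg.
Qed.

Lemma is_derive_reflect (g : R -> R) x d :
  is_derive g (- x) d -> is_derive (fun x => g (- x)) x (- d).
Proof.
  intros H. auto_derive; [eexists; exact H |]. rewrite_derive H. ring.
Qed.

Lemma resolvent_exists a (f : Cbar) : a <> 0 ->
  exists g : Cbar, forall x, is_derive g x (a * g x - f x).
Proof.
  intros Ha. destruct (Rlt_dec 0 a) as [H | H]; [apply resolvent_exists_pos; auto |].
  destruct (resolvent_exists_pos (- a) (cb_opp (reflect f))) as [g Hg]; [lra |].
  exists (reflect g). intros x. evar_last.
  - apply (is_derive_reflect g x). apply Hg.
  - simpl. rewrite Ropp_involutive. ring.
Qed.

Lemma resolvent_apriori a (f g : Cbar) : a <> 0 ->
  (forall x, is_derive g x (a * g x - f x)) -> norm g <= / Rabs a * norm f.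
Proof.
  intros Ha Hg. apply cb_norm_le. destruct (Rlt_dec 0 a) as [H | H].
  - rewrite Rabs_pos_eq by lra.
    apply (resolvent_bound a f g H Hg (proj1 (ev_tame g)) (norm f) (ev_le_norm f)).
  - rewrite Rabs_left1 by lra. intros x.
    rewrite <- (Ropp_involutive x).
    apply (resolvent_bound (- a) (fun x => - f (- x)) (reflect g)) with (x := - x); [lra | | |].
    + intros y. evar_last; [apply (is_derive_reflect g y); apply Hg |]. simpl. ring.
    + apply (ev_tame (reflect g)).
    + intros y. rewrite Rabs_Ropp. apply ev_le_norm.
Qed.

Lemma resolvent_choice a : exists T : Cbar -> Cbar,
  a <> 0 -> forall f x, is_derive (T f) x (a * T f x - f x).
Proof.
  destruct (Req_dec a 0) as [Ha | Ha]; [exists (fun f => f); contradiction |].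
  destruct (functional_choice (fun (f g : Cbar) => forall x, is_derive g x (a * g x - f x))) as [T HT].
  - intros f. apply resolvent_exists; auto.
  - exists T. auto.
Qed.

(** [resolvent a f] is the bounded solution [(a - d/dx)^-1 f] of [g' = a g - f]. *)
Definition resolvent (a : R) : Cbar -> Cbar :=
  proj1_sig (constructive_indefinite_description _ (resolvent_choice a)).

Lemma resolvent_derive a f x : a <> 0 -> is_derive (resolvent a f) x (a * resolvent a f x - f x).
Proof.
  intros Ha. apply (proj2_sig (constructive_indefinite_description _ (resolvent_choice a)) Ha).
Qed.

Lemma is_derive_cb_plus (f g : Cbar) x a b :
  is_derive f x a -> is_derive g x b -> is_derive (cb_plus f g) x (a + b).
Proof. intros. apply (is_derive_plus (K := R_AbsRing) (V := R_NormedModule) f g x a b); auto. Qed.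

Lemma is_derive_cb_scal (f : Cbar) x c a :
  is_derive f x a -> is_derive (cb_scal c f) x (c * a).
Proof. intros. apply (is_derive_scal f x c a); auto. Qed.

Lemma resolvent_unique a (f g h : Cbar) : a <> 0 ->
  (forall x, is_derive g x (a * g x - f x)) -> (forall x, is_derive h x (a * h x - f x)) -> g = h.
Proof.
  intros Ha Hg Hh. apply (@eq_of_norm_minus Cbar_NormedModule).
  eapply Rle_trans; [apply (resolvent_apriori a (cst 0) (cb_plus g (cb_opp h)) Ha) |].
  - intros x. evar_last.
    + apply is_derive_cb_plus; [apply Hg | apply is_derive_cb_scal, Hh].
    + simpl. ring.
  - right. replace (norm (cst 0)) with 0; [ring |]. symmetry.
    apply (@norm_zero R_AbsRing Cbar_NormedModule).
Qed.

Lemma is_linear_resolvent a : a <> 0 ->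
  is_linear (resolvent a : Cbar_NormedModule -> Cbar_NormedModule).
Proof.
  intros Ha. split.
  - intros f g. apply (resolvent_unique a (cb_plus f g)); auto.
    + intros x. apply resolvent_derive. auto.
    + intros x. evar_last; [apply is_derive_cb_plus; apply resolvent_derive; auto |]. simpl. ring.
  - intros k f. apply (resolvent_unique a (cb_scal k f)); auto.
    + intros x. apply resolvent_derive. auto.
    + intros x. evar_last; [apply is_derive_cb_scal; apply resolvent_derive; auto |]. simpl. ring.
  - exists (/ Rabs a). split; [apply Rinv_0_lt_compat, Rabs_pos_lt; auto |].
    intros f. apply resolvent_apriori; auto. intros x. apply resolvent_derive; auto.
Qed.

(** * Inverting the linearisation at the Walker wall *)

Lemma filterlim_Rplus {T} {F : (T -> Prop) -> Prop} {FF : Filter F} (f g : T -> R) a b :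
  filterlim f F (locally a) -> filterlim g F (locally b) ->
  filterlim (fun x => f x + g x) F (locally (a + b)).
Proof. intros Hf Hg. apply (filterlim_comp_2 f g Rplus Hf Hg). exact (filterlim_plus a b). Qed.

Lemma filterlim_Rmult {T} {F : (T -> Prop) -> Prop} {FF : Filter F} (f g : T -> R) a b :
  filterlim f F (locally a) -> filterlim g F (locally b) ->
  filterlim (fun x => f x * g x) F (locally (a * b)).
Proof. intros Hf Hg. apply (filterlim_comp_2 f g Rmult Hf Hg). exact (filterlim_mult a b). Qed.

Lemma filterlim_continuous {T} {F : (T -> Prop) -> Prop} (g : R -> R) (f : T -> R) a :
  continuous g a -> filterlim f F (locally a) -> filterlim (fun x => g (f x)) F (locally (g a)).
Proof. intros Hg Hf. eapply filterlim_comp; eauto. Qed.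

Lemma exp_limit_minus : filterlim exp (Rbar_locally m_infty) (locally 0).
Proof. exact is_lim_exp_m. Qed.

Lemma exp_opp_limit_plus : filterlim (fun x => exp (- x)) (Rbar_locally p_infty) (locally 0).
Proof. eapply filterlim_comp; [apply (filterlim_Rbar_opp p_infty) | exact exp_limit_minus]. Qed.

Lemma tanh_of_exp x : tanh x = (1 - exp (- x) * exp (- x)) / (1 + exp (- x) * exp (- x)).
Proof.
  unfold tanh, sinh, cosh. generalize (exp_pos x) (exp_pos (- x)). intros.
  rewrite <- (exp_mult_opp x). field. nra.
Qed.

Lemma sech_of_exp x : / cosh x = 2 * exp (- x) / (1 + exp (- x) * exp (- x)).
Proof.
  unfold cosh. generalize (exp_pos x) (exp_pos (- x)). intros.
  rewrite <- (exp_mult_opp x). field. nra.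
Qed.

Lemma tanh_opp x : tanh (- x) = - tanh x.
Proof.
  unfold tanh, sinh, cosh. rewrite Ropp_involutive.
  generalize (exp_pos x) (exp_pos (- x)). intros. field. lra.
Qed.

Lemma cosh_opp x : cosh (- x) = cosh x.
Proof. unfold cosh. rewrite Ropp_involutive. lra. Qed.

Lemma tanh_limit_plus : filterlim tanh (Rbar_locally p_infty) (locally 1).
Proof.
  apply (filterlim_ext (fun x => (fun y => (1 - y * y) / (1 + y * y)) (exp (- x)))).
  { intros x. symmetry. apply tanh_of_exp. }
  assert (Hc : continuous (fun y => (1 - y * y) / (1 + y * y)) 0).
  { apply (ex_derive_continuous (fun y => (1 - y * y) / (1 + y * y))). auto_derive. nra. }
  generalize (filterlim_continuous _ _ _ Hc exp_opp_limit_plus). cbv beta.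
  replace ((1 - 0 * 0) / (1 + 0 * 0)) with 1 by field. auto.
Qed.

Lemma sech_limit_plus : filterlim (fun x => / cosh x) (Rbar_locally p_infty) (locally 0).
Proof.
  apply (filterlim_ext (fun x => (fun y => 2 * y / (1 + y * y)) (exp (- x)))).
  { intros x. symmetry. apply sech_of_exp. }
  assert (Hc : continuous (fun y => 2 * y / (1 + y * y)) 0).
  { apply (ex_derive_continuous (fun y => 2 * y / (1 + y * y))). auto_derive. nra. }
  generalize (filterlim_continuous _ _ _ Hc exp_opp_limit_plus). cbv beta.
  replace (2 * 0 / (1 + 0 * 0)) with 0 by field. auto.
Qed.

Lemma tanh_limit_minus : filterlim tanh (Rbar_locally m_infty) (locally (-1)).
Proof.
  apply (filterlim_ext (fun x => -1 * tanh (- x))).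
  { intros x. rewrite tanh_opp. ring. }
  replace (locally (-1)) with (locally (-1 * 1)) by (f_equal; ring).
  apply (filterlim_Rmult (fun _ => -1)); [apply filterlim_const |].
  eapply filterlim_comp; [apply (filterlim_Rbar_opp m_infty) | exact tanh_limit_plus].
Qed.

Lemma sech_limit_minus : filterlim (fun x => / cosh x) (Rbar_locally m_infty) (locally 0).
Proof.
  apply (filterlim_ext (fun x => / cosh (- x))).
  { intros x. rewrite cosh_opp. reflexivity. }
  eapply (filterlim_comp _ _ _ Ropp (fun x => / cosh x));
    [apply (filterlim_Rbar_opp m_infty) | exact sech_limit_plus].
Qed.

(** The constant 1 bounds both functions since their squares add up to 1; the first
    is the sine and the second the cosine of the wall angle. *)
Definition tanh_bar : Cbar.
Proof.
  refine (MakeCbar tanh (tame_of_limits _ _ 1 _ _ is_derive_tanh _ tanh_limit_plus tanh_limit_minus)).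
  intros x. generalize (tanh2_sech2 x) (Rle_0_sqr (/ cosh x)). unfold Rsqr.
  intros. apply Rabs_le. nra.
Defined.

Definition sech_bar : Cbar.
Proof.
  refine (MakeCbar (fun x => / cosh x) (tame_of_limits _ _ 1 _ _ is_derive_sech _ sech_limit_plus sech_limit_minus)).
  intros x. generalize (tanh2_sech2 x) (Rle_0_sqr (tanh x)). unfold Rsqr.
  intros. apply Rabs_le. nra.
Defined.

Declare Scope cbar_scope.
Delimit Scope cbar_scope with cbar.
Bind Scope cbar_scope with Cbar.
Infix "+" := cb_plus : cbar_scope.
Infix "*" := cb_mult : cbar_scope.
Notation "- f" := (cb_opp f) : cbar_scope.
Notation "f - g" := (cb_plus f (cb_opp g)) : cbar_scope.

Notation "'Linear' l" := (@is_linear R_AbsRing _ Cbar_NormedModule l) (at level 10, l at level 9).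

Lemma linear_cb_plus {X : NormedModule R_AbsRing} (l k : X -> Cbar) :
  Linear l -> Linear k -> Linear (fun x => (l x + k x)%cbar).
Proof.
  intros Hl Hk.
  exact (is_linear_comp (fun x => (l x, k x) : prod_NormedModule _ Cbar_NormedModule Cbar_NormedModule)
    _ (is_linear_prod l k Hl Hk) (@is_linear_plus _ Cbar_NormedModule)).
Qed.

Lemma linear_cb_mult {X : NormedModule R_AbsRing} (c : Cbar) (l : X -> Cbar) :
  Linear l -> Linear (fun x => (c * l x)%cbar).
Proof.
  intros Hl.
  assert (Hc : @is_linear R_AbsRing Cbar_NormedModule Cbar_NormedModule (cb_mult c)).
  { split.
    - intros f g. apply Cbar_ext. intros x. simpl. ring.
    - intros k f. apply Cbar_ext. intros x. simpl. ring.
    - exists (norm c + 1). split; [generalize (norm_ge_0 c); lra |].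
      intros f. apply cb_norm_le. intros x. simpl. apply Rabs_mult_le; [| apply ev_le_norm].
      eapply Rle_trans; [apply ev_le_norm |]. change (cb_norm c) with (norm c). lra. }
  exact (is_linear_comp _ _ Hl Hc).
Qed.

Lemma linear_cb_opp {X : NormedModule R_AbsRing} (l : X -> Cbar) :
  Linear l -> Linear (fun x => (- l x)%cbar).
Proof. apply linear_cb_mult. Qed.

Lemma linear_resolvent {X : NormedModule R_AbsRing} a (l : X -> Cbar) :
  a <> 0 -> Linear l -> Linear (fun x => resolvent a (l x)).
Proof. intros Ha Hl. exact (is_linear_comp _ _ Hl (is_linear_resolvent a Ha)). Qed.

Lemma linear_eval {X : NormedModule R_AbsRing} (l : X -> Cbar) y :
  Linear l -> is_linear (fun x => l x y : R_NormedModule).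
Proof.
  intros Hl.
  assert (He : @is_linear R_AbsRing Cbar_NormedModule R_NormedModule (fun f : Cbar => f y)).
  { split; try reflexivity. exists 1. split; [lra |]. intros f. rewrite Rmult_1_l. apply ev_le_norm. }
  exact (is_linear_comp _ _ Hl He).
Qed.

Lemma linear_scal_l {X : NormedModule R_AbsRing} (l : X -> R) (f : Cbar) :
  @is_linear R_AbsRing X R_NormedModule l -> Linear (fun x => cb_scal (l x) f).
Proof.
  intros Hl.
  assert (Hc : @is_linear R_AbsRing R_NormedModule Cbar_NormedModule (fun a => cb_scal a f)).
  { split.
    - intros a b. apply Cbar_ext. intros x. simpl. unfold plus; simpl. ring.
    - intros a b. apply Cbar_ext. intros x. simpl. unfold scal; simpl. unfold mult; simpl. ring.
    - exists (norm f + 1). split; [generalize (norm_ge_0 f); lra |].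
      intros a. eapply Rle_trans; [apply cb_norm_scal |]. change (cb_norm f) with (norm f).
      change (norm a) with (Rabs a). generalize (Rabs_pos a). lra. }
  exact (is_linear_comp _ _ Hl Hc).
Qed.

(** The operator of the in-plane deviation, [u'' - (1 - 2 sech^2) u], factors as
    [(d - tanh)(d + tanh)], and conjugation with its factors turns it into
    [d^2 - 1].  The characteristic variables of the conjugate equation solve
    constant coefficient first order equations, so two resolvents with weights
    [1 + tanh] and [1 - tanh] are enough.  [theta_flux f] is [u' + tanh u] and
    [theta_inverse f] is [u].

    The kernel of the operator is spanned by [sech], and a bounded solution exists
    only for sources orthogonal to [sech]; [theta_defect f] is the multiple of
    [sech] that has to be subtracted from the source.  It is the value at 0 of a
    combination that turns out to be proportional to [sech]. *)
Definition theta_right (f : Cbar) : Cbar := resolvent 1 ((cst 1 + tanh_bar) * f).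
Definition theta_left (f : Cbar) : Cbar := resolvent (-1) ((cst 1 - tanh_bar) * f).
Definition theta_flux (f : Cbar) : Cbar := (cst (- / 2) * (theta_right f + theta_left f))%cbar.
Definition theta_defect (f : Cbar) : R := / 2 * (theta_right f 0 - theta_left f 0).
Definition theta_inverse (f : Cbar) : Cbar :=
  (cst (- / 2) * ((cst 1 + tanh_bar) * resolvent (-1) (theta_flux f) + (cst 1 - tanh_bar) * resolvent 1 (theta_flux f)))%cbar.
Definition theta_inverse_der (f : Cbar) : Cbar := (theta_flux f - tanh_bar * theta_inverse f)%cbar.

Lemma tanh_ODE_unique (y : R -> R) : (forall x, is_derive y x (- (tanh x * y x))) ->
  forall x, y x = y 0 * / cosh x.
Proof.
  intros Hy x.
  assert (Hd : forall z, is_derive (fun z => y z * cosh z) z 0).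
  { intros z. generalize (Hy z) (is_derive_cosh z) (cosh_pos z); intros E1 E2 Hc.
    auto_derive; [repeat split; eexists; eassumption |].
    rewrite_derive E1. unfold tanh. field. lra. }
  destruct (MVT_gen (fun z => y z * cosh z) 0 x (fun _ => 0)) as [c [_ E]].
  - intros z _. apply Hd.
  - intros z _. apply continuity_pt_filterlim, (ex_derive_continuous (fun z => y z * cosh z)).
    eexists. apply Hd.
  - rewrite cosh_0 in E. generalize (cosh_pos x). intros.
    apply (Rmult_eq_reg_r (cosh x)); [| lra]. rewrite Rmult_assoc, Rinv_l by lra. lra.
Qed.

(** In the variables [z, w], which are half the difference and half the sum of the
    characteristic variables up to sign, the function [z - tanh w] satisfies
    [y' = - tanh y] and therefore equals [- theta_defect f * sech].  This is what
    appears as the correction of the source. *)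
Lemma theta_flux_derive f x : is_derive (theta_flux f) x (tanh x * theta_flux f x + f x - theta_defect f * / cosh x).
Proof.
  assert (HP : forall x, is_derive (theta_right f) x (theta_right f x - (1 + tanh x) * f x)).
  { intros y. evar_last; [apply resolvent_derive; lra |]. fold (theta_right f). simpl. ring. }
  assert (HQ : forall x, is_derive (theta_left f) x (- theta_left f x - (1 - tanh x) * f x)).
  { intros y. evar_last; [apply resolvent_derive; lra |]. fold (theta_left f). simpl. ring. }
  set (y := fun x => / 2 * (theta_left f x - theta_right f x) + tanh x * (/ 2 * (theta_right f x + theta_left f x))).
  assert (Hy : forall x, is_derive y x (- (tanh x * y x))).
  { intros z. unfold y. generalize (HP z) (HQ z) (is_derive_tanh z) (tanh2_sech2 z). intros E1 E2 E3 E4.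
    auto_derive; [repeat split; eexists; eassumption |].
    rewrite_derive E1. rewrite_derive E2. rewrite_derive E3.
    replace (/ cosh z * / cosh z) with (1 - tanh z * tanh z) by lra. field. }
  generalize (tanh_ODE_unique y Hy x). intros E.
  assert (Hy0 : y 0 = - theta_defect f).
  { unfold y, theta_defect. unfold tanh. rewrite sinh_0. field. rewrite cosh_0. lra. }
  rewrite Hy0 in E. unfold y in E.
  generalize (HP x) (HQ x). intros E1 E2.
  apply (is_derive_ext (fun x => - / 2 * (theta_right f x + theta_left f x))); [reflexivity |].
  auto_derive; [repeat split; eexists; eassumption |].
  rewrite_derive E1. rewrite_derive E2. simpl.
  replace (tanh x * _ + f x - theta_defect f * / cosh x)
    with (tanh x * (- / 2 * (theta_right f x + theta_left f x)) + f x + - theta_defect f * / cosh x) by ring.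
  rewrite <- E. field.
Qed.

Lemma theta_inverse_derive f x : is_derive (theta_inverse f) x (theta_inverse_der f x).
Proof.
  set (g := theta_flux f).
  assert (HA : is_derive (resolvent 1 g) x (resolvent 1 g x - g x)).
  { evar_last; [apply resolvent_derive; lra |]. ring. }
  assert (HB : is_derive (resolvent (-1) g) x (- resolvent (-1) g x - g x)).
  { evar_last; [apply resolvent_derive; lra |]. ring. }
  generalize (is_derive_tanh x) (tanh2_sech2 x). intros Ht E.
  apply (is_derive_ext (fun x => - / 2 * ((1 + tanh x) * resolvent (-1) g x
     + (1 - tanh x) * resolvent 1 g x))).
  { intros y. simpl. fold g. ring. }
  auto_derive; [repeat split; eexists; eassumption |].
  rewrite_derive HA. rewrite_derive HB. rewrite_derive Ht. simpl. 
  change (- / 2 * (theta_right f x + theta_left f x)) with (g x). fold g.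
  replace (/ cosh x * / cosh x) with (1 - tanh x * tanh x) by lra. field.
Qed.

Lemma theta_inverse_der_derive f x :
  is_derive (theta_inverse_der f) x ((1 - 2 * (/ cosh x * / cosh x)) * theta_inverse f x + f x - theta_defect f * / cosh x).
Proof.
  assert (E' : forall y, theta_inverse_der f y = theta_flux f y - tanh y * theta_inverse f y) by (intros y; simpl; ring).
  apply (is_derive_ext (fun x => theta_flux f x - tanh x * theta_inverse f x)); [intros y; symmetry; apply E' |].
  generalize (is_derive_tanh x) (tanh2_sech2 x) (theta_flux_derive f x) (theta_inverse_derive f x). rewrite E'.
  generalize (ev (theta_flux f)) (ev (theta_inverse f)). intros G U Ht E HG HU.
  auto_derive; [repeat split; eexists; eassumption |].
  rewrite_derive HG. rewrite_derive Ht. rewrite_derive HU.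
  replace (/ cosh x * / cosh x) with (1 - tanh x * tanh x) by lra. ring.
Qed.

(** For the out-of-plane deviation the operator [psi'' - (1 + kappa - 2 sech^2) psi]
    is conjugate to [d^2 - mu^2] with [mu^2 = 1 + kappa].  Since [kappa > 0] it is
    invertible: [kappa * psi = z - tanh * w], where [w' = z + f] and
    [z' = mu^2 w + tanh f]. *)
Section Psi.
Variables (kappa : R).
Hypothesis (Hk : 0 < kappa).
Definition mu : R := sqrt (1 + kappa).
Lemma mu_sq : mu * mu = 1 + kappa.
Proof. apply sqrt_sqrt. lra. Qed.
Lemma mu_pos : 0 < mu.
Proof. apply sqrt_lt_R0. lra. Qed.

Definition psi_right (f : Cbar) : Cbar := resolvent mu ((cst mu + tanh_bar) * f).
Definition psi_left (f : Cbar) : Cbar := resolvent (- mu) ((cst mu - tanh_bar) * f).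
Definition psi_z (f : Cbar) : Cbar := (cst (/ 2) * (psi_left f - psi_right f))%cbar.
Definition psi_w (f : Cbar) : Cbar := (cst (- / (2 * mu)) * (psi_right f + psi_left f))%cbar.
Definition psi_inverse (f : Cbar) : Cbar := (cst (/ kappa) * (psi_z f - tanh_bar * psi_w f))%cbar.
Definition psi_inverse_der (f : Cbar) : Cbar :=
  (cst (/ kappa) * ((cst (mu * mu) - sech_bar * sech_bar) * psi_w f - tanh_bar * psi_z f))%cbar.

Lemma psi_right_derive f x : is_derive (psi_right f) x (mu * psi_right f x - (mu + tanh x) * f x).
Proof. evar_last; [apply resolvent_derive; generalize mu_pos; lra |]. fold (psi_right f). simpl. ring. Qed.
Lemma psi_left_derive f x : is_derive (psi_left f) x (- mu * psi_left f x - (mu - tanh x) * f x).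
Proof. evar_last; [apply resolvent_derive; generalize mu_pos; lra |]. fold (psi_left f). simpl. ring. Qed.
Lemma psi_z_derive f x : is_derive (psi_z f) x (mu * mu * psi_w f x + tanh x * f x).
Proof.
  generalize (psi_right_derive f x) (psi_left_derive f x). intros HP HQ.
  apply (is_derive_ext (fun x => / 2 * (psi_left f x - psi_right f x))).
  { intros y. simpl. ring. }
  auto_derive; [repeat split; eexists; eassumption |].
  rewrite_derive HP. rewrite_derive HQ. simpl. generalize mu_pos. intros. field. lra.
Qed.
Lemma psi_w_derive f x : is_derive (psi_w f) x (psi_z f x + f x).
Proof.
  generalize (psi_right_derive f x) (psi_left_derive f x) mu_pos. intros HP HQ Hm.
  apply (is_derive_ext (fun x => - / (2 * mu) * (psi_right f x + psi_left f x))).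
  { intros y. simpl. ring. }
  auto_derive; [repeat split; try (eexists; eassumption) |].
  rewrite_derive HP. rewrite_derive HQ. simpl. field. lra.
Qed.
Lemma psi_inverse_derive f x : is_derive (psi_inverse f) x (psi_inverse_der f x).
Proof.
  generalize (psi_z_derive f x) (psi_w_derive f x) (is_derive_tanh x) (tanh2_sech2 x). intros HZ HW Ht E.
  apply (is_derive_ext (fun x => / kappa * (psi_z f x - tanh x * psi_w f x))).
  { intros y. simpl. ring. }
  unfold psi_inverse_der. cbn [ev cb_mult cb_plus cb_opp cb_scal cst tanh_bar sech_bar].
  revert HZ HW. generalize (ev (psi_z f)) (ev (psi_w f)). intros Z W HZ HW.
  auto_derive; [repeat split; try (eexists; eassumption) |].
  rewrite_derive HZ. rewrite_derive HW. rewrite_derive Ht.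
  field. split; generalize (cosh_pos x); lra.
Qed.
Lemma psi_inverse_der_derive f x :
  is_derive (psi_inverse_der f) x ((1 + kappa - 2 * (/ cosh x * / cosh x)) * psi_inverse f x + f x).
Proof.
  generalize (psi_z_derive f x) (psi_w_derive f x) (is_derive_tanh x) (tanh2_sech2 x) mu_sq. intros HZ HW Ht E Hm.
  apply (is_derive_ext (fun x => / kappa * ((mu * mu - (1 - tanh x * tanh x)) * psi_w f x - tanh x * psi_z f x))).
  { intros y. simpl.
    generalize (tanh2_sech2 y). intros Ey.
    replace (1 - tanh y * tanh y) with (/ cosh y * / cosh y) by lra. ring. }
  unfold psi_inverse. cbn [ev cb_mult cb_plus cb_opp cb_scal cst tanh_bar sech_bar].
  revert HZ HW. generalize (ev (psi_z f)) (ev (psi_w f)). intros Z W HZ HW.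
  auto_derive; [repeat split; try (eexists; eassumption) |].
  rewrite_derive HZ. rewrite_derive HW. rewrite_derive Ht.
  replace (/ cosh x * / cosh x) with (1 - tanh x * tanh x) by lra.
  rewrite Hm. field. lra.
Qed.
End Psi.

(** * The nonlinear remainder and its fixed point *)

Notation Params := (prod_NormedModule R_AbsRing (prod_NormedModule R_AbsRing
  (prod_NormedModule R_AbsRing R_NormedModule R_NormedModule) R_NormedModule) R_NormedModule).

(** The solvability condition of the in-plane equation fixes the velocity: the
    damping term contributes [alpha * V * sech] at first order, which must cancel
    the defect. *)
Definition velocity_of (alpha : R) (f : Cbar) : R := (cst (/ (2 * alpha)) * (theta_right f - theta_left f))%cbar 0.

Lemma velocity_of_defect alpha f : 0 < alpha -> alpha * velocity_of alpha f = theta_defect f.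
Proof. intros H. unfold velocity_of, theta_defect. simpl. field. lra. Qed.

Lemma linear_theta_right {X : NormedModule R_AbsRing} (l : X -> Cbar) : Linear l -> Linear (fun x => theta_right (l x)).
Proof. intros H. apply linear_resolvent; [lra |]. apply linear_cb_mult, H. Qed.
Lemma linear_theta_left {X : NormedModule R_AbsRing} (l : X -> Cbar) : Linear l -> Linear (fun x => theta_left (l x)).
Proof. intros H. apply linear_resolvent; [lra |]. apply linear_cb_mult, H. Qed.
Lemma linear_theta_flux {X : NormedModule R_AbsRing} (l : X -> Cbar) : Linear l -> Linear (fun x => theta_flux (l x)).
Proof. intros H. apply linear_cb_mult, linear_cb_plus; [apply linear_theta_right | apply linear_theta_left]; exact H. Qed.
Lemma linear_theta_inverse {X : NormedModule R_AbsRing} (l : X -> Cbar) : Linear l -> Linear (fun x => theta_inverse (l x)).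
Proof.
  intros H. apply linear_cb_mult, linear_cb_plus; apply linear_cb_mult, linear_resolvent; try lra;
    apply linear_theta_flux, H.
Qed.
Lemma linear_theta_inverse_der {X : NormedModule R_AbsRing} (l : X -> Cbar) : Linear l -> Linear (fun x => theta_inverse_der (l x)).
Proof.
  intros H. apply linear_cb_plus; [apply linear_theta_flux, H |].
  apply linear_cb_opp, linear_cb_mult, linear_theta_inverse, H.
Qed.
Lemma linear_velocity_of {X : NormedModule R_AbsRing} alpha (l : X -> Cbar) :
  Linear l -> is_linear (fun x => velocity_of alpha (l x) : R_NormedModule).
Proof.
  intros H. apply linear_eval, linear_cb_mult, linear_cb_plus;
  [apply linear_theta_right, H | apply linear_cb_opp, linear_theta_left, H].
Qed.
Section LinPsi.
Context {X : NormedModule R_AbsRing} (kappa : R) (Hk : 0 < kappa) (l : X -> Cbar) (Hl : Linear l).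
Lemma linear_psi_right : Linear (fun x => psi_right kappa (l x)).
Proof.
  apply linear_resolvent; [generalize (mu_pos kappa Hk); lra |]. apply linear_cb_mult, Hl.
Qed.
Lemma linear_psi_left : Linear (fun x => psi_left kappa (l x)).
Proof.
  apply linear_resolvent; [generalize (mu_pos kappa Hk); lra |]. apply linear_cb_mult, Hl.
Qed.
Lemma linear_psi_z : Linear (fun x => psi_z kappa (l x)).
Proof. apply linear_cb_mult, linear_cb_plus; [apply linear_psi_left | apply linear_cb_opp, linear_psi_right]. Qed.
Lemma linear_psi_w : Linear (fun x => psi_w kappa (l x)).
Proof. apply linear_cb_mult, linear_cb_plus; [apply linear_psi_right | apply linear_psi_left]. Qed.
Lemma linear_psi_inverse : Linear (fun x => psi_inverse kappa (l x)).
Proof.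
  apply linear_cb_mult, linear_cb_plus; [apply linear_psi_z |].
  apply linear_cb_opp, linear_cb_mult, linear_psi_w.
Qed.
Lemma linear_psi_inverse_der : Linear (fun x => psi_inverse_der kappa (l x)).
Proof.
  apply linear_cb_mult, linear_cb_plus; [apply linear_cb_mult, linear_psi_w |].
  apply linear_cb_opp, linear_cb_mult, linear_psi_z.
Qed.
End LinPsi.

Section Nonlinearity.
Variables (alpha kappa : R).
Hypothesis (Ha : 0 < alpha) (Hk : 0 < kappa).

(** All unknowns are recovered linearly from the pair [n] of nonlinear remainders of
    the two equations: the deviation [u] of the angle in the plane and its
    derivative [p], the Mercator latitude [psi] and its derivative [q], and the
    velocity.  The velocity is put into the second source at once, through its
    first-order term [V * sech], so that what remains is quadratic. *)
Definition wall_u (n : Cbar * Cbar) : Cbar := theta_inverse (fst n).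
Definition wall_p (n : Cbar * Cbar) : Cbar := theta_inverse_der (fst n).
Definition wall_V (n : Cbar * Cbar) : R := velocity_of alpha (fst n).
Definition psi_source (n : Cbar * Cbar) : Cbar := (snd n + cb_scal (wall_V n) sech_bar)%cbar.
Definition wall_psi (n : Cbar * Cbar) : Cbar := psi_inverse kappa (psi_source n).
Definition wall_q (n : Cbar * Cbar) : Cbar := psi_inverse_der kappa (psi_source n).

Notation Cbar2xParams := (prod_NormedModule R_AbsRing Cbar2 Params).

Lemma linear_wall_u : @is_linear R_AbsRing Cbar2 Cbar_NormedModule wall_u.
Proof. apply (linear_theta_inverse (X := Cbar2)), is_linear_fst. Qed.
Lemma linear_wall_p : @is_linear R_AbsRing Cbar2 Cbar_NormedModule wall_p.
Proof. apply (linear_theta_inverse_der (X := Cbar2)), is_linear_fst. Qed.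
Lemma linear_wall_V : @is_linear R_AbsRing Cbar2 R_NormedModule wall_V.
Proof. apply (linear_velocity_of (X := Cbar2)), is_linear_fst. Qed.
Lemma linear_psi_source : @is_linear R_AbsRing Cbar2 Cbar_NormedModule psi_source.
Proof. apply (linear_cb_plus (X := Cbar2)); [apply is_linear_snd | apply linear_scal_l, linear_wall_V]. Qed.
Lemma linear_wall_psi : @is_linear R_AbsRing Cbar2 Cbar_NormedModule wall_psi.
Proof. apply (linear_psi_inverse (X := Cbar2) kappa Hk), linear_psi_source. Qed.
Lemma linear_wall_q : @is_linear R_AbsRing Cbar2 Cbar_NormedModule wall_q.
Proof. apply (linear_psi_inverse_der (X := Cbar2) kappa Hk), linear_psi_source. Qed.

Definition state_map (l : Cbar * Cbar -> Cbar) (Hl : @is_linear R_AbsRing Cbar2 Cbar_NormedModule l) :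
    smooth Cbar2xParams Cbar_NormedModule :=
  smooth_linear (fun x : Cbar2xParams => l (fst x)) (is_linear_comp _ _ is_linear_fst Hl).
Definition param_map (l : Params -> R) (Hl : @is_linear R_AbsRing Params R_NormedModule l) :
    smooth Cbar2xParams Cbar_NormedModule :=
  smooth_linear (fun x : Cbar2xParams => cb_scal (l (snd x)) (cst 1))
    (linear_scal_l _ _ (is_linear_comp _ _ is_linear_snd Hl)).

Lemma linear_H1 : @is_linear R_AbsRing Params R_NormedModule (fun L => fst (fst (fst L))).
Proof. apply (is_linear_comp (fun L : Params => fst (fst L)) fst); [apply (is_linear_comp (fun L : Params => fst L) fst) |]; apply is_linear_fst. Qed.
Lemma linear_H2 : @is_linear R_AbsRing Params R_NormedModule (fun L => snd (fst (fst L))).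
Proof. apply (is_linear_comp (fun L : Params => fst (fst L)) snd); [apply (is_linear_comp (fun L : Params => fst L) fst); apply is_linear_fst | apply is_linear_snd]. Qed.
Lemma linear_H3 : @is_linear R_AbsRing Params R_NormedModule (fun L => snd (fst L)).
Proof. apply (is_linear_comp (fun L : Params => fst L) snd); [apply is_linear_fst | apply is_linear_snd]. Qed.
Lemma linear_K2 : @is_linear R_AbsRing Params R_NormedModule (fun L => snd L).
Proof. apply is_linear_snd. Qed.

Definition var_u := state_map wall_u linear_wall_u.
Definition var_p := state_map wall_p linear_wall_p.
Definition var_psi := state_map wall_psi linear_wall_psi.
Definition var_q := state_map wall_q linear_wall_q.
Definition var_V := state_map (fun n => cb_scal (wall_V n) (cst 1)) (linear_scal_l _ _ linear_wall_V).
Definition var_H1 := param_map _ linear_H1.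
Definition var_H2 := param_map _ linear_H2.
Definition var_H3 := param_map _ linear_H3.
Definition var_K2 := param_map _ linear_K2.
Definition constant (f : Cbar) : smooth Cbar2xParams Cbar_NormedModule := smooth_const (f : Cbar_NormedModule).

Declare Scope smooth_scope.
Delimit Scope smooth_scope with sm.
Infix "+" := smooth_plus : smooth_scope.
Infix "*" := smooth_mult : smooth_scope.
Notation "f - g" := (smooth_plus f (smooth_mult (constant (cst (-1))) g)) : smooth_scope.

(** The angle of the wall is the Gudermannian of [xi], with sine [tanh] and cosine
    [sech], plus [u]; the addition formulas avoid naming the Gudermannian. *)
Definition var_sin_theta : smooth Cbar2xParams Cbar_NormedModule :=
  (constant tanh_bar * smooth_comp smooth_cos var_u + constant sech_bar * smooth_comp smooth_sin var_u)%sm.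
Definition var_cos_theta : smooth Cbar2xParams Cbar_NormedModule :=
  (constant sech_bar * smooth_comp smooth_cos var_u - constant tanh_bar * smooth_comp smooth_sin var_u)%sm.
Definition var_theta' : smooth Cbar2xParams Cbar_NormedModule := (constant sech_bar + var_p)%sm.

(** The accelerations in Mercator coordinates minus their linearisation at the
    Walker wall, the linear terms in [V] included.  Hence these maps and their
    derivatives in the unknown vanish at the wall, which is what makes
    [n = remainder (n, L)] a contraction. *)
Definition theta_remainder : smooth Cbar2xParams Cbar_NormedModule :=
  (constant (cst 2) * smooth_comp smooth_tanh var_psi * var_q * var_theta' - var_sin_theta * var_cos_theta
   - smooth_comp smooth_cosh var_psi * (var_H1 * var_cos_theta - var_H3 * var_sin_theta)
   - var_V * var_q - constant (cst alpha) * var_V * var_p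
   + constant (sech_bar * tanh_bar) - constant (cst 1 - cst 2 * sech_bar * sech_bar) * var_u)%sm.

Definition psi_remainder : smooth Cbar2xParams Cbar_NormedModule :=
  (smooth_comp smooth_tanh var_psi * (var_q * var_q - var_theta' * var_theta')
   + smooth_comp smooth_tanh var_psi * (var_sin_theta * var_sin_theta + var_K2)
   + smooth_comp smooth_sinh var_psi * (var_H1 * var_sin_theta + var_H3 * var_cos_theta) - var_H2
   + var_V * var_p - constant (cst alpha) * var_V * var_q
   - constant (cst (1 + kappa) - cst 2 * sech_bar * sech_bar) * var_psi)%sm.

Definition remainder : smooth Cbar2xParams Cbar2 := smooth_pair theta_remainder psi_remainder.

Lemma wall_u_derive n x : is_derive (wall_u n) x (wall_p n x).
Proof. apply theta_inverse_derive. Qed.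
Lemma wall_p_derive n x : is_derive (wall_p n) x
  ((1 - 2 * (/ cosh x * / cosh x)) * wall_u n x + fst n x - alpha * wall_V n * / cosh x).
Proof. unfold wall_V. rewrite velocity_of_defect by exact Ha. apply theta_inverse_der_derive. Qed.
Lemma wall_psi_derive n x : is_derive (wall_psi n) x (wall_q n x).
Proof. apply psi_inverse_derive; exact Hk. Qed.
Lemma wall_q_derive n x : is_derive (wall_q n) x
  ((1 + kappa - 2 * (/ cosh x * / cosh x)) * wall_psi n x + (snd n x + wall_V n * / cosh x)).
Proof. apply psi_inverse_der_derive; exact Hk. Qed.

Opaque wall_u wall_p wall_psi wall_q wall_V.

Lemma linear_zero_at (l : Cbar * Cbar -> Cbar) x :
  @is_linear R_AbsRing Cbar2 Cbar_NormedModule l -> l (cst 0, cst 0) x = 0.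
Proof.
  intros Hl. change (cst 0, cst 0) with (zero : Cbar2).
  rewrite (linear_zero l Hl). reflexivity.
Qed.

Lemma wall_V_zero : wall_V (cst 0, cst 0) = 0.
Proof. exact (linear_zero wall_V linear_wall_V). Qed.

Definition Walker_point : Params := (0, 0, 0, kappa).

Lemma tanh_0 : tanh 0 = 0.
Proof. unfold tanh. rewrite sinh_0. field. rewrite cosh_0. lra. Qed.

Ltac at_zero x :=
  rewrite ?(linear_zero_at wall_u x linear_wall_u), ?(linear_zero_at wall_p x linear_wall_p),
    ?(linear_zero_at wall_psi x linear_wall_psi), ?(linear_zero_at wall_q x linear_wall_q),
    ?wall_V_zero, ?sin_0, ?cos_0, ?tanh_0, ?sinh_0, ?cosh_0.

Lemma remainder_zero : remainder ((cst 0, cst 0), Walker_point) = (cst 0, cst 0).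
Proof.
  cbn [remainder smooth_pair sm_fun]. f_equal.
  - apply Cbar_ext. intros x. simpl. at_zero x. simpl. ring.
  - apply Cbar_ext. intros x. simpl. at_zero x. simpl. ring.
Qed.

Lemma remainder_der_zero h : sm_der remainder ((cst 0, cst 0), Walker_point) (h, zero) = (cst 0, cst 0).
Proof.
  cbn [remainder smooth_pair sm_der]. f_equal.
  - apply Cbar_ext. intros x. simpl. at_zero x. unfold zero; simpl. rewrite Rinv_1.
    transitivity (wall_u h x * (tanh x * tanh x + / cosh x * / cosh x - 1)); [ring |].
    rewrite tanh2_sech2. ring.
  - apply Cbar_ext. intros x. simpl. at_zero x. unfold zero; simpl. rewrite Rinv_1.
    transitivity (wall_psi h x * (tanh x * tanh x + / cosh x * / cosh x - 1)); [ring |].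
    rewrite tanh2_sech2. ring.
Qed.

(** The travelling-wave equation solved for the second derivatives of the angle and
    of the Mercator latitude, for [S], [C] the sine and cosine of the angle and
    [th'], [q] the first derivatives.  Mercator coordinates are conformal, so no
    factor stands before the second derivatives. *)
Definition theta_acceleration (H1 H3 V S C th' psi q : R) : R :=
  2 * tanh psi * q * th' - S * C - cosh psi * (H1 * C - H3 * S) - V * q - alpha * V * th'.
Definition psi_acceleration (H1 H2 H3 K V S C th' psi q : R) : R :=
  tanh psi * (q * q - th' * th') + tanh psi * (S * S + K) + sinh psi * (H1 * S + H3 * C) - H2
  + V * th' - alpha * V * q.

Record profile (L : param) (V : R) (u p psi q : R -> R) : Prop := {
  profile_u : forall x, is_derive u x (p x);
  profile_psi : forall x, is_derive psi x (q x);
  profile_p : forall x, let '(H1, H2, H3, K) := L in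
    let S := tanh x * cos (u x) + / cosh x * sin (u x) in
    let C := / cosh x * cos (u x) - tanh x * sin (u x) in
    is_derive p x (theta_acceleration H1 H3 V S C (/ cosh x + p x) (psi x) (q x) + / cosh x * tanh x);
  profile_q : forall x, let '(H1, H2, H3, K) := L in
    let S := tanh x * cos (u x) + / cosh x * sin (u x) in
    let C := / cosh x * cos (u x) - tanh x * sin (u x) in
    is_derive q x (psi_acceleration H1 H2 H3 K V S C (/ cosh x + p x) (psi x) (q x))
}.

Lemma fixed_point_profile (n : Cbar * Cbar) (L : Params) :
  remainder (n, L) = n -> profile L (wall_V n) (wall_u n) (wall_p n) (wall_psi n) (wall_q n).
Proof.
  destruct n as [n1 n2]. destruct L as [[[H1 H2] H3] K]. intros E.
  assert (E1 : forall x, theta_remainder ((n1, n2), (((H1, H2), H3), K)) x = n1 x)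
    by (intros x; exact (f_equal (fun z => ev (fst z) x) E)).
  assert (E2 : forall x, psi_remainder ((n1, n2), (((H1, H2), H3), K)) x = n2 x)
    by (intros x; exact (f_equal (fun z => ev (snd z) x) E)).
  clear E.
  split; intros x.
  - apply wall_u_derive.
  - apply wall_psi_derive.
  - cbv zeta. evar_last; [apply wall_p_derive |].
    cbn [fst]. rewrite <- E1. simpl. unfold theta_acceleration. ring.
  - cbv zeta. evar_last; [apply wall_q_derive |].
    cbn [snd]. rewrite <- E2. simpl. unfold psi_acceleration. ring.
Qed.

Lemma fixed_point_family :
  exists (d : R) (w : Params -> Cbar2) (dw : Params -> Params -> Cbar2),
    0 < d /\ w Walker_point = (cst 0, cst 0) /\
    (forall L, near Walker_point d L -> remainder (w L, L) = w L) /\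
    C11_on (near Walker_point d) w dw.
Proof.
  apply (@smooth_fixed_point Cbar2 Params remainder).
  - apply prod_complete; apply Cbar_complete.
  - exact remainder_zero.
  - intros h. apply remainder_der_zero.
Qed.
End Nonlinearity.

(** * From the profile to the travelling-wave equation *)

Lemma filterdiff_pair {X Y Z : NormedModule R_AbsRing} (f : X -> Y) (g : X -> Z) x lf lg :
  filterdiff f (locally x) lf -> filterdiff g (locally x) lg ->
  filterdiff (fun y => (f y, g y) : prod_NormedModule R_AbsRing Y Z) (locally x)
    (fun y => (lf y, lg y)).
Proof.
  intros Hf Hg.
  apply (filterdiff_comp'_2 f g (fun a b => (a, b) : prod_NormedModule R_AbsRing Y Z) x lf lg
    (fun a b => (a, b)) Hf Hg).
  apply (filterdiff_linear (fun t : prod_NormedModule R_AbsRing Y Z => (fst t, snd t))).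
  apply is_linear_prod; [apply is_linear_fst | apply is_linear_snd].
Qed.

Lemma is_derive_vec3 (f g h : R -> R) x a b c :
  is_derive f x a -> is_derive g x b -> is_derive h x c ->
  is_derive (fun x => (f x, g x, h x) : vec3) x ((a, b, c) : vec3).
Proof. intros Hf Hg Hh. exact (filterdiff_pair _ _ _ _ _ (filterdiff_pair _ _ _ _ _ Hf Hg) Hh). Qed.

Lemma vec3_zero (a b c : R) : a = 0 -> b = 0 -> c = 0 -> (a, b, c) = (0, 0, 0).
Proof. intros -> -> ->. reflexivity. Qed.

(** The point of the sphere with Mercator coordinates [theta] and [psi], where
    [S = sin theta] and [C = cos theta]; the poles lie on the y axis. *)
Definition mercator (S C psi : R) : vec3 := (S * / cosh psi, tanh psi, C * / cosh psi).

Lemma is_derive_cos_sin (f g u : R -> R) x f' g' u' :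
  is_derive f x f' -> is_derive g x g' -> is_derive u x u' ->
  is_derive (fun x => f x * cos (u x) + g x * sin (u x)) x
    (f' * cos (u x) + g' * sin (u x) + (g x * cos (u x) - f x * sin (u x)) * u').
Proof.
  intros Ef Eg Eu. auto_derive; [repeat split; eexists; eassumption |].
  rewrite_derive Ef. rewrite_derive Eg. rewrite_derive Eu. ring.
Qed.

Section Wave.
Variables (alpha : R) (H1 H2 H3 K V : R) (u p psi q : R -> R).
Hypothesis (Hprof : profile alpha (H1, H2, H3, K) V u p psi q).

Let S x := tanh x * cos (u x) + / cosh x * sin (u x).
Let C x := / cosh x * cos (u x) - tanh x * sin (u x).
Let P x := / cosh x + p x.
Let sg x := / cosh (psi x).
Let ta x := tanh (psi x).
Let P' x := theta_acceleration alpha H1 H3 V (S x) (C x) (P x) (psi x) (q x).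
Let Q' x := psi_acceleration alpha H1 H2 H3 K V (S x) (C x) (P x) (psi x) (q x).

Lemma S2_C2 x : S x * S x + C x * C x = 1.
Proof.
  unfold S, C. transitivity ((tanh x * tanh x + / cosh x * / cosh x) * (Rsqr (sin (u x)) + Rsqr (cos (u x)))).
  - unfold Rsqr. ring.
  - rewrite tanh2_sech2, sin2_cos2. ring.
Qed.

Lemma S_derive x : is_derive S x (C x * P x).
Proof.
  unfold S, C, P.
  evar_last; [eapply (is_derive_cos_sin tanh (fun x => / cosh x) u x);
    [apply is_derive_tanh | apply is_derive_sech | apply (profile_u _ _ _ _ _ _ _ Hprof)] |].
  simpl. ring.
Qed.

Lemma C_derive x : is_derive C x (- (S x * P x)).
Proof.
  unfold S, C, P.
  apply (is_derive_ext (fun x => / cosh x * cos (u x) + - tanh x * sin (u x))).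
  { intros y. simpl. ring. }
  evar_last; [eapply (is_derive_cos_sin (fun x => / cosh x) (fun x => - tanh x) u x);
    [apply is_derive_sech | apply (is_derive_opp tanh), is_derive_tanh
      | apply (profile_u _ _ _ _ _ _ _ Hprof)] |].
  simpl. unfold opp; simpl. ring.
Qed.

Lemma P_derive x : is_derive P x (P' x).
Proof.
  generalize (is_derive_sech x) (profile_p _ _ _ _ _ _ _ Hprof x). cbv beta iota zeta. intros Hs Hp.
  evar_last; [apply @is_derive_plus; [exact Hs | exact Hp] |].
  unfold P', S, C, P, plus; simpl. ring.
Qed.

Lemma q_derive x : is_derive q x (Q' x).
Proof. exact (profile_q _ _ _ _ _ _ _ Hprof x). Qed.

Lemma sg_derive x : is_derive sg x (- (sg x * ta x * q x)).
Proof.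
  unfold sg, ta. evar_last.
  - apply (is_derive_comp (fun y => / cosh y) psi); [apply is_derive_sech | apply (profile_psi _ _ _ _ _ _ _ Hprof)].
  - unfold scal; simpl; unfold mult; simpl. ring.
Qed.

Lemma ta_derive x : is_derive ta x (sg x * sg x * q x).
Proof.
  unfold sg, ta. evar_last.
  - apply (is_derive_comp tanh psi); [apply is_derive_tanh | apply (profile_psi _ _ _ _ _ _ _ Hprof)].
  - unfold scal; simpl; unfold mult; simpl. ring.
Qed.

Definition wave_d (S C P Q s t : R) : vec3 :=
  (C * P * s - S * s * t * Q, s * s * Q, - (S * P * s) - C * s * t * Q).
Definition wave_dd (S C P Q s t P' Q' : R) : vec3 :=
  (- (S * P * P * s) + C * P' * s - 2 * C * P * s * t * Q - S * s * (s * s - t * t) * Q * Q - S * s * t * Q',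
   - 2 * s * s * t * Q * Q + s * s * Q',
   - (C * P * P * s) - S * P' * s + 2 * S * P * s * t * Q - C * s * (s * s - t * t) * Q * Q - C * s * t * Q').

Ltac solve_derive x :=
  generalize (S_derive x) (C_derive x) (P_derive x) (q_derive x) (sg_derive x) (ta_derive x);
  generalize (P' x) (Q' x);
  clearbody S C P sg ta;
  intros p' q' E1 E2 E3 E4 E5 E6;
  auto_derive; [repeat split; eexists; eassumption |];
  rewrite ?(is_derive_unique _ _ _ E1 : Derive (fun x => S x) x = _),
    ?(is_derive_unique _ _ _ E2 : Derive (fun x => C x) x = _),
    ?(is_derive_unique _ _ _ E3 : Derive (fun x => P x) x = _),
    ?(is_derive_unique _ _ _ E4 : Derive (fun x => q x) x = _),
    ?(is_derive_unique _ _ _ E5 : Derive (fun x => sg x) x = _),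
    ?(is_derive_unique _ _ _ E6 : Derive (fun x => ta x) x = _); ring.

Lemma wave_derive x : is_derive (fun x => mercator (S x) (C x) (psi x)) x
  (wave_d (S x) (C x) (P x) (q x) (sg x) (ta x)).
Proof.
  apply (is_derive_vec3 (fun x => S x * sg x) ta (fun x => C x * sg x)).
  - solve_derive x.
  - apply ta_derive.
  - solve_derive x.
Qed.

Lemma wave_d_derive x : is_derive (fun x => wave_d (S x) (C x) (P x) (q x) (sg x) (ta x)) x
  (wave_dd (S x) (C x) (P x) (q x) (sg x) (ta x) (P' x) (Q' x)).
Proof. apply is_derive_vec3; solve_derive x. Qed.

(** After substituting the accelerations and [cosh psi = 1 / sg],
    [sinh psi = ta / sg], each component is a rational identity modulo
    [S^2 + C^2 = 1] and [sg^2 + ta^2 = 1]. *)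
Lemma wave_equation x :
  let m := mercator (S x) (C x) (psi x) in
  let m' := wave_d (S x) (C x) (P x) (q x) (sg x) (ta x) in
  let m'' := wave_dd (S x) (C x) (P x) (q x) (sg x) (ta x) (P' x) (Q' x) in
  (V * m' + (alpha * V)%R * cross m m' + cross m (effective_field (H1, H2, H3, K) m m''))%vec3 = vzero.
Proof.
  cbv zeta. unfold P', Q', mercator. fold (sg x) (ta x).
  generalize (S2_C2 x) (tanh2_sech2 (psi x)). fold (sg x) (ta x).
  assert (Ec : cosh (psi x) = / sg x).
  { unfold sg. rewrite Rinv_inv. reflexivity. }
  assert (Es : sinh (psi x) = ta x / sg x).
  { unfold sg, ta, tanh. field. generalize (cosh_pos (psi x)). lra. }
  assert (Hsg : sg x <> 0).
  { unfold sg. apply Rinv_neq_0_compat. generalize (cosh_pos (psi x)). lra. }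
  unfold theta_acceleration, psi_acceleration. fold (ta x). rewrite Ec, Es.
  generalize (q x) (P x). revert Hsg. clear Ec Es. clearbody S C P sg ta.
  generalize (S x) (C x) (sg x) (ta x). intros s c g t Hg Q p' E1 E2.
  unfold effective_field, applied_field, wave_d, wave_dd, vzero, vadd, vscal, anisotropy, dot, cross, xhat, yhat, zhat.
  cbn -[Rmult Rplus]. unfold mult, plus, zero, scal; simpl.
repeat (unfold prod_plus, prod_scal, prod_zero, plus, scal, zero, mult; simpl).
  assert (F1 : c * c = 1 - s * s) by lra.
  assert (F2 : t * t = 1 - g * g) by lra.
  apply vec3_zero; field [F1 F2]; exact Hg.
Qed.
End Wave.

(** * Local minima of the potential on the sphere *)

Lemma filterlim_pairs {T} {X Y : UniformSpace} {F : (T -> Prop) -> Prop} {FF : Filter F}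
    (f : T -> X) (g : T -> Y) a b :
  filterlim f F (locally a) -> filterlim g F (locally b) ->
  filterlim (fun x => (f x, g x)) F (locally (a, b)).
Proof.
  intros Hf Hg. apply filterlim_locally. intros e.
  generalize (filter_and _ _ (proj1 (filterlim_locally f a) Hf e) (proj1 (filterlim_locally g b) Hg e)).
  apply filter_imp. intros x [H1 H2]. split; assumption.
Qed.

Lemma filterlim_vec3 {T} {F : (T -> Prop) -> Prop} {FF : Filter F} (f g h : T -> R) a b c :
  filterlim f F (locally a) -> filterlim g F (locally b) -> filterlim h F (locally c) ->
  filterlim (fun x => (f x, g x, h x) : vec3) F (locally ((a, b, c) : vec3)).
Proof. intros Hf Hg Hh. exact (filterlim_pairs _ _ _ _ (filterlim_pairs _ _ _ _ Hf Hg) Hh). Qed.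

Definition energy (H1 H2 H3 K a b c : R) : R :=
  / 2 * (1 - a * a + K * (b * b) - 2 * (H1 * a + H2 * b + H3 * c)).

Lemma potential_energy H1 H2 H3 K a b c :
  potential (H1, H2, H3, K) (a, b, c) = energy H1 H2 H3 K a b c.
Proof.
  unfold potential, energy, applied_field, anisotropy, xhat, yhat, zhat, vadd, vscal, dot.
  repeat (unfold prod_plus, prod_scal, prod_zero, plus, scal, zero, mult; simpl). ring.
Qed.

Lemma sphere_eq a b c : sphere (a, b, c) <-> a * a + b * b + c * c = 1.
Proof. reflexivity. Qed.

(** The gradient of the potential is normal to the sphere, with Lagrange
    multiplier [l]. *)
Definition critical (H1 H2 H3 K l a b c : R) : Prop :=
  a + H1 = l * a /\ - K * b + H2 = l * b /\ H3 = l * c.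

Section Energy.
Variables (H1 H2 H3 K : R).

(** The potential is quadratic, so its expansion at a critical point is exact; the
    linear term is [- l m.(n - m)], and [m.(n - m) = - |n - m|^2 / 2] on the
    sphere. *)
Lemma energy_gap l a b c x y z :
  critical H1 H2 H3 K l a b c -> a * a + b * b + c * c = 1 -> x * x + y * y + z * z = 1 ->
  energy H1 H2 H3 K x y z - energy H1 H2 H3 K a b c =
  / 2 * (l * ((x - a) * (x - a) + (y - b) * (y - b) + (z - c) * (z - c))
         - (x - a) * (x - a) + K * ((y - b) * (y - b))).
Proof.
  intros (E1 & E2 & E3) Hm Hn. unfold energy.
  replace H1 with (l * a - a) by lra. replace H2 with (l * b + K * b) by lra. rewrite E3.
  match goal with |- ?A = ?B => replace A with
    (B - l / 2 * ((x * x + y * y + z * z) - (a * a + b * b + c * c))) by field end.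
  rewrite Hm, Hn. ring.
Qed.

Lemma nonneg_at_0 (f : R -> R) : continuous f 0 ->
  locally 0 (fun r => 0 < r -> 0 <= f r) -> 0 <= f 0.
Proof.
  intros Hf [d Hd]. apply Rnot_lt_le. intros H0.
  assert (He : 0 < - f 0) by lra.
  destruct (proj1 (filterlim_locally f (f 0)) Hf (mkposreal _ He)) as [d' Hd'].
  assert (Hm : 0 < Rmin d d') by (apply Rmin_pos; apply cond_pos).
  assert (Hr : Rabs (Rmin d d' / 2 - 0) = Rmin d d' / 2) by (rewrite Rabs_pos_eq; lra).
  assert (H1' : ball 0 d (Rmin d d' / 2)).
  { change (Rabs (Rmin d d' / 2 - 0) < d). rewrite Hr. generalize (Rmin_l d d'). lra. }
  assert (H2' : ball 0 d' (Rmin d d' / 2)).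
  { change (Rabs (Rmin d d' / 2 - 0) < d'). rewrite Hr. generalize (Rmin_r d d'). lra. }
  generalize (Hd _ H1' ltac:(lra)). specialize (Hd' _ H2').
  change (Rabs (f (Rmin d d' / 2) - f 0) < - f 0) in Hd'.
  apply Rabs_def2 in Hd'. lra.
Qed.

Section LocalMin.
Variables (a b c : R).
Hypothesis (Hmin : local_min_on_sphere (potential (H1, H2, H3, K)) (a, b, c)).
Let Hn : a * a + b * b + c * c = 1 := proj1 Hmin.

(** The potential along the great circle through the point in the direction
    [(x, y, z)], in the rational parametrisation
    [((1 - r^2 N) n + 2 r t) / (1 + r^2 N)], which avoids normalising the tangent
    vector and makes the condition polynomial in [r]. *)
Lemma local_min_along (x y z : R) : a * x + b * y + c * z = 0 ->
  let N := x * x + y * y + z * z in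
  let w := x * (a + H1) + y * (- K * b + H2) + z * H3 in
  let v := a * (a + H1) + b * (- K * b + H2) + c * H3 in
  let Q := fun r => (x - r * N * a) * (x - r * N * a) - K * ((y - r * N * b) * (y - r * N * b)) in
  locally 0 (fun r => 0 <= (1 + r * r * N) * (r * r * N * v - r * w) - r * r * Q r).
Proof.
  intros Hperp N w v Q.
  set (D := fun r => 1 + r * r * N).
  assert (HN : 0 <= N) by (unfold N; nra).
  assert (HD : forall r, 0 < D r).
  { intros r. unfold D. assert (0 <= r * r * N) by (apply Rmult_le_pos; [apply Rle_0_sqr | auto]). lra. }
  set (g := fun n t r => ((1 - r * r * N) * n + 2 * r * t) / D r).
  assert (Hg : forall n t, filterlim (g n t) (locally 0) (locally n)).
  { intros n t.
    assert (E : continuous (g n t) 0).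
    { apply (ex_derive_continuous (g n t)). unfold g, D. auto_derive.
      generalize (HD 0). unfold D. lra. }
    unfold continuous in E. replace (g n t 0) with n in E; [exact E |].
    unfold g, D. field. }
  assert (Hsph : forall r, sphere (g a x r, g b y r, g c z r)).
  { intros r. apply sphere_eq. unfold g.
    transitivity (((1 - r * r * N) * (1 - r * r * N) * (a * a + b * b + c * c)
      + 4 * r * (1 - r * r * N) * (a * x + b * y + c * z) + 4 * r * r * (x * x + y * y + z * z)) / (D r * D r)).
    { field. generalize (HD r). lra. }
    rewrite Hn, Hperp. fold N. unfold D. field. generalize (HD r). unfold D. lra. }
  generalize (filterlim_vec3 _ _ _ _ _ _ (Hg a x) (Hg b y) (Hg c z) _ (proj2 Hmin)).
  unfold filtermap. apply filter_imp. intros r Hr. specialize (Hr (Hsph r)).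
  rewrite !potential_energy in Hr.
  assert (E : (D r * D r) * (energy H1 H2 H3 K (g a x r) (g b y r) (g c z r) - energy H1 H2 H3 K a b c)
     = 2 * ((1 + r * r * N) * (r * r * N * v - r * w) - r * r * Q r)).
  { assert (Hd : forall n t, exists d, g n t r = n + d /\ D r * d = 2 * r * (t - r * N * n)).
    { intros n t. exists (2 * r * (t - r * N * n) / D r).
      generalize (HD r). unfold g, D. intros. split; field; lra. }
    destruct (Hd a x) as (d1 & -> & E1), (Hd b y) as (d2 & -> & E2), (Hd c z) as (d3 & -> & E3).
    transitivity (- D r * (D r * d1 * (a + H1) + D r * d2 * (- K * b + H2) + D r * d3 * H3)
      - / 2 * (D r * d1 * (D r * d1) - K * (D r * d2 * (D r * d2)))).
    - unfold energy. field.
    - rewrite E1, E2, E3. unfold Q, w, v, D. field. }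
  assert (0 <= (D r * D r) * (energy H1 H2 H3 K (g a x r) (g b y r) (g c z r) - energy H1 H2 H3 K a b c)).
  { apply Rmult_le_pos; [generalize (HD r); nra | lra]. }
  lra.
Qed.

Lemma local_min_tangent x y z : a * x + b * y + c * z = 0 ->
  x * (a + H1) + y * (- K * b + H2) + z * H3 <= 0.
Proof.
  intros Hp. generalize (local_min_along x y z Hp). cbv zeta.
  set (N := x * x + y * y + z * z).
  set (w := x * (a + H1) + y * (- K * b + H2) + z * H3).
  set (v := a * (a + H1) + b * (- K * b + H2) + c * H3).
  intros HL.
  set (f := fun r => (1 + r * r * N) * (r * N * v - w)
     - r * ((x - r * N * a) * (x - r * N * a) - K * ((y - r * N * b) * (y - r * N * b)))).
  enough (0 <= f 0) by (unfold f in *; lra).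
  apply nonneg_at_0.
  - apply (ex_derive_continuous f). unfold f. auto_derive. auto.
  - generalize HL. apply filter_imp. intros r Hr Hr0.
    apply (Rmult_le_reg_l r); [exact Hr0 |]. unfold f. lra.
Qed.

Lemma local_min_critical : exists l, critical H1 H2 H3 K l a b c /\
  forall x y z, a * x + b * y + c * z = 0 ->
    x * x - K * (y * y) <= l * (x * x + y * y + z * z).
Proof.
  set (v := a * (a + H1) + b * (- K * b + H2) + c * H3).
  exists v.
  assert (Hc : critical H1 H2 H3 K v a b c).
  { generalize (local_min_tangent (a + H1 - v * a) (- K * b + H2 - v * b) (H3 - v * c)).
    intros Ht.
    assert (Hp : a * (a + H1 - v * a) + b * (- K * b + H2 - v * b) + c * (H3 - v * c) = 0).
    { transitivity (v - v * (a * a + b * b + c * c)); [unfold v; ring | rewrite Hn; ring]. }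
    specialize (Ht Hp).
    set (X := a + H1 - v * a) in *. set (Y := - K * b + H2 - v * b) in *. set (Z := H3 - v * c) in *.
    assert (E : X * (a + H1) + Y * (- K * b + H2) + Z * H3 = X * X + Y * Y + Z * Z).
    { transitivity (X * X + Y * Y + Z * Z + v * (a * X + b * Y + c * Z)); [unfold X, Y, Z; ring | rewrite Hp; ring]. }
    rewrite E in Ht.
    assert (X = 0) by nra. assert (Y = 0) by nra. assert (Z = 0) by nra.
    unfold critical, X, Y, Z in *. repeat split; lra. }
  split; [exact Hc |].
  intros x y z Hp. generalize (local_min_along x y z Hp). cbv zeta. fold v.
  set (N := x * x + y * y + z * z).
  assert (Hw : x * (a + H1) + y * (- K * b + H2) + z * H3 = 0).
  { destruct Hc as (E1 & E2 & E3). rewrite E1, E2, E3 at 1.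
    transitivity (v * (a * x + b * y + c * z)); [ring | rewrite Hp; ring]. }
  rewrite Hw. intros HL.
  set (f := fun r => (1 + r * r * N) * (N * v)
     - ((x - r * N * a) * (x - r * N * a) - K * ((y - r * N * b) * (y - r * N * b)))).
  enough (0 <= f 0) by (unfold f in *; lra).
  apply nonneg_at_0.
  - apply (ex_derive_continuous f). unfold f. auto_derive. auto.
  - generalize HL. apply filter_imp. intros r Hr Hr0.
    apply (Rmult_le_reg_l (r * r)); [nra |]. unfold f. lra.
Qed.
End LocalMin.

Hypothesis (HK : 0 <= K).
Hypothesis (HH1 : Rabs H1 <= / 100) (HH2 : Rabs H2 <= / 100).

(** Since [n - m] is orthogonal to [n + m], Cauchy-Schwarz bounds the first
    component of the chord by the others, with a factor governed by the part of
    [n + m] orthogonal to the x axis.  That part is smaller than the x component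
    needs because [m] is nearly a pole of that axis and [n] is in its hemisphere. *)
Lemma chord_component e a b c x y z : e = 1 \/ e = -1 ->
  a * a + b * b + c * c = 1 -> x * x + y * y + z * z = 1 ->
  99 / 100 <= e * a -> 0 <= e * x ->
  (x - a) * (x - a) <= 3 / 5 * ((x - a) * (x - a) + (y - b) * (y - b) + (z - c) * (z - c)).
Proof.
  intros He Hm Hn Ha Hx.
  set (d1 := x - a). set (d2 := y - b). set (d3 := z - c).
  set (s1 := x + a). set (s2 := y + b). set (s3 := z + c).
  assert (Eo : d1 * s1 + d2 * s2 + d3 * s3 = 0).
  { transitivity ((x * x + y * y + z * z) - (a * a + b * b + c * c));
      [unfold d1, d2, d3, s1, s2, s3; ring | rewrite Hm, Hn; ring]. }
  assert (Ha2 : 98 / 100 <= a * a) by (destruct He as [-> | ->]; nra).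
  assert (Hs1 : 98 / 100 <= s1 * s1) by (unfold s1; destruct He as [-> | ->]; nra).
  assert (Hs : s2 * s2 + s3 * s3 <= 132 / 100).
  { assert (Hyb : 2 * (y * b) <= 15 / 100 * (y * y) + 20 / 3 * (b * b))
      by (generalize (Rle_0_sqr (15 / 100 * y - b)); unfold Rsqr; lra).
    assert (Hzc : 2 * (z * c) <= 15 / 100 * (z * z) + 20 / 3 * (c * c))
      by (generalize (Rle_0_sqr (15 / 100 * z - c)); unfold Rsqr; lra).
    assert (0 <= x * x) by apply Rle_0_sqr.
    unfold s2, s3. lra. }
  assert (HC : d1 * d1 * (s1 * s1) <= (d2 * d2 + d3 * d3) * (s2 * s2 + s3 * s3)).
  { replace (d1 * d1 * (s1 * s1)) with ((d2 * s2 + d3 * s3) * (d2 * s2 + d3 * s3)).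
    - generalize (Rle_0_sqr (d2 * s3 - d3 * s2)). unfold Rsqr. lra.
    - replace (d2 * s2 + d3 * s3) with (- (d1 * s1)) by lra. ring. }
  assert (0 <= d1 * d1) by apply Rle_0_sqr.
  assert (0 <= d2 * d2 + d3 * d3) by (generalize (Rle_0_sqr d2) (Rle_0_sqr d3); unfold Rsqr; lra).
  assert (d1 * d1 * (98 / 100) <= d1 * d1 * (s1 * s1)) by (apply Rmult_le_compat_l; auto).
  assert ((d2 * d2 + d3 * d3) * (s2 * s2 + s3 * s3) <= (d2 * d2 + d3 * d3) * (132 / 100)) by (apply Rmult_le_compat_l; auto).
  lra.
Qed.

Lemma multiplier_near_1 e l a b c : e = 1 \/ e = -1 -> critical H1 H2 H3 K l a b c ->
  99 / 100 <= e * a -> 98 / 100 <= l.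
Proof.
  intros He (E & _) Ha. apply Rabs_le_between in HH1. destruct He as [-> | ->]; nra.
Qed.

Lemma critical_is_local_min e l a b c : e = 1 \/ e = -1 ->
  critical H1 H2 H3 K l a b c -> a * a + b * b + c * c = 1 -> 99 / 100 <= e * a ->
  local_min_on_sphere (potential (H1, H2, H3, K)) (a, b, c).
Proof.
  intros He Hc Hm Ha. split; [exact Hm |].
  generalize (multiplier_near_1 e l a b c He Hc Ha). intros Hl.
  assert (Hd : 0 < / 2) by lra. exists (mkposreal _ Hd).
  intros [[x y] z] [[Hx _] _] Hn. simpl in Hx.
  change (Rabs (x - a) < / 2) in Hx. apply Rabs_def2 in Hx.
  rewrite !potential_energy.
  generalize (energy_gap l a b c x y z Hc Hm Hn).
  assert (Hx0 : 0 <= e * x) by (destruct He as [-> | ->]; lra).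
  generalize (chord_component e a b c x y z He Hm Hn Ha Hx0).
  set (d2 := (x - a) * (x - a) + (y - b) * (y - b) + (z - c) * (z - c)).
  assert (0 <= (y - b) * (y - b)) by apply Rle_0_sqr.
  assert (0 <= (x - a) * (x - a)) by apply Rle_0_sqr.
  assert (0 <= (z - c) * (z - c)) by apply Rle_0_sqr.
  assert (0 <= K * ((y - b) * (y - b))) by (apply Rmult_le_pos; auto).
  assert (0 <= d2) by (unfold d2; lra).
  assert (98 / 100 * d2 <= l * d2) by (apply Rmult_le_compat_r; auto).
  lra.
Qed.

(** Adding the two exact expansions of the potential at the critical point and at
    another minimiser bounds the sum of the multipliers by 6/5, so the second one
    is small.  The gradient condition then forces the second point close to the
    plane orthogonal to x, where the direction of x violates the second-order
    condition. *)
Lemma local_min_unique e l a b c x y z : e = 1 \/ e = -1 ->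
  critical H1 H2 H3 K l a b c -> a * a + b * b + c * c = 1 -> 99 / 100 <= e * a ->
  local_min_on_sphere (potential (H1, H2, H3, K)) (x, y, z) -> 0 < e * x ->
  (x, y, z) = (a, b, c).
Proof.
  intros He Hc Hm Ha Hmin Hx.
  assert (Hn : x * x + y * y + z * z = 1) by apply (proj1 Hmin).
  destruct (local_min_critical x y z Hmin) as (l' & Hc' & Hsec).
  generalize (multiplier_near_1 e l a b c He Hc Ha). intros Hl.
  generalize (energy_gap l a b c x y z Hc Hm Hn) (energy_gap l' x y z a b c Hc' Hn Hm).
  generalize (chord_component e a b c x y z He Hm Hn Ha ltac:(lra)).
  replace ((a - x) * (a - x)) with ((x - a) * (x - a)) by ring.
  replace ((b - y) * (b - y)) with ((y - b) * (y - b)) by ring.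
  replace ((c - z) * (c - z)) with ((z - c) * (z - c)) by ring.
  assert (HX : 0 <= (x - a) * (x - a)) by apply Rle_0_sqr.
  assert (HY : 0 <= (y - b) * (y - b)) by apply Rle_0_sqr.
  assert (HZ : 0 <= (z - c) * (z - c)) by apply Rle_0_sqr.
  assert (HKY : 0 <= K * ((y - b) * (y - b))) by (apply Rmult_le_pos; auto).
  set (D := (x - a) * (x - a) + (y - b) * (y - b) + (z - c) * (z - c)). intros G1 G2 G3.
  destruct (Req_dec D 0) as [HD | HD].
  { assert (x - a = 0) by (unfold D in HD; nra). assert (y - b = 0) by (unfold D in HD; nra).
    assert (z - c = 0) by (unfold D in HD; nra).
    replace x with a by lra. replace y with b by lra. replace z with c by lra. reflexivity. }
  exfalso.
  assert (HD0 : 0 < D) by (unfold D in *; lra).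
  assert (Hll : (l + l') * D <= 6 / 5 * D) by lra.
  assert (Hll' : l + l' <= 6 / 5) by (apply (Rmult_le_reg_r D); auto).
  destruct Hc' as (E1 & E2 & E3).
  apply Rabs_le_between in HH1. apply Rabs_le_between in HH2.
  assert (Hx1 : x * (1 - l') = - H1) by lra.
  assert (Hxs : -2 / 100 <= x <= 2 / 100) by nra.
  assert (Hxx : x * x <= 4 / 10000) by nra.
  assert (Hxx0 : 0 <= x * x) by apply Rle_0_sqr.
  (* The tangential part of the x direction at the point. *)
  generalize (Hsec (1 - x * x) (- x * y) (- x * z)). intros Hs.
  assert (Hp : x * (1 - x * x) + y * (- x * y) + z * (- x * z) = 0).
  { transitivity (x * (1 - (x * x + y * y + z * z))); [ring | rewrite Hn; ring]. }
  specialize (Hs Hp).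
  replace (K * (- x * y * (- x * y))) with (x * x * y * (K * y)) in Hs by ring.
  replace (K * y) with (H2 - l' * y) in Hs by lra.
  replace ((1 - x * x) * (1 - x * x) + - x * y * (- x * y) + - x * z * (- x * z)) with (1 - x * x) in Hs
    by (symmetry; transitivity ((1 - x * x) * (1 - x * x) + x * x * (x * x + y * y + z * z) - x * x * x * x); [ring | rewrite Hn; ring]).
  assert (Hyy : 0 <= y * y <= 1) by (split; [apply Rle_0_sqr | generalize (Rle_0_sqr z); unfold Rsqr; lra]).
  assert (Hy1 : -1 <= y <= 1) by nra.
  set (xx := x * x) in *. set (yy := y * y) in *.
  assert (Hs' : (1 - xx) * (1 - xx) - xx * (y * H2) <= l' * (1 - xx - xx * yy)) by (unfold yy; lra).
  assert (HyH : y * H2 <= / 100) by nra.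
  assert (Hxy : 0 <= xx * yy <= 4 / 10000) by nra.
  assert (xx * (y * H2) <= 4 / 10000 * / 100 + 1) by nra.
  assert (Hleft : 9 / 10 <= (1 - xx) * (1 - xx) - xx * (y * H2)) by nra.
  assert (Hright : l' * (1 - xx - xx * yy) <= 3 / 10) by nra.
  lra.
Qed.
End Energy.

(** * End states of the profile *)

Lemma end_window z (Q : R -> Prop) : z = p_infty \/ z = m_infty -> Rbar_locally z Q ->
  exists x, forall y, x <= y <= x + 1 -> Q y.
Proof.
  intros [-> | ->] [M HM].
  - exists (M + 1). intros y Hy. apply HM. lra.
  - exists (M - 2). intros y Hy. apply HM. lra.
Qed.

Lemma derivative_limit_zero (f g : R -> R) (z : Rbar) (l k : R) : z = p_infty \/ z = m_infty ->
  (forall x, is_derive f x (g x)) ->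
  filterlim f (Rbar_locally z) (locally l) -> filterlim g (Rbar_locally z) (locally k) -> k = 0.
Proof.
  intros Hz Hd Hf Hg. apply Rabs_eq_0. apply Rle_antisym; [| apply Rabs_pos].
  apply le_epsilon. intros e He.
  assert (He3 : 0 < e / 3) by lra.
  destruct (end_window z _ Hz (filter_and _ _
    (proj1 (filterlim_locally f l) Hf (mkposreal _ He3))
    (proj1 (filterlim_locally g k) Hg (mkposreal _ He3)))) as [x Hx].
  assert (Hf' : forall y, x <= y <= x + 1 -> Rabs (f y - l) < e / 3) by (intros y Hy; apply (Hx y Hy)).
  assert (Hg' : forall y, x <= y <= x + 1 -> Rabs (g y - k) < e / 3) by (intros y Hy; apply (Hx y Hy)).
  destruct (MVT_gen f x (x + 1) g) as [c [Hc E]].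
  - intros y _. apply Hd.
  - intros y _. apply continuity_pt_filterlim, (is_derive_continuous f g Hd).
  - rewrite Rmin_left, Rmax_right in Hc by lra.
    generalize (Hf' x ltac:(lra)) (Hf' (x + 1) ltac:(lra)) (Hg' c Hc). intros A1 A2 A3.
    apply Rabs_def2 in A1. apply Rabs_def2 in A2. apply Rabs_def2 in A3.
    apply Rabs_le. lra.
Qed.

Lemma limit_bound {T} {F : (T -> Prop) -> Prop} {FF : ProperFilter F} (f : T -> R) (l B : R) :
  filterlim f F (locally l) -> (forall x, Rabs (f x) <= B) -> Rabs l <= B.
Proof.
  intros Hf HB. apply le_epsilon. intros e He.
  destruct (filter_ex _ (proj1 (filterlim_locally f l) Hf (mkposreal _ He))) as [x Hx].
  change (Rabs (f x - l) < e) in Hx.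
  generalize (HB x) (Rabs_triang (f x) (- (f x - l))). rewrite Rabs_Ropp.
  replace (f x + - (f x - l)) with l by ring. lra.
Qed.

Lemma filterlim_Ropp {T} {F : (T -> Prop) -> Prop} {FF : Filter F} (f : T -> R) a :
  filterlim f F (locally a) -> filterlim (fun x => - f x) F (locally (- a)).
Proof. intros Hf. eapply filterlim_comp; [exact Hf | exact (filterlim_opp a)]. Qed.

Lemma filterlim_Rminus {T} {F : (T -> Prop) -> Prop} {FF : Filter F} (f g : T -> R) a b :
  filterlim f F (locally a) -> filterlim g F (locally b) ->
  filterlim (fun x => f x - g x) F (locally (a - b)).
Proof. intros Hf Hg. apply filterlim_Rplus; [exact Hf | apply filterlim_Ropp, Hg]. Qed.

Ltac solve_limit := lazymatch goal with
  | |- filterlim (fun _ => ?c) _ _ => apply filterlim_const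
  | |- filterlim (fun x => @?f x - @?g x) _ _ => apply (filterlim_Rminus f g); solve_limit
  | |- filterlim (fun x => @?f x + @?g x) _ _ => apply (filterlim_Rplus f g); solve_limit
  | |- filterlim (fun x => @?f x * @?g x) _ _ => apply (filterlim_Rmult f g); solve_limit
  | |- filterlim (fun x => - @?f x) _ _ => apply (filterlim_Ropp f); solve_limit
  | _ => eassumption
  end.

(** All functions have limits at the end [z], and a function that converges together
    with its derivative has derivative tending to 0.  Applied to [u], [psi], [p]
    and [q] this shows that the limit is an equilibrium of the equations. *)
Lemma end_state alpha H1 H2 H3 K V (u p psi q : Cbar) eta z e :
  z = p_infty /\ e = 1 \/ z = m_infty /\ e = -1 ->
  profile alpha (H1, H2, H3, K) V u p psi q ->
  (forall x, Rabs (u x) <= eta) -> (forall x, Rabs (psi x) <= eta) ->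
  exists ul psil l, Rabs ul <= eta /\ Rabs psil <= eta /\
    filterlim (fun x => mercator (tanh x * cos (u x) + / cosh x * sin (u x))
                 (/ cosh x * cos (u x) - tanh x * sin (u x)) (psi x))
      (Rbar_locally z) (locally (mercator (e * cos ul) (- (e * sin ul)) psil)) /\
    critical H1 H2 H3 K l (e * cos ul * / cosh psil) (tanh psil) (- (e * sin ul) * / cosh psil).
Proof.
  intros Hze Hp Bu Bpsi.
  assert (Hz : z = p_infty \/ z = m_infty) by tauto.
  assert (He : e * e = 1) by (destruct Hze as [[_ ->] | [_ ->]]; ring).
  assert (Lt : filterlim tanh (Rbar_locally z) (locally e)).
  { destruct Hze as [[-> ->] | [-> ->]]; [exact tanh_limit_plus | exact tanh_limit_minus]. }
  assert (Ls : filterlim (fun x => / cosh x) (Rbar_locally z) (locally 0)).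
  { destruct Hze as [[-> ->] | [-> ->]]; [exact sech_limit_plus | exact sech_limit_minus]. }
  destruct (proj2 (ev_tame u) z) as [ul Lu], (proj2 (ev_tame p) z) as [pl Lp],
    (proj2 (ev_tame psi) z) as [psil Lpsi], (proj2 (ev_tame q) z) as [ql Lq].
  destruct Hp as [Du Dpsi Dp Dq].
  assert (pl = 0) by exact (derivative_limit_zero u p z ul pl Hz Du Lu Lp).
  assert (ql = 0) by exact (derivative_limit_zero psi q z psil ql Hz Dpsi Lpsi Lq).
  subst pl ql.
  assert (Lcos : filterlim (fun x => cos (u x)) (Rbar_locally z) (locally (cos ul))).
  { apply filterlim_continuous; [apply continuous_cos | exact Lu]. }
  assert (Lsin : filterlim (fun x => sin (u x)) (Rbar_locally z) (locally (sin ul))).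
  { apply filterlim_continuous; [apply continuous_sin | exact Lu]. }
  assert (Ltp : filterlim (fun x => tanh (psi x)) (Rbar_locally z) (locally (tanh psil))).
  { apply filterlim_continuous; [apply (is_derive_continuous _ _ is_derive_tanh) | exact Lpsi]. }
  assert (Lcp : filterlim (fun x => cosh (psi x)) (Rbar_locally z) (locally (cosh psil))).
  { apply filterlim_continuous; [apply (is_derive_continuous _ _ is_derive_cosh) | exact Lpsi]. }
  assert (Lsp : filterlim (fun x => sinh (psi x)) (Rbar_locally z) (locally (sinh psil))).
  { apply filterlim_continuous; [apply (is_derive_continuous _ _ is_derive_sinh) | exact Lpsi]. }
  assert (Lsg : filterlim (fun x => / cosh (psi x)) (Rbar_locally z) (locally (/ cosh psil))).
  { apply (filterlim_continuous (fun y => / cosh y)); [apply (is_derive_continuous _ _ is_derive_sech) | exact Lpsi]. }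
  set (S := fun x => tanh x * cos (u x) + / cosh x * sin (u x)) in *.
  set (C := fun x => / cosh x * cos (u x) - tanh x * sin (u x)) in *.
  assert (LS : filterlim S (Rbar_locally z) (locally (e * cos ul))).
  { replace (e * cos ul) with (e * cos ul + 0 * sin ul) by ring. unfold S. solve_limit. }
  assert (LC : filterlim C (Rbar_locally z) (locally (- (e * sin ul)))).
  { replace (- (e * sin ul)) with (0 * cos ul - e * sin ul) by ring. unfold C. solve_limit. }
  assert (A1 : theta_acceleration alpha H1 H3 V (e * cos ul) (- (e * sin ul)) (0 + 0) psil 0 + 0 * e = 0).
  { apply (derivative_limit_zero p _ z 0 _ Hz Dp Lp).
    change (filterlim (fun x => theta_acceleration alpha H1 H3 V (S x) (C x) (/ cosh x + p x) (psi x) (q x)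
      + / cosh x * tanh x) (Rbar_locally z)
      (locally (theta_acceleration alpha H1 H3 V (e * cos ul) (- (e * sin ul)) (0 + 0) psil 0 + 0 * e))).
    unfold theta_acceleration. solve_limit. }
  assert (A2 : psi_acceleration alpha H1 H2 H3 K V (e * cos ul) (- (e * sin ul)) (0 + 0) psil 0 = 0).
  { apply (derivative_limit_zero q _ z 0 _ Hz Dq Lq).
    change (filterlim (fun x => psi_acceleration alpha H1 H2 H3 K V (S x) (C x) (/ cosh x + p x) (psi x) (q x))
      (Rbar_locally z)
      (locally (psi_acceleration alpha H1 H2 H3 K V (e * cos ul) (- (e * sin ul)) (0 + 0) psil 0))).
    unfold psi_acceleration. solve_limit. }
  exists ul, psil.
  set (s := e * cos ul) in *. set (c := - (e * sin ul)) in *.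
  exists (s * s + cosh psil * (H1 * s + H3 * c)).
  split; [exact (limit_bound u ul eta Lu Bu) |].
  split; [exact (limit_bound psi psil eta Lpsi Bpsi) |]. split.
  - change (filterlim (fun x => (S x * / cosh (psi x), tanh (psi x), C x * / cosh (psi x)) : vec3)
      (Rbar_locally z) (locally ((s * / cosh psil, tanh psil, c * / cosh psil) : vec3))).
    apply filterlim_vec3; solve_limit.
  - assert (E : s * s + c * c = 1).
    { unfold s, c. transitivity ((e * e) * (Rsqr (sin ul) + Rsqr (cos ul))); [unfold Rsqr; ring |].
      rewrite He, sin2_cos2. ring. }
    unfold theta_acceleration in A1. unfold psi_acceleration in A2.
    generalize (cosh_pos psil). intros Hch.
    assert (Esh : sinh psil = tanh psil * cosh psil) by (unfold tanh; field; lra).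
    rewrite Esh in A2. set (g := cosh psil) in *. set (t := tanh psil) in *.
    assert (B1 : g * (H1 * c - H3 * s) = - (s * c)) by lra.
    unfold critical. repeat split.
    + apply (Rmult_eq_reg_l g); [| lra].
      transitivity (s + g * (s * (H1 * s + H3 * c) + c * (H1 * c - H3 * s))).
      { replace (s * (H1 * s + H3 * c) + c * (H1 * c - H3 * s)) with (H1 * (s * s + c * c)) by ring.
        rewrite E. field. lra. }
      rewrite Rmult_plus_distr_l.
      replace (g * (c * (H1 * c - H3 * s))) with (- (s * (c * c)))
        by (transitivity (c * (g * (H1 * c - H3 * s))); [rewrite B1; ring | ring]).
      replace (c * c) with (1 - s * s) by lra. field. lra.
    + lra.
    + apply (Rmult_eq_reg_l g); [| lra].
      transitivity (g * (c * (H1 * s + H3 * c) - s * (H1 * c - H3 * s))).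
      { replace (c * (H1 * s + H3 * c) - s * (H1 * c - H3 * s)) with (H3 * (s * s + c * c)) by ring.
        rewrite E. ring. }
      rewrite Rmult_minus_distr_l.
      replace (g * (s * (H1 * c - H3 * s))) with (- (s * s * c))
        by (transitivity (s * (g * (H1 * c - H3 * s))); [rewrite B1; ring | ring]).
      field. lra.
Qed.

Lemma near_pole : exists eta, 0 < eta /\ forall u psi, Rabs u <= eta -> Rabs psi <= eta ->
  99 / 100 <= cos u * / cosh psi.
Proof.
  assert (He : 0 < / 1000) by lra.
  assert (Hc := continuous_cos 0). assert (Hs := is_derive_continuous _ _ is_derive_sech 0).
  destruct (proj1 (filterlim_locally cos (cos 0)) Hc (mkposreal _ He)) as [d1 Hd1].
  destruct (proj1 (filterlim_locally (fun x => / cosh x) (/ cosh 0)) Hs (mkposreal _ He)) as [d2 Hd2].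
  simpl in *. rewrite cos_0 in Hd1. rewrite cosh_0, Rinv_1 in Hd2.
  exists (Rmin d1 d2 / 2).
  assert (0 < Rmin d1 d2) by (apply Rmin_pos; apply cond_pos).
  split; [lra |]. intros u psi Hu Hpsi.
  assert (A1 : Rabs (cos u - 1) < / 1000).
  { apply Hd1. change (Rabs (u - 0) < d1). rewrite Rminus_0_r. generalize (Rmin_l d1 d2). lra. }
  assert (A2 : Rabs (/ cosh psi - 1) < / 1000).
  { apply Hd2. change (Rabs (psi - 0) < d2). rewrite Rminus_0_r. generalize (Rmin_r d1 d2). lra. }
  apply Rabs_def2 in A1. apply Rabs_def2 in A2.
  apply Rle_trans with (999 / 1000 * (999 / 1000)); [lra |]. apply Rmult_le_compat; lra.
Qed.

(** * Dependence on the parameters, and assembly *)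

(** Evaluation is jointly continuous because the sup norm controls the values
    uniformly in [xi], and each value of [DF] is a continuous function. *)
Lemma continuous_eval {P : NormedModule R_AbsRing} (x0 : P) d (F : P -> Cbar) DF h xi x :
  @C11_on P Cbar_NormedModule (near x0 d) F DF -> near x0 d x ->
  continuous (fun y : R * P => DF (snd y) h (fst y)) (xi, x).
Proof.
  intros [C [C0 HF]] Hx. apply filterlim_locally. intros [e He].
  assert (He2 : 0 < e / 2) by lra.
  assert (HK : 0 < C * norm h + 1).
  { generalize (Rmult_le_pos _ _ C0 (norm_ge_0 h)). lra. }
  assert (Hd : 0 < e / 2 / (C * norm h + 1)) by (apply Rdiv_lt_0_compat; lra).
  destruct (proj1 (filterlim_locally (DF x h) (DF x h xi)) (tame_continuous _ (ev_tame (DF x h)) xi)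
    (mkposreal _ He2)) as [d1 Hd1].
  generalize (filter_and _ _ (locally_near x0 d x Hx) (locally_near x _ x (near_center x _ Hd))).
  intros [d2 Hd2].
  assert (Hm : 0 < Rmin d1 d2) by (apply Rmin_pos; apply cond_pos).
  exists (mkposreal _ Hm). intros [xi' x'] [B1 B2]. simpl in B1, B2.
  change (Rabs (DF x' h xi' - DF x h xi) < e).
  assert (A1 : Rabs (DF x h xi' - DF x h xi) < e / 2).
  { apply Hd1. eapply ball_le; [apply Rmin_l | exact B1]. }
  destruct (Hd2 x') as [N1 N2]; [eapply ball_le; [apply Rmin_r | exact B2] |].
  assert (A2 : Rabs (DF x' h xi' - DF x h xi') <= C * norm (minus x' x) * norm h).
  { eapply Rle_trans; [apply ev_minus_le |]. apply (c11_dlip _ _ _ _ HF); auto. }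
  unfold near in N2.
  assert (A3 : C * norm (minus x' x) * norm h <= e / 2).
  { replace (e / 2) with ((C * norm h + 1) * (e / 2 / (C * norm h + 1))) by (field; lra).
    generalize (norm_ge_0 (minus x' x)) (norm_ge_0 h). intros.
    rewrite Rmult_assoc, (Rmult_comm _ (norm h)), <- Rmult_assoc.
    generalize (Rmult_le_pos _ _ C0 H0). nra. }
  replace (DF x' h xi' - DF x h xi) with ((DF x' h xi' - DF x h xi') + (DF x h xi' - DF x h xi)) by ring.
  eapply Rle_lt_trans; [apply Rabs_triang |]. lra.
Qed.

Lemma C11_eval {P : NormedModule R_AbsRing} S (F : P -> Cbar) DF (xi : R) :
  @C11_on P Cbar_NormedModule S F DF ->
  @C11_on P R_NormedModule S (fun x => F x xi) (fun x h => DF x h xi).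
Proof.
  intros HF.
  exact (C11_smooth_comp S F DF
    (smooth_linear (fun f : Cbar_NormedModule => ev f xi : R_NormedModule)
      (linear_eval (X := Cbar_NormedModule) (fun f => f) xi is_linear_id)) HF).
Qed.

Lemma C11_continuous_der {P Y : NormedModule R_AbsRing} (x0 : P) d (F : P -> Y) DF h x :
  C11_on (near x0 d) F DF -> near x0 d x -> continuous (fun y => DF y h) x.
Proof.
  intros [C [C0 HF]] Hx. apply filterlim_locally. intros [e He].
  assert (HK : 0 < C * norm h + 1).
  { generalize (Rmult_le_pos _ _ C0 (norm_ge_0 h)). lra. }
  assert (Hd : 0 < e / (C * norm h + 1)) by (apply Rdiv_lt_0_compat; lra).
  generalize (filter_and _ _ (locally_near x0 d x Hx) (locally_near x _ x (near_center x _ Hd))).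
  apply filter_imp. intros y [N1 N2]. unfold near in N2.
  apply norm_compat1. simpl.
  eapply Rle_lt_trans; [apply (c11_dlip _ _ _ _ HF); auto |].
  replace e with ((C * norm h + 1) * (e / (C * norm h + 1))) by (field; lra).
  generalize (norm_ge_0 (minus y x)) (norm_ge_0 h). intros.
  rewrite Rmult_assoc, (Rmult_comm _ (norm h)), <- Rmult_assoc.
  generalize (Rmult_le_pos _ _ C0 H0). nra.
Qed.

Lemma near_Walker kappa d H1 H2 H3 K : near (Walker_point kappa) d ((H1, H2, H3, K) : Params) ->
  Rabs H1 < d /\ Rabs H2 < d /\ Rabs H3 < d /\ Rabs (K - kappa) < d.
Proof.
  unfold near. set (D := minus ((H1, H2, H3, K) : Params) (Walker_point kappa)). intros HD.
  generalize (norm_le_prod_norm_1 D) (norm_le_prod_norm_2 D)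
    (norm_le_prod_norm_1 (fst D)) (norm_le_prod_norm_2 (fst D))
    (norm_le_prod_norm_1 (fst (fst D))) (norm_le_prod_norm_2 (fst (fst D))).
  intros N1 N2 N3 N4 N5 N6.
  replace (norm (snd D)) with (Rabs (K - kappa)) in N2 by reflexivity.
  replace (norm (snd (fst D))) with (Rabs H3) in N4
    by (rewrite <- (Rminus_0_r H3) at 1; reflexivity).
  replace (norm (snd (fst (fst D)))) with (Rabs H2) in N6
    by (rewrite <- (Rminus_0_r H2) at 1; reflexivity).
  replace (norm (fst (fst (fst D)))) with (Rabs H1) in N5
    by (rewrite <- (Rminus_0_r H1) at 1; reflexivity).
  repeat split; lra.
Qed.

Section Assembly.
Variables (alpha kappa : R).
Hypothesis (halpha : 0 < alpha) (hkappa : 0 < kappa).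

Definition wall_m1 := smooth_mult (var_sin_theta) (smooth_comp smooth_sech (var_psi alpha kappa hkappa)).
Definition wall_m2 := smooth_comp smooth_tanh (var_psi alpha kappa hkappa).
Definition wall_m3 := smooth_mult (var_cos_theta) (smooth_comp smooth_sech (var_psi alpha kappa hkappa)).

Definition wall (n : Cbar * Cbar) (xi : R) : vec3 :=
  mercator (tanh xi * cos (wall_u n xi) + / cosh xi * sin (wall_u n xi))
           (/ cosh xi * cos (wall_u n xi) - tanh xi * sin (wall_u n xi)) (wall_psi alpha kappa n xi).

Opaque wall_u wall_psi.

Lemma wall_eval n (L : Params) xi :
  wall n xi = (wall_m1 (n, L) xi, wall_m2 (n, L) xi, wall_m3 (n, L) xi).
Proof.
  unfold wall, mercator, wall_m1, wall_m2, wall_m3. f_equal.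
  simpl. f_equal. ring.
Qed.

Lemma wall_zero xi : wall (cst 0, cst 0) xi = Walker_profile xi.
Proof.
  unfold wall, mercator, Walker_profile.
  rewrite (linear_zero_at wall_u xi linear_wall_u).
  rewrite (linear_zero_at (wall_psi alpha kappa) xi (linear_wall_psi alpha kappa hkappa)).
  rewrite cos_0, sin_0, cosh_0, tanh_0, Rinv_1. f_equal; [f_equal |]; ring.
Qed.

Lemma wall_travelling_wave n L : remainder alpha kappa hkappa (n, L) = n ->
  travelling_wave alpha L (wall_V alpha n) (wall n).
Proof.
  intros E. generalize (fixed_point_profile alpha kappa halpha hkappa n L E).
  destruct L as [[[H1 H2] H3] K]. intros Hp. split.
  - intros xi. unfold wall, mercator. apply sphere_eq.
    generalize (S2_C2 (wall_u n) xi) (tanh2_sech2 (wall_psi alpha kappa n xi)). cbv beta zeta. intros E1 E2.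
    set (S := tanh xi * cos (wall_u n xi) + / cosh xi * sin (wall_u n xi)) in *.
    set (C := / cosh xi * cos (wall_u n xi) - tanh xi * sin (wall_u n xi)) in *.
    set (g := / cosh (wall_psi alpha kappa n xi)) in *.
    transitivity ((S * S + C * C) * (g * g) + tanh (wall_psi alpha kappa n xi) * tanh (wall_psi alpha kappa n xi)); [ring |].
    rewrite E1. lra.
  - eexists _, _. intros xi. split; [| split].
    + exact (wave_derive alpha H1 H2 H3 K _ _ _ _ _ Hp xi).
    + exact (wave_d_derive alpha H1 H2 H3 K _ _ _ _ _ Hp xi).
    + exact (wave_equation alpha H1 H2 H3 K _ (wall_u n) (wall_p n) (wall_psi alpha kappa n) (wall_q alpha kappa n) xi).
Qed.

(** At each end the limit is critical and close to the pole [e] of the x axis, so it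
    is a local minimum and the only one in its hemisphere; boundary values must
    therefore be the two limits. *)
Lemma wall_ends (n : Cbar * Cbar) (L : Params) : remainder alpha kappa hkappa (n, L) = n -> forall eta,
  (forall u psi, Rabs u <= eta -> Rabs psi <= eta -> 99 / 100 <= cos u * / cosh psi) ->
  (forall x, Rabs (wall_u n x) <= eta) -> (forall x, Rabs (wall_psi alpha kappa n x) <= eta) ->
  near (Walker_point kappa) (/ 100) L -> near (Walker_point kappa) kappa L ->
  (exists mp mm, boundary_values L mp mm) /\
  forall mp mm, boundary_values L mp mm ->
    filterlim (wall n) (Rbar_locally p_infty) (locally mp) /\
    filterlim (wall n) (Rbar_locally m_infty) (locally mm).
Proof.
  intros E eta Heta Bu Bpsi HL1 HL2.
  generalize (fixed_point_profile alpha kappa halpha hkappa n L E).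
  destruct L as [[[H1 H2] H3] K]. intros Hp.
  destruct (near_Walker _ _ _ _ _ _ HL1) as (A1 & A2 & _ & _).
  destruct (near_Walker _ _ _ _ _ _ HL2) as (_ & _ & _ & A4).
  apply Rabs_def2 in A4. assert (HK : 0 <= K) by lra.
  assert (A1' : Rabs H1 <= / 100) by lra. assert (A2' : Rabs H2 <= / 100) by lra.
  assert (Hend : forall z e, z = p_infty /\ e = 1 \/ z = m_infty /\ e = -1 ->
    exists m : vec3, local_min_on_sphere (potential (H1, H2, H3, K)) m /\ 0 < e * dot xhat m /\
      filterlim (wall n) (Rbar_locally z) (locally m) /\
      forall m', local_min_on_sphere (potential (H1, H2, H3, K)) m' -> 0 < e * dot xhat m' -> m' = m).
  { intros z e Hze.
    destruct (end_state alpha H1 H2 H3 K _ _ _ _ _ eta z e Hze Hp Bu Bpsi)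
      as (ul & psil & l & Hu & Hpsi & Hlim & Hc).
    assert (He : e = 1 \/ e = -1) by tauto.
    assert (Hm : e * cos ul * / cosh psil * (e * cos ul * / cosh psil) + tanh psil * tanh psil
       + - (e * sin ul) * / cosh psil * (- (e * sin ul) * / cosh psil) = 1).
    { transitivity (e * e * (Rsqr (sin ul) + Rsqr (cos ul)) * (/ cosh psil * / cosh psil) + tanh psil * tanh psil).
      - unfold Rsqr. ring.
      - rewrite sin2_cos2. generalize (tanh2_sech2 psil). destruct He as [-> | ->]; lra. }
    assert (Ha : 99 / 100 <= e * (e * cos ul * / cosh psil)).
    { generalize (Heta ul psil Hu Hpsi). destruct He as [-> | ->]; lra. }
    exists (mercator (e * cos ul) (- (e * sin ul)) psil).
    split; [| split; [| split]].
    - apply (critical_is_local_min H1 H2 H3 K HK A1' e l); auto.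
    - unfold mercator, xhat, dot. lra.
    - exact Hlim.
    - intros [[x y] w] Hmin Hx.
      apply (local_min_unique H1 H2 H3 K HK A1' A2' e l); auto.
      unfold xhat, dot in Hx. lra. }
  destruct (Hend p_infty 1) as (mp & P1 & P2 & P3 & P4); [auto |].
  destruct (Hend m_infty (-1)) as (mm & M1 & M2 & M3 & M4); [auto |].
  split.
  - exists mp, mm. repeat split; try (apply P1 || apply M1); try lra.
    intros ->. lra.
  - intros mp' mm' (_ & B1 & B2 & B3 & B4).
    rewrite (P4 mp' B1) by lra. rewrite (M4 mm' B2) by lra. auto.
Qed.

(** The chain rule is applied in [Cbar], to the components of the wall along
    [L |-> (w L, 0)], and only then are the results evaluated at [xi]. *)
Lemma wall_C1 d (w : Params -> Cbar2) dw : C11_on (near (Walker_point kappa) d) w dw ->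
  C1_in_param_on (near (Walker_point kappa) d) (fun xi L => wall (w L) xi).
Proof.
  intros Hw.
  set (NW := near (Walker_point kappa) d).
  assert (HwL : C11_on NW (fun L => (w L, zero) : prod_NormedModule R_AbsRing Cbar2 Params)
     (fun L h => (dw L h, zero))).
  { apply C11_pair; [exact Hw | apply C11_const]. }
  set (m := fun s : smooth (prod_NormedModule R_AbsRing Cbar2 Params) Cbar_NormedModule =>
    fun L => s (w L, zero)).
  set (dm := fun s : smooth (prod_NormedModule R_AbsRing Cbar2 Params) Cbar_NormedModule =>
    fun L h => sm_der s (w L, zero) (dw L h, zero)).
  assert (Hm : forall s, @C11_on Params Cbar_NormedModule NW (m s) (dm s)).
  { intros s. apply (C11_smooth_comp NW _ _ s HwL). }
  exists (fun xi L h => (dm wall_m1 L h xi, dm wall_m2 L h xi, dm wall_m3 L h xi)).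
  intros xi L HL. split.
  - refine (C11_filterdiff (Walker_point kappa) d (fun L => wall (w L) xi)
      (fun L h => (dm wall_m1 L h xi, dm wall_m2 L h xi, dm wall_m3 L h xi)) L _ HL).
    destruct (C11_pair _ _ _ _ _ (C11_pair _ _ _ _ _ (C11_eval _ _ _ xi (Hm wall_m1))
      (C11_eval _ _ _ xi (Hm wall_m2))) (C11_eval _ _ _ xi (Hm wall_m3))) as [C [C0 HC]].
    exists C. split; [exact C0 |].
    replace (fun L0 => wall (w L0) xi) with (fun L0 => (m wall_m1 L0 xi, m wall_m2 L0 xi, m wall_m3 L0 xi)).
    + exact HC.
    + apply FunctionalExtensionality.functional_extensionality. intros L0. symmetry.
      apply wall_eval.
  - intros h.
    assert (Hc : forall s, continuous (fun p : R * Params => dm s (snd p) h (fst p)) (xi, L)).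
    { intros s. exact (continuous_eval (Walker_point kappa) d (m s) (dm s) h xi L (Hm s) HL). }
    exact (filterlim_vec3 _ _ _ _ _ _ (Hc wall_m1) (Hc wall_m2) (Hc wall_m3)).
Qed.
End Assembly.

Lemma C11_pointwise_small {P : NormedModule R_AbsRing} (x0 : P) d (F : P -> Cbar) DF eta :
  0 < d -> 0 < eta -> @C11_on P Cbar_NormedModule (near x0 d) F DF -> (forall xi, F x0 xi = 0) ->
  exists d', 0 < d' <= d /\ forall x, near x0 d' x -> forall xi, Rabs (F x xi) <= eta.
Proof.
  intros Hd He [C [C0 HF]] H0.
  assert (Hq : 0 < eta / (C + 1)) by (apply Rdiv_lt_0_compat; lra).
  exists (Rmin d (eta / (C + 1))). split.
  { split; [apply Rmin_pos; auto | apply Rmin_l]. }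
  intros x Hx xi. unfold near in Hx.
  assert (Hx1 : near x0 d x) by (eapply Rlt_le_trans; [exact Hx | apply Rmin_l]).
  assert (Hx2 : norm (minus x x0) < eta / (C + 1)) by (eapply Rlt_le_trans; [exact Hx | apply Rmin_r]).
  generalize (c11_lip _ _ _ _ HF x0 x (near_center _ _ Hd) Hx1) (ev_minus_le (F x) (F x0) xi).
  rewrite H0, Rminus_0_r. intros A B.
  eapply Rle_trans; [exact B |]. eapply Rle_trans; [exact A |].
  replace eta with ((C + 1) * (eta / (C + 1))) by (field; lra).
  apply Rmult_le_compat; auto using norm_ge_0; lra.
Qed.

Theorem theorem4p1 (alpha kappa : R) (halpha : 0 < alpha) (hkappa : 0 < kappa) :
  exists D : param -> Prop, open D /\ D (Walker_param kappa) /\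
  exists (m : R -> param -> vec3) (V : param -> R),
    (forall L : param, D L ->
       travelling_wave alpha L (V L) (fun xi => m xi L) /\
       (exists mp mm : vec3, boundary_values L mp mm) /\
       (forall mp mm : vec3, boundary_values L mp mm ->
          filterlim (fun xi => m xi L) (Rbar_locally p_infty) (locally mp) /\
          filterlim (fun xi => m xi L) (Rbar_locally m_infty) (locally mm))) /\
    C1_in_param_on D m /\
    C1_on D V /\
    (forall xi : R, m xi (Walker_param kappa) = Walker_profile xi).
Proof.
  destruct (fixed_point_family alpha kappa hkappa) as (d & w & dw & Hd & Hw0 & Hfix & Hw).
  destruct near_pole as (eta & Heta0 & Heta).
  assert (Hu : @C11_on Params Cbar_NormedModule (near (Walker_point kappa) d) (fun L => wall_u (w L))
     (fun L h => wall_u (dw L h))).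
  { exact (C11_smooth_comp _ w dw (smooth_linear wall_u linear_wall_u) Hw). }
  assert (Hpsi : @C11_on Params Cbar_NormedModule (near (Walker_point kappa) d)
     (fun L => wall_psi alpha kappa (w L)) (fun L h => wall_psi alpha kappa (dw L h))).
  { exact (C11_smooth_comp _ w dw (smooth_linear _ (linear_wall_psi alpha kappa hkappa)) Hw). }
  destruct (C11_pointwise_small _ _ _ _ eta Hd Heta0 Hu) as (d1 & Hd1 & Hsu).
  { intros xi. rewrite Hw0. apply (linear_zero_at wall_u xi linear_wall_u). }
  destruct (C11_pointwise_small _ _ _ _ eta Hd Heta0 Hpsi) as (d2 & Hd2 & Hspsi).
  { intros xi. rewrite Hw0. apply (linear_zero_at _ xi (linear_wall_psi alpha kappa hkappa)). }
  assert (Hdelta : exists delta, 0 < delta /\ delta <= d1 /\ delta <= d2 /\ delta <= / 100 /\ delta <= kappa).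
  { exists (Rmin (Rmin d1 d2) (Rmin (/ 100) kappa)).
    generalize (Rmin_l (Rmin d1 d2) (Rmin (/ 100) kappa)) (Rmin_r (Rmin d1 d2) (Rmin (/ 100) kappa))
      (Rmin_l d1 d2) (Rmin_r d1 d2) (Rmin_l (/ 100) kappa) (Rmin_r (/ 100) kappa).
    intros. split; [repeat apply Rmin_pos; lra |]. repeat split; lra. }
  destruct Hdelta as (delta & D0 & D1 & D2 & D3 & D4).
  assert (Hnear : forall r L, delta <= r -> near (Walker_point kappa) delta L -> near (Walker_point kappa) r L)
    by (intros r L Hr HL; unfold near in *; lra).
  assert (Hwd : C11_on (near (Walker_point kappa) delta) w dw).
  { destruct Hw as [C [C0 HC]]. exists C. split; [exact C0 |].
    apply C11_weaken with (3 := HC); [lra |]. intros L. apply Hnear. lra. }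
  exists (near (Walker_point kappa) delta).
  split; [exact (@locally_near Params (Walker_point kappa) delta) |].
  split; [apply near_center; exact D0 |].
  exists (fun xi L => wall alpha kappa (w L) xi), (fun L => wall_V alpha (w L)).
  split; [| split; [| split]].
  - intros L HL.
    assert (E : remainder alpha kappa hkappa (w L, L) = w L) by (apply Hfix, (Hnear d); [lra | exact HL]).
    split; [exact (wall_travelling_wave alpha kappa halpha hkappa (w L) L E) |].
    apply (wall_ends alpha kappa halpha hkappa (w L) L E eta Heta);
      [apply Hsu, (Hnear d1) | apply Hspsi, (Hnear d2) | apply (Hnear (/ 100)) | apply (Hnear kappa)];
      assumption.
  - exact (wall_C1 alpha kappa hkappa delta w dw Hwd).
  - assert (HV : @C11_on Params R_NormedModule (near (Walker_point kappa) delta) (fun L => wall_V alpha (w L))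
       (fun L h => wall_V alpha (dw L h))).
    { exact (C11_smooth_comp _ w dw (smooth_linear _ (linear_wall_V alpha)) Hwd). }
    exists (fun L h => wall_V alpha (dw L h)). intros L HL. split.
    + exact (C11_filterdiff _ _ _ _ _ HV HL).
    + intros h. exact (C11_continuous_der _ _ _ _ h L HV HL).
  - intros xi. change (Walker_param kappa) with (Walker_point kappa : param).
    rewrite Hw0. apply wall_zero. exact hkappa.
Qed.
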